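(* Let $0<\beta<1$ and $h=0$. Define $$H := \frac{1}{N}\sum_{1\le i<j\le N} g_{ij}\sigma_i\sigma_j - \frac{\sqrt N\beta}{2}.$$ Then there is a constant $C(\beta)$ depending only on $\beta$ such that for every $N$ and every bounded measurable $u:\mathbb{R}\to\mathbb{R}$, $$\mathbb{E}\Bigl(\langle u(H)\rangle - \int_{\mathbb{R}} u(t)\,\phi_{0,1/2}(t)\,dt\Bigr)^2 \le \frac{C(\beta)\|u\|_\infty^2}{N}.$$
   Context: Sherrington–Kirkpatrick model: for a positive integer $N$, let $\Sigma_N=\{-1,1\}^N$ and let $g=(g_{ij})_{1\le i<j\le N}$ be i.i.d. standard Gaussian random variables (the disorder). Given $g$, the Gibbs measure on $\Sigma_N$ is $G_N(\sigma)=Z_N^{-1}\exp\bigl(\frac{\beta}{\sqrt N}\sum_{1\le i<j\le N} g_{ij}\sigma_i\sigma_j + h\sum_{i=1}^N\sigma_i\bigr)$, with $Z_N$ the normalizing constant. $\langle\cdot\rangle$ denotes the quenched average over $\sigma\sim G_N$ with $g$ fixed, and $\mathbb{E}$ is expectation over the disorder. $\phi_{0,1/2}(t)=\frac{1}{\sqrt{\pi}}e^{-t^2}$ is the Gaussian density with mean $0$ and variance $1/2$. *)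

(* Defs.v *)
From HB Require Import structures.
From mathcomp Require Import all_boot all_order all_algebra.
From mathcomp Require Import all_classical all_reals all_analysis.
Set Implicit Arguments. Unset Strict Implicit. Unset Printing Implicit Defensive.
Import Order.TTheory GRing.Theory Num.Theory.
Local Open Scope classical_set_scope.
Local Open Scope ring_scope.

Section SK.
Context {R : realType}.

(* A configuration sigma in Sigma_N = {-1,1}^N is encoded by s : {ffun 'I_N -> bool},
   with sigma_i = spin s i = +1 if s i is true and -1 otherwise. *)
Definition spin (N : nat) (s : {ffun 'I_N -> bool}) (i : 'I_N) : R :=
  if s i then 1 else -1.

Definition pair_energy (N : nat) (g : 'I_N -> 'I_N -> R) (s : {ffun 'I_N -> bool}) : R :=
  \sum_(i < N) \sum_(j < N | (i < j)%N) g i j * spin s i * spin s j.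

Definition gibbs_weight (N : nat) (beta h : R) (g : 'I_N -> 'I_N -> R)
    (s : {ffun 'I_N -> bool}) : R :=
  expR (beta / Num.sqrt (N%:R) * pair_energy g s + h * \sum_(i < N) spin s i).

Definition partition_fun (N : nat) (beta h : R) (g : 'I_N -> 'I_N -> R) : R :=
  \sum_(s : {ffun 'I_N -> bool}) gibbs_weight beta h g s.

Definition gibbs_avg (N : nat) (beta h : R) (g : 'I_N -> 'I_N -> R)
    (f : {ffun 'I_N -> bool} -> R) : R :=
  \sum_(s : {ffun 'I_N -> bool})
     f s * (gibbs_weight beta h g s / partition_fun beta h g).

Definition Hstat (N : nat) (beta : R) (g : 'I_N -> 'I_N -> R)
    (s : {ffun 'I_N -> bool}) : R :=
  (N%:R)^-1 * pair_energy g s - Num.sqrt (N%:R) * beta / 2.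

Definition phi_half (t : R) : R := (Num.sqrt pi)^-1 * expR (- t ^+ 2).

Definition sup_norm (u : R -> R) : R := sup [set `|u t| | t in [set: R]].

Definition disorder_independent d (T : measurableType d) (P : probability T R)
    (N : nat) (g : 'I_N -> 'I_N -> T -> R) : Prop :=
  forall (J : {set 'I_N * 'I_N}) (A : 'I_N * 'I_N -> set R),
    (forall p, p \in J -> (p.1 < p.2)%N) ->
    (forall p, measurable (A p)) ->
    P (\bigcap_(p in [set q | q \in J]) (g p.1 p.2 @^-1` A p)) =
    (\prod_(p in J) P (g p.1 p.2 @^-1` A p))%E.

Definition disorder_std_gaussian d (T : measurableType d) (P : probability T R)
    (N : nat) (g : 'I_N -> 'I_N -> T -> R) : Prop :=
  forall i j : 'I_N, (i < j)%N ->
    measurable_fun [set: T] (g i j) /\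
    forall A : set R, measurable A -> P (g i j @^-1` A) = normal_prob 0 1 A.

End SK.

(* Main.v *)
(** Stein's method under the Gibbs measure. Write the disorder as a standard
    Gaussian vector y indexed by pairs p = (i, j), let a_p = sigma_i sigma_j,
    and for a test function psi let V_p = <a_p psi(H)> and
    delta V = sum_p (y_p V_p - d_p V_p). Algebra gives, with kap = 1 / N,
    b = beta / sqrt N and two replicas s, t with Q(s, t) = sum_p a_p(s) a_p(t),
      <psi'(H) - 2 H psi(H)> = - 2 kap delta V + kap <psi'(H)> + b <psi(H)>
                               + 2 b kap <Q(s, t) psi(H(s))>,
    while Gaussian integration by parts gives
      E (delta V)^2 = sum_p E V_p^2 + sum_(p, q) E (d_q V_p) (d_p V_q).
    Since the derivatives of V are Gibbs correlations, all terms are O(1 / N)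
    as soon as E <(Q / N)^2> is bounded.

    That bound uses beta < 1. Let L = ln (Z / E Z). The second moment of Z is
    comparable to the square of its mean even after tilting by exp (lam Q / N),
    so Jensen's inequality bounds lam E <Q / N> by a constant plus 2 m, where
    m = - E L. The Efron-Stein inequality bounds Var L by 4 E <Q / N> + 5, and a
    Paley-Zygmund argument bounds (m - 1)^2 by a multiple of Var L: hence m,
    Var L and E L^2 are bounded, and then the tilted moment controls
    E <(Q / N)^2>.

    Finally psi solves Stein's equation psi' - 2 x psi = u - int u phi. The
    function u is only measurable, so it is replaced by moving averages, which
    converge to it almost everywhere; this suffices because H, as a function of
    y at a fixed configuration, has an absolutely continuous law. *)

Require Import Defs.
From HB Require Import structures.
From mathcomp Require Import all_boot all_order all_algebra.
From mathcomp Require Import all_classical all_reals all_analysis measurable_realfun.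
From mathcomp Require Import ring lra.
Import Order.TTheory GRing.Theory Num.Theory numFieldNormedType.Exports.
Local Open Scope classical_set_scope.
Local Open Scope ring_scope.
Set Implicit Arguments.
Unset Strict Implicit.
Unset Printing Implicit Defensive.

(** * One-dimensional Gaussian integrals *)

(** The bounds on m, Var L and E <Q / N> are circular: Var L is controlled by E <Q / N>, this by m,
    and m by Var L. The loop closes because m enters quadratically on one side and linearly on the
    other. The second moment of Z alone does not bound E <(Q / N)^2>, since the weight (Z / E Z)^2
    can suppress the disorders where Z is small; the bound on E L^2 is what removes this weight.

    The rate comes from sizes: b^2 <= kap = 1 / N, and the number n of pairs satisfies 2 n kap^2 = 1
    - kap. The shift beta sqrt N / 2 in H and the variance 1 / 2 are exactly those for which the
    terms of order one in the identity cancel, leaving coefficients kap and b. Sums over pairs of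
    products of Gibbs averages become overlaps of two replicas.

    In E (delta V)^2 the second derivatives of V cancel by symmetry, so the final bound involves
    only the sup norms of psi and psi'. This allows psi to be smoothed at no cost, although the
    identity is proved for psi of class C^2. *)

Section GaussianLine.
Import HBNNSimple.
Context {R : realType}.
Local Notation lam := (@lebesgue_measure R).

(** Both sides commute with increasing limits of simple functions, and on the indicator of a
    measurable set the identity is the definition of [normal_prob]. *)
Lemma ge0_integral_normal_prob (m s : R) (f : measurableTypeR R -> \bar R) :
  measurable_fun [set: measurableTypeR R] f -> (forall x, 0 <= f x)%E ->
  (\int[normal_prob m s]_x f x = \int[lam]_x (f x * (normal_pdf m s x)%:E))%E.
Proof.
move=> mf f0.
pose f_ := nnsfun_approx measurableT mf.
have mpdf : measurable_fun [set: measurableTypeR R] (EFin \o normal_pdf m s).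
  by apply/measurable_EFinP; exact: measurable_normal_pdf.
transitivity (limn (fun n => \int[normal_prob m s]_x (f_ n x)%:E))%E.
  rewrite -monotone_convergence//=.
  - apply: eq_integral => x _; apply/esym/cvg_lim => //=.
    exact: cvg_nnsfun_approx.
  - by move=> n; exact/measurable_EFinP.
  - by move=> n x _; rewrite lee_fin.
  - by move=> x _ a b ab; rewrite lee_fin//; exact/lefP/nd_nnsfun_approx.
transitivity (limn (fun n => \int[lam]_x ((f_ n x)%:E * (normal_pdf m s x)%:E)))%E; last first.
  rewrite -monotone_convergence//=.
  - apply: eq_integral => x _; apply/cvg_lim => //=.
    apply: cvgeZr => //.
    exact: cvg_nnsfun_approx.
  - move=> n; apply: emeasurable_funM => //.
    exact/measurable_EFinP.
  - by move=> n x _; rewrite -EFinM lee_fin mulr_ge0// normal_pdf_ge0.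
  - move=> x _ a b ab; rewrite -!EFinM lee_fin//.
    by rewrite ler_wpM2r ?normal_pdf_ge0//; exact/lefP/nd_nnsfun_approx.
congr (limn _); apply/funext => n.
have mi (r : R) : measurable (f_ n @^-1` [set r]) by [].
under eq_integral do rewrite fimfunE -fsumEFin//.
rewrite ge0_integral_fsum//; last 2 first.
  - by move=> r; apply/measurable_EFinP; apply: measurable_funM.
  - by move=> r x _; rewrite EFinM nnfun_muleindic_ge0.
under [RHS]eq_integral.
  move=> x _; rewrite fimfunE -fsumEFin// ge0_mule_fsuml; last first.
    by move=> r; rewrite EFinM nnfun_muleindic_ge0.
  over.
rewrite [RHS]ge0_integral_fsum//; last 2 first.
  - by move=> r; apply: emeasurable_funM => //; apply/measurable_EFinP; apply: measurable_funM.
  - move=> r x _; apply: mule_ge0; first by rewrite EFinM nnfun_muleindic_ge0.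
    by rewrite lee_fin normal_pdf_ge0.
apply: eq_fsbigr => r /set_mem [x _ <-].
transitivity ((f_ n x)%:E * normal_prob m s (f_ n @^-1` [set f_ n x]))%E.
  under eq_integral do rewrite EFinM.
  rewrite ge0_integralZl//; last 2 first.
  - by apply/measurable_EFinP.
  - by rewrite lee_fin.
  by rewrite integral_indic// setIT.
under [RHS]eq_integral do rewrite EFinM -muleA.
rewrite ge0_integralZl//; last 3 first.
  - by apply: emeasurable_funM => //; apply/measurable_EFinP.
  - by move=> y _; rewrite mule_ge0// lee_fin ?normal_pdf_ge0.
  - by rewrite lee_fin.
congr (_ * _)%E. rewrite /normal_prob [LHS]integral_mkcond; apply: eq_integral => y _.
rewrite patchE indicE; case: ifPn => _; by rewrite ?mul1e ?mul0e.
Qed.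

End GaussianLine.

Section GaussianMoments.
Context {R : realType}.
Local Notation lam := (@lebesgue_measure R).
Local Notation gam := (@normal_prob R 0 1).

Lemma normal_pdf01E (x : R) :
  normal_pdf 0 1 x = normal_peak 1 * expR (- (x ^+ 2 / 2)).
Proof.
rewrite normal_pdfE ?oner_neq0// /normal_fun subr0 expr1n mulNr.
by [].
Qed.

Lemma measurable_expRM (c : R) : measurable_fun [set: R] (fun x : R => expR (c * x)).
Proof. by apply: measurableT_comp => //; exact: measurable_funM. Qed.

Lemma measurable_expRM_norm (c : R) :
  measurable_fun [set: R] (fun x : R => expR (c * `|x|)).
Proof.
by apply: measurableT_comp => //; apply: measurable_funM.
Qed.

(** Completing the square: the tilt turns the centred density into [expR (c ^+ 2 / 2)] times the
    density of mean [c], which has mass 1. *)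
Lemma integral_normal_expR (c : R) :
  (\int[gam]_x (expR (c * x))%:E = (expR (c ^+ 2 / 2))%:E)%E.
Proof.
rewrite ge0_integral_normal_prob//; last by apply/measurable_EFinP; exact: measurable_expRM.
transitivity (\int[lam]_x ((expR (c ^+ 2 / 2))%:E * (normal_pdf c 1 x)%:E))%E.
  apply: eq_integral => x _; rewrite -!EFinM; congr EFin.
  rewrite normal_pdf01E normal_pdfE ?oner_neq0// /normal_fun.
  rewrite mulrCA -expRD [RHS]mulrCA -expRD; congr (_ * expR _).
  by rewrite expr1n; field.
rewrite ge0_integralZl ?integral_normal_pdf ?mule1//.
- by apply/measurable_EFinP; exact: measurable_normal_pdf.
- by move=> x _; rewrite lee_fin normal_pdf_ge0.
Qed.

(** A quadratic tilt keeps the density Gaussian, with variance [(1 - k)^-1], as long as [k < 1]. The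
    restriction beta < 1 enters through this condition, [k] being at least beta^2 in the
    application. *)
Lemma normal_pdf01_expR_sqr (k x : R) : k < 1 ->
  expR (k * x ^+ 2 / 2) * normal_pdf 0 1 x =
  (Num.sqrt (1 - k))^-1 * normal_pdf 0 (Num.sqrt (1 - k))^-1 x.
Proof.
move=> k1; have k0 : 0 < 1 - k by rewrite subr_gt0.
have s0 : 0 < Num.sqrt (1 - k) by rewrite sqrtr_gt0.
set s := (Num.sqrt (1 - k))^-1.
have sp : 0 < s by rewrite invr_gt0.
have s2 : s ^+ 2 = (1 - k)^-1 by rewrite exprVn sqr_sqrtr// ltW.
rewrite normal_pdf01E normal_pdfE ?(gt_eqF sp)// /normal_fun.
have pk : normal_peak s = s^-1 * normal_peak 1.
  rewrite /normal_peak expr1n mul1r -mulrnAr (sqrtrM _ (sqr_ge0 s)).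
  by rewrite sqrtr_sqr (gtr0_norm sp) invfM.
have se : k * x ^+ 2 / 2 - x ^+ 2 / 2 = - (x - 0) ^+ 2 / (s ^+ 2 *+ 2).
  by rewrite subr0 s2 -[X in _ = _ / X]mulr_natr; field; rewrite gt_eqF.
by rewrite mulrCA -expRD se pk !mulrA divff ?mul1r// gt_eqF.
Qed.

Lemma integral_normal_expR_sqr (k : R) : k < 1 ->
  (\int[gam]_x (expR (k * x ^+ 2 / 2))%:E = ((Num.sqrt (1 - k))^-1)%:E)%E.
Proof.
move=> k1.
have me : measurable_fun [set: R] (fun x : R => expR (k * x ^+ 2 / 2)).
  apply: measurableT_comp => //.
  by apply: measurable_funM => //; apply: measurable_funM.
rewrite ge0_integral_normal_prob//; last exact/measurable_EFinP.
under eq_integral do rewrite -EFinM normal_pdf01_expR_sqr// EFinM.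
rewrite ge0_integralZl ?integral_normal_pdf ?mule1//.
- by apply/measurable_EFinP; exact: measurable_normal_pdf.
- by move=> x _; rewrite lee_fin normal_pdf_ge0.
Qed.

Lemma expR_norm_le (c x : R) : expR (c * `|x|) <= expR (c * x) + expR ((- c) * x).
Proof.
have [x0|x0] := leP 0 x.
  by rewrite ger0_norm// lerDl expR_ge0.
by rewrite ltr0_norm// mulrN mulNr lerDr expR_ge0.
Qed.

Lemma integral_normal_expR_norm (c : R) :
  (\int[gam]_x (expR (c * `|x|))%:E <= (2 * expR (c ^+ 2 / 2))%:E)%E.
Proof.
have me (a : R) : measurable_fun [set: measurableTypeR R] (fun x => (expR (a * x))%:E).
  by apply/measurable_EFinP; exact: measurable_expRM.
apply: (@le_trans _ _ (\int[gam]_x ((expR (c * x))%:E + (expR ((- c) * x))%:E))%E).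
  apply: ge0_le_integral => //.
  - by apply/measurable_EFinP; exact: measurable_expRM_norm.
  - by apply: emeasurable_funD => //; exact: me.
  - by move=> x _; rewrite -EFinD lee_fin expR_norm_le.
rewrite ge0_integralD//.
rewrite !integral_normal_expR -EFinD sqrrN lee_fin.
by rewrite mulr2n mulrDl !mul1r.
Qed.

Lemma integrable_normal (f : R -> R) (c : R) : measurable_fun [set: R] f ->
  (forall x, `|f x| <= c * expR (c * `|x|)) -> gam.-integrable [set: R] (EFin \o f).
Proof.
move=> mf fc; apply/integrableP; split; first exact/measurable_EFinP.
have me := measurable_expRM_norm c.
have c0 : 0 <= c.
  have := fc 0; rewrite normr0 mulr0 expR0 mulr1; exact: le_trans.
apply: (@le_lt_trans _ _ (\int[gam]_x (c%:E * (expR (c * `|x|))%:E)))%E.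
  apply: ge0_le_integral => //.
  - by apply/measurable_EFinP; exact: measurableT_comp.
  - by apply: emeasurable_funM => //; exact/measurable_EFinP.
  - by move=> x _; rewrite -EFinM /= lee_fin.
rewrite ge0_integralZl//; last exact/measurable_EFinP.
apply: (@le_lt_trans _ _ (c%:E * (2 * expR (c ^+ 2 / 2))%:E)%E).
  by apply: lee_wpmul2l; [rewrite lee_fin|exact: integral_normal_expR_norm].
by rewrite -EFinM ltry.
Qed.

Lemma integral_normal_pdfE (f : R -> R) (c : R) : measurable_fun [set: R] f ->
  (forall x, `|f x| <= c * expR (c * `|x|)) ->
  lam.-integrable [set: R] (fun x => (f x * normal_pdf 0 1 x)%:E) /\
  (\int[gam]_x (f x)%:E = \int[lam]_x (f x * normal_pdf 0 1 x)%:E)%E.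
Proof.
move=> mf fc; have fi := integrable_normal mf fc.
have mpdf := @measurable_normal_pdf R 0 1.
have mE : measurable_fun [set: measurableTypeR R] (EFin \o f) by exact/measurable_EFinP.
split.
  apply/integrableP; split; first by apply/measurable_EFinP; exact: measurable_funM.
  have /integrableP[_] := fi.
  rewrite ge0_integral_normal_prob//; last exact: measurableT_comp.
  congr (_ < _)%E; apply: eq_integral => x _ /=.
  by rewrite normrM EFinM (ger0_norm (normal_pdf_ge0 _ _ _)).
rewrite integralE [RHS]integralE.
rewrite !ge0_integral_normal_prob//; last 2 first.
  exact: measurable_funeneg.
  exact: measurable_funepos.
congr (_ - _)%E; apply: eq_integral => x _.
  rewrite !funeposE /= -!EFin_max -EFinM; congr EFin.
  by rewrite maxr_pMl ?normal_pdf_ge0// mul0r.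
rewrite !funenegE /= -!EFin_max -EFinM; congr EFin.
by rewrite maxr_pMl ?normal_pdf_ge0// mul0r mulNr.
Qed.

End GaussianMoments.

(** * Gaussian integration by parts in one variable *)

Section GaussianIBP.
Context {R : realType}.
Local Notation lam := (@lebesgue_measure R).
Local Notation gam := (@normal_prob R 0 1).

Lemma cvg_integral_symitv (h : R -> R) : measurable_fun [set: R] h ->
  lam.-integrable [set: R] (EFin \o h) ->
  (fun n : nat => \int[lam]_(x in `[(- n%:R)%R, n%:R]) (h x)%:E)%E @ \oo -->
  (\int[lam]_x (h x)%:E)%E.
Proof.
move=> mh ih.
have mh' : measurable_fun [set: measurableTypeR R] (EFin \o h) by exact/measurable_EFinP.
have := @dominated_convergence _ (measurableTypeR R) R lam setT measurableT
  (fun n => (EFin \o h) \_ `[(- n%:R)%R, n%:R]) (EFin \o h) (fun x => `|(h x)%:E|)%E.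
case.
- move=> n; apply: (iffLR (measurable_restrictT _ _)); first exact: measurable_itv.
  exact: (measurable_funS measurableT (@subsetT _ _) mh').
- exact: mh'.
- apply: aeW => x _; apply: cvg_near_cst; near=> n.
  rewrite patchE ifT// inE/= in_itv/= -ler_norml.
  near: n; exact: nbhs_infty_ger.
- exact: integrable_abse.
- apply: aeW => x n _; rewrite patchE; case: ifPn => // _.
  by rewrite abse0.
move=> _ _ cv.
suff -> : (fun n : nat => \int[lam]_(x in `[(- n%:R)%R, n%:R]) (h x)%:E)%E =
  (fun n : nat => \int[lam]_x ((EFin \o h) \_ `[(- n%:R)%R, n%:R]) x)%E by exact: cv.
by apply/funext => n; rewrite integral_mkcond.
Unshelve. all: by end_near. Qed.

Lemma is_derive_normal_pdf01 (x : R) :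
  is_derive x 1 (normal_pdf 0 1 : R -> R) (- x * normal_pdf 0 1 x).
Proof.
have -> : (normal_pdf 0 1 : R -> R) = fun x => normal_peak 1 * expR (- (x ^+ 2 / 2)).
  by apply/funext => y; exact: normal_pdf01E.
apply: is_derive_eq; rewrite /GRing.scale /=.
by field.
Qed.

Lemma normal_pdf_decay (c : R) :
  (fun n : nat => expR (c * n%:R) * normal_pdf 0 1 (n%:R : R)) @ \oo --> (0 : R).
Proof.
apply: (@squeeze_cvgr _ _ _ _ (cst 0) (fun n : nat => normal_peak 1 * expR (- n%:R))).
- near=> n; rewrite mulr_ge0 ?expR_ge0 ?normal_pdf_ge0//=.
  rewrite normal_pdf01E mulrCA ler_wpM2l ?normal_peak_ge0// -expRD ler_expR.
  have : 2 * (c + 1) <= n%:R by near: n; exact: nbhs_infty_ger.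
  have : (0 : R) <= n%:R by [].
  move: (n%:R : R) => z z0 hz; nra.
- exact: cvg_cst.
- rewrite -[X in _ --> X](mulr0 (normal_peak 1)); apply: cvgMr; exact: cvgn_expR.
Unshelve. all: by end_near. Qed.

(** [F x = f x * normal_pdf 0 1 x] has derivative [(f' x - x * f x) * normal_pdf 0 1 x], so the
    integral of the latter over [-n, n] is a boundary term, which the Gaussian decay sends to 0. *)
Lemma normal_ibp (f f' : R -> R) (c : R) :
  (forall x : R, is_derive x 1 f (f' x)) -> continuous f' ->
  (forall x, `|f x| <= c * expR (c * `|x|)) ->
  (forall x, `|f' x| <= c * expR (c * `|x|)) ->
  \int[gam]_x (x * f x) = \int[gam]_x f' x.
Proof.
move=> df cf' fb f'b.
have c0 : 0 <= c by have := fb 0; rewrite normr0 mulr0 expR0 mulr1; exact: le_trans.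
have cf : continuous f by move=> x; exact/differentiable_continuous/derivable1_diffP.
have mf : measurable_fun [set: R] f by exact: continuous_measurable_fun.
have mf' : measurable_fun [set: R] f' by exact: continuous_measurable_fun.
pose h x := f' x - x * f x.
have mh : measurable_fun [set: R] h.
  by apply: measurable_funB => //; apply: measurable_funM.
have xfb x : `|x * f x| <= (c + 1) * expR ((c + 1) * `|x|).
  have e1 : `|x| <= expR `|x| by rewrite (le_trans _ (expR_ge1Dx _))// lerDr.
  have -> : expR ((c + 1) * `|x|) = expR `|x| * expR (c * `|x|).
    by rewrite -expRD; congr expR; ring.
  have p1 := expR_ge0 `|x|; have p2 := expR_ge0 (c * `|x|).
  rewrite normrM (le_trans (ler_pM _ _ e1 (fb x)))//.
  by rewrite mulrCA ler_wpM2r ?mulr_ge0// lerDl.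
have ixf := integrable_normal (measurable_funM (@measurable_id _ _ _) mf) xfb.
have if' := integrable_normal mf' f'b.
have hb x : `|h x| <= (2 * c + 1) * expR ((2 * c + 1) * `|x|).
  rewrite (le_trans (ler_normB _ _))// (le_trans (lerD (f'b x) (xfb x)))//.
  set E := expR ((2 * c + 1) * _).
  have -> : (2 * c + 1) * E = c * E + (c + 1) * E by ring.
  apply: lerD; apply: ler_wpM2l => //; rewrite ?addr_ge0// ler_expR;
    apply: ler_wpM2r => //; lra.
have [ilam elam] := integral_normal_pdfE mh hb.
apply/esym/eqP; rewrite -subr_eq0 -RintegralB//; apply/eqP.
rewrite /Rintegral elam.
suff -> : (\int[lam]_x (h x * normal_pdf 0 1 x)%:E = 0)%E by [].
pose F x := f x * normal_pdf 0 1 x.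
have dF (x : R) : is_derive x 1 F (h x * normal_pdf 0 1 x).
  have dM := is_deriveM (df x) (is_derive_normal_pdf01 x).
  have -> : h x * normal_pdf 0 1 x =
      f x *: (- x * normal_pdf 0 1 x) + normal_pdf 0 1 x *: f' x.
    by rewrite /h /GRing.scale/=; ring.
  exact: dM.
have cF : continuous F by move=> x; exact/differentiable_continuous/derivable1_diffP.
have mhp : measurable_fun [set: R] (fun x => h x * normal_pdf 0 1 x).
  by apply: measurable_funM => //; exact: measurable_normal_pdf.
have l1 := cvg_integral_symitv mhp ilam.
have chp : continuous (fun x => h x * normal_pdf 0 1 x).
  move=> x; apply: cvgM; last exact: continuous_normal_pdf (oner_neq0 _) _.
  by apply: cvgB; [exact: cf'|apply: cvgM => //; exact: cf].
have Fb (x : R) : `|F x| <= c * (expR (c * `|x|) * normal_pdf 0 1 `|x|).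
  rewrite normrM (ger0_norm (normal_pdf_ge0 _ _ _)) mulrA !normal_pdf01E.
  by rewrite real_normK ?num_real// ler_wpM2r// mulr_ge0 ?normal_peak_ge0 ?expR_ge0.
(* The index is shifted by one because [continuous_FTC2] needs a nondegenerate interval. *)
have Flim0 (s : nat -> R) : (forall n, `|s n| = n.+1%:R) -> F (s n) @[n --> \oo] --> (0 : R).
  move=> sn; apply/norm_cvg0P.
  apply: (@squeeze_cvgr _ _ _ _ (cst 0) (fun n : nat => c * (expR (c * n.+1%:R) * normal_pdf 0 1 (n.+1%:R : R)))).
  - by apply: nearW => n; rewrite normr_ge0/= (le_trans (Fb _))// sn.
  - exact: cvg_cst.
  - rewrite -[X in _ --> X](mulr0 c); apply: cvgMr.
    have := normal_pdf_decay c; by rewrite -cvg_shiftS.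
have Flim : F (n.+1%:R) @[n --> \oo] --> (0 : R).
  by apply: (Flim0 (fun n => n.+1%:R)) => n; rewrite ger0_norm.
have Flim' : F (- n.+1%:R) @[n --> \oo] --> (0 : R).
  by apply: (Flim0 (fun n => - n.+1%:R)) => n; rewrite normrN ger0_norm.
have l2 : (fun n : nat => (F n.+1%:R)%:E - (F (- n.+1%:R))%:E)%E @ \oo --> 0%E.
  rewrite -(sube0 0%E); apply: cvgeB => //.
    apply: cvg_EFin; first exact: nearW.
    exact: Flim.
  apply: cvg_EFin; first exact: nearW.
  exact: Flim'.
have l1' : (fun n : nat => \int[lam]_(x in `[(- n.+1%:R)%R, n.+1%:R]) (h x * normal_pdf 0 1 x)%:E)%E @ \oo -->
  (\int[lam]_x (h x * normal_pdf 0 1 x)%:E)%E by move: l1; rewrite -cvg_shiftS.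
apply: (cvg_unique _ l1'); first exact: ereal_hausdorff.
suff -> : (fun n : nat => \int[lam]_(x in `[(- n.+1%:R)%R, n.+1%:R]) (h x * normal_pdf 0 1 x)%:E)%E =
  (fun n : nat => (F n.+1%:R)%:E - (F (- n.+1%:R))%:E)%E by exact: l2.
apply/funext => n; apply: continuous_FTC2.
- by rewrite -subr_gt0 opprK addr_gt0 ?ltr0n.
- exact: continuous_subspaceT.
- split; first by move=> y _; exact: ex_derive.
  + by apply/cvg_at_right_filter; exact: cF.
  + by apply/cvg_at_left_filter; exact: cF.
- by move=> y _; rewrite derive1E derive_val.
Qed.

End GaussianIBP.

(** * Gaussian vectors and resampling of one coordinate *)

Section Resampling.
Context {R : realType} (n : nat).
Local Notation gam := (@normal_prob R 0 1).
Local Notation X := (n.-tuple R).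

Definition upd (p : 'I_n) (x : R) (y : X) : X :=
  [tuple if q == p then x else tnth y q | q < n].

Lemma tnth_upd p x y q : tnth (upd p x y) q = if q == p then x else tnth y q.
Proof. by rewrite tnth_mktuple. Qed.

Lemma tnth_upd_eq p x y : tnth (upd p x y) p = x.
Proof. by rewrite tnth_upd eqxx. Qed.

Lemma upd_id p y : upd p (tnth y p) y = y.
Proof. by apply: eq_from_tnth => q; rewrite tnth_upd; case: eqP => // ->. Qed.

Lemma upd_upd p x x' y : upd p x (upd p x' y) = upd p x y.
Proof. by apply: eq_from_tnth => q; rewrite !tnth_upd; case: eqP. Qed.

Lemma updC p q x z y : p != q -> upd p x (upd q z y) = upd q z (upd p x y).
Proof.
move=> pq; apply: eq_from_tnth => r; rewrite !tnth_upd.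
by case: eqP => [->|//]; rewrite (negbTE pq).
Qed.

Definition l1 (y : X) : R := \sum_p `|tnth y p|.

Lemma l1_ge0 y : 0 <= l1 y. Proof. exact: sumr_ge0. Qed.

Lemma measurable_l1 : measurable_fun [set: X] l1.
Proof.
apply: measurable_sum => p; apply: measurableT_comp => //.
exact: measurable_tnth.
Qed.

Lemma l1_upd p x y : l1 (upd p x y) <= `|x| + l1 y.
Proof.
rewrite /l1 (bigD1 p)//= tnth_upd_eq lerD2l [leRHS](bigD1 p)//=.
rewrite (eq_bigr (fun q => `|tnth y q|)) ?lerDr// => q qp.
by rewrite tnth_upd (negbTE qp).
Qed.

Lemma measurable_upd p :
  measurable_fun [set: measurableTypeR R * X] (fun z => upd p z.1 z.2).
Proof.
apply/measurable_fun_tnthP => q.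
have [->|qp] := eqVneq q p.
  rewrite (_ : _ \o _ = fst); first exact: measurable_fst.
  by apply/funext => z /=; rewrite tnth_upd_eq.
rewrite (_ : _ \o _ = (@tnth n R ^~ q) \o snd).
  apply: measurableT_comp; [exact: measurable_tnth|exact: measurable_snd].
by apply/funext => z /=; rewrite tnth_upd (negbTE qp).
Qed.

Lemma measurable_upd1 p y : measurable_fun [set: R] (fun x => upd p x y).
Proof.
apply/measurable_fun_tnthP => q.
have [->|qp] := eqVneq q p.
  rewrite (_ : _ \o _ = id); first exact: measurable_id.
  by apply/funext => z /=; rewrite tnth_upd_eq.
rewrite (_ : _ \o _ = cst (tnth y q)); first exact: measurable_cst.
by apply/funext => z /=; rewrite tnth_upd (negbTE qp).
Qed.

Lemma measurable_upd2 p x : measurable_fun [set: X] (fun y => upd p x y).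
Proof.
apply/measurable_fun_tnthP => q.
have [->|qp] := eqVneq q p.
  rewrite (_ : _ \o _ = cst x); first exact: measurable_cst.
  by apply/funext => z /=; rewrite tnth_upd_eq.
rewrite (_ : _ \o _ = @tnth n R ^~ q); first exact: measurable_tnth.
by apply/funext => z /=; rewrite tnth_upd (negbTE qp).
Qed.

(* At most exponential growth: a class closed under sums, products and partial
   integration, all of whose members are Gaussian-integrable. *)
Definition eg (F : X -> R) : Prop :=
  measurable_fun [set: X] F /\ exists c, forall y, `|F y| <= c * expR (c * l1 y).

(** Conditional expectation given the coordinates other than [p]. It is kept as a function on the
    whole space so that the operators for different coordinates can be composed. *)
Definition Ep p (F : X -> R) (y : X) : R := \int[gam]_x F (upd p x y).

(* Invariance under resampling any coordinate characterises the standard Gaussian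
   law on R^n, and is the form in which independence is used. *)
Definition gauss_vec (mu : probability X R) : Prop :=
  forall p (f : X -> \bar R), measurable_fun [set: X] f -> (forall y, 0 <= f y)%E ->
  (\int[mu]_y f y = \int[mu]_y \int[gam]_x f (upd p x y))%E.

Lemma eg_bound (F : X -> R) c : (forall y, `|F y| <= c * expR (c * l1 y)) -> 0 <= c.
Proof.
move=> h; have := h [tuple 0 | i < n]; rewrite /l1 big1.
  by rewrite mulr0 expR0 mulr1; exact: le_trans.
by move=> i _; rewrite tnth_mktuple normr0.
Qed.

Lemma expgrow_mono (c d l : R) : 0 <= c <= d -> 0 <= l ->
  c * expR (c * l) <= d * expR (d * l).
Proof.
move=> /andP[c0 cd] l0; rewrite ler_pM ?expR_ge0//.
by rewrite ler_expR ler_wpM2r.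
Qed.

Lemma eg_cst a : eg (cst a).
Proof.
split; first exact: measurable_cst.
exists `|a| => y; rewrite ler_peMr// -[leLHS]expR0 ler_expR.
by rewrite mulr_ge0// l1_ge0.
Qed.

Lemma eg_le (F G : X -> R) : measurable_fun [set: X] F -> eg G ->
  (forall y, `|F y| <= `|G y|) -> eg F.
Proof.
move=> mF [_ [c hc]] FG; split=> //; exists c => y.
exact: le_trans (FG y) (hc y).
Qed.

Lemma eg_bounded (F : X -> R) a : measurable_fun [set: X] F ->
  (forall y, `|F y| <= a) -> eg F.
Proof.
move=> mF Fa; apply: (eg_le mF (eg_cst a)) => y.
by rewrite (le_trans (Fa y))// ler_norm.
Qed.

Lemma egD F G : eg F -> eg G -> eg (fun y => F y + G y).
Proof.
move=> [mF [c hc]] [mG [d hd]]; split; first exact: measurable_funD.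
have c0 := eg_bound hc; have d0 := eg_bound hd.
exists (c + d) => y; rewrite (le_trans (ler_normD _ _))// mulrDl lerD//.
  rewrite (le_trans (hc y))// ler_wpM2l// ler_expR ler_wpM2r ?l1_ge0//.
  by rewrite lerDl.
rewrite (le_trans (hd y))// ler_wpM2l// ler_expR ler_wpM2r ?l1_ge0//.
by rewrite lerDr.
Qed.

Lemma egM F G : eg F -> eg G -> eg (fun y => F y * G y).
Proof.
move=> [mF [c hc]] [mG [d hd]]; split; first exact: measurable_funM.
have c0 := eg_bound hc; have d0 := eg_bound hd.
exists (c * d + c + d) => y; rewrite normrM (le_trans (ler_pM _ _ (hc y) (hd y)))//.
rewrite mulrACA -expRD -mulrDl; apply: ler_pM; rewrite ?expR_ge0 ?mulr_ge0//.
  by rewrite -addrA lerDl addr_ge0.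
rewrite ler_expR ler_wpM2r ?l1_ge0//.
by rewrite -addrA lerDr mulr_ge0.
Qed.

Lemma egN F : eg F -> eg (fun y => - F y).
Proof.
move=> [mF [c hc]]; split; first exact: measurableT_comp.
by exists c => y; rewrite normrN.
Qed.

Lemma egB F G : eg F -> eg G -> eg (fun y => F y - G y).
Proof. by move=> hF hG; apply: (egD hF); exact: egN. Qed.

Lemma egZ a F : eg F -> eg (fun y => a * F y).
Proof. by move=> hF; apply: (egM _ hF); exact: eg_cst. Qed.

Lemma egX F k : eg F -> eg (fun y => F y ^+ k).
Proof.
move=> hF; elim: k => [|k IH]; first exact: eg_cst.
rewrite (_ : (fun _ => _) = fun y => F y * F y ^+ k); first exact: egM.
by apply/funext => y; rewrite exprS.
Qed.

Lemma eg_sum (I : Type) (s : seq I) (P : pred I) (F : I -> X -> R) :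
  (forall i, P i -> eg (F i)) -> eg (fun y => \sum_(i <- s | P i) F i y).
Proof.
move=> hF; elim: s => [|i s IH].
  rewrite (_ : (fun _ => _) = cst 0); first exact: eg_cst.
  by apply/funext => y; rewrite big_nil.
have [Pi|nPi] := boolP (P i).
  rewrite (_ : (fun _ => _) = fun y => F i y + \sum_(i <- s | P i) F i y).
    by apply: egD => //; exact: hF.
  by apply/funext => y; rewrite big_cons Pi.
rewrite (_ : (fun _ => _) = fun y => \sum_(i <- s | P i) F i y) => //.
by apply/funext => y; rewrite big_cons (negbTE nPi).
Qed.

Lemma eg_norm F : eg F -> eg (fun y => `|F y|).
Proof.
move=> [mF [c hc]]; split; first exact: measurableT_comp.
by exists c => y; rewrite normr_id.
Qed.

Lemma eg_tnth p : eg (fun y => tnth y p).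
Proof.
split; first exact: measurable_tnth.
exists 1 => y; rewrite !mul1r.
apply: (@le_trans _ _ (l1 y)).
  by rewrite /l1 (bigD1 p)//= lerDl sumr_ge0.
by rewrite (le_trans _ (expR_ge1Dx _))// lerDr.
Qed.

Lemma eg_expl1 c : 0 <= c -> eg (fun y => c * expR (c * l1 y)).
Proof.
move=> c0; split; last by exists c => y; rewrite ger0_norm// mulr_ge0 ?expR_ge0.
apply: measurable_funM => //; apply: measurableT_comp => //.
by apply: measurable_funM => //; exact: measurable_l1.
Qed.

Lemma eg_upd p x F : eg F -> eg (fun y => F (upd p x y)).
Proof.
move=> [mF [c hc]]; split.
  by apply: measurableT_comp => //; exact: measurable_upd2.
have c0 := eg_bound hc.
exists (c * expR (c * `|x|) + c) => y; rewrite (le_trans (hc _))//.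
apply: (@le_trans _ _ (c * expR (c * `|x|) * expR (c * l1 y))).
  rewrite -mulrA ler_wpM2l// -expRD ler_expR -mulrDr ler_wpM2l//.
  exact: l1_upd.
apply: ler_pM; rewrite ?mulr_ge0 ?expR_ge0 ?lerDl//.
by rewrite ler_expR ler_wpM2r ?l1_ge0// lerDr mulr_ge0 ?expR_ge0.
Qed.

Lemma eg_slice p F y : eg F -> measurable_fun [set: R] (fun x => F (upd p x y)) /\
  exists c, forall x, `|F (upd p x y)| <= c * expR (c * `|x|).
Proof.
move=> [mF [c hc]]; split.
  apply: measurableT_comp => //; exact: measurable_upd1.
have c0 := eg_bound hc; have ly := l1_ge0 y.
exists (c * expR (c * l1 y) + c) => x; rewrite (le_trans (hc _))//.
apply: (@le_trans _ _ (c * expR (c * l1 y) * expR (c * `|x|))).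
  rewrite -mulrA ler_wpM2l// -expRD ler_expR -mulrDr ler_wpM2l//.
  by rewrite addrC l1_upd.
apply: ler_pM; rewrite ?mulr_ge0 ?expR_ge0 ?lerDl//.
by rewrite ler_expR ler_wpM2r// lerDr mulr_ge0 ?expR_ge0.
Qed.

Lemma eg_slice_integrable p F y : eg F ->
  gam.-integrable [set: R] (EFin \o (fun x => F (upd p x y))).
Proof.
by move=> /(eg_slice p y)[mF [c hc]]; exact: integrable_normal mF hc.
Qed.

Lemma EpE p F y : eg F ->
  ((Ep p F y)%:E = \int[gam]_x (F (upd p x y))%:E)%E.
Proof.
move=> hF; rewrite fineK//; apply: integrable_fin_num => //.
exact: eg_slice_integrable.
Qed.

Lemma EpD p F G y : eg F -> eg G -> Ep p (fun y => F y + G y) y = Ep p F y + Ep p G y.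
Proof. by move=> hF hG; rewrite /Ep RintegralD//; exact: eg_slice_integrable. Qed.

Lemma EpB p F G y : eg F -> eg G -> Ep p (fun y => F y - G y) y = Ep p F y - Ep p G y.
Proof. by move=> hF hG; rewrite /Ep RintegralB//; exact: eg_slice_integrable. Qed.

Lemma Ep_indep p F y : (forall x y, F (upd p x y) = F y) -> Ep p F y = F y.
Proof.
move=> h; rewrite /Ep; under eq_Rintegral do rewrite h.
by rewrite Rintegral_cst//= probability_setT mulr1.
Qed.

Lemma Ep_mull p F G y : (forall x y, F (upd p x y) = F y) -> eg G ->
  Ep p (fun y => F y * G y) y = F y * Ep p G y.
Proof.
move=> h hG; rewrite /Ep; under eq_Rintegral do rewrite h.
by rewrite RintegralZl//; exact: eg_slice_integrable.
Qed.

Lemma Ep_upd p F x y : Ep p F (upd p x y) = Ep p F y.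
Proof. by rewrite /Ep; under eq_Rintegral do rewrite upd_upd. Qed.

Lemma Ep_upd_other p q F x y : (forall x y, F (upd q x y) = F y) ->
  Ep p F (upd q x y) = Ep p F y.
Proof.
move=> h; have [->|pq] := eqVneq p q; first exact: Ep_upd.
by rewrite /Ep; under eq_Rintegral do rewrite updC// h.
Qed.

(** Measurability is Fubini-Tonelli on the positive and negative parts. The rate [c] survives by
    [l1_upd], and only the prefactor grows, by the bound [K] on the Gaussian integral of exp (c
    |x|). *)
Lemma eg_Ep p F : eg F -> eg (Ep p F).
Proof.
move=> hF; have [mF [c hc]] := hF; have c0 := eg_bound hc; split.
  have mf : measurable_fun [set: measurableTypeR R * X] (fun z => (F (upd p z.1 z.2))%:E).
    apply/measurable_EFinP; apply: measurableT_comp => //; exact: measurable_upd.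
  apply: measurableT_comp; first exact: fine_measurable.
  under eq_fun do rewrite integralE.
  apply: emeasurable_funB.
    rewrite (_ : (fun _ => _) = fubini_G gam ((fun z => (F (upd p z.1 z.2))%:E)^\+)%E).
      by apply: measurable_fun_fubini_tonelli_G => //; exact: measurable_funepos.
    by apply/funext => y; apply: eq_integral => x _; rewrite !funeposE.
  rewrite (_ : (fun _ => _) = fubini_G gam ((fun z => (F (upd p z.1 z.2))%:E)^\-)%E).
    by apply: measurable_fun_fubini_tonelli_G => //; exact: measurable_funeneg.
  by apply/funext => y; apply: eq_integral => x _; rewrite !funenegE.
set K := 2 * expR (c ^+ 2 / 2).
have K0 : 0 <= K by rewrite mulr_ge0 ?expR_ge0.
exists (c * K + c) => y; have ly := l1_ge0 y.
apply: (@le_trans _ _ (c * K * expR (c * l1 y))); last first.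
  apply: ler_pM; rewrite ?mulr_ge0 ?expR_ge0 ?lerDl//.
  by rewrite ler_expR ler_wpM2r// lerDr mulr_ge0.
rewrite -lee_fin EFin_normr_Rintegral//; last exact: eg_slice_integrable.
have [mFs _] := eg_slice p y hF.
apply: (le_trans (le_abse_integral _ _ _)) => //; first exact/measurable_EFinP.
apply: (@le_trans _ _ (\int[gam]_x ((c * expR (c * l1 y))%:E * (expR (c * `|x|))%:E))%E).
  apply: ge0_le_integral => //.
  - by apply/measurable_EFinP; exact: measurableT_comp.
  - apply: measurable_funeM; apply/measurable_EFinP; exact: measurable_expRM_norm.
  - move=> x _; rewrite -EFinM lee_fin (le_trans (hc _))//.
    rewrite -mulrA ler_wpM2l// -expRD ler_expR -mulrDr ler_wpM2l//.
    by rewrite addrC l1_upd.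
rewrite ge0_integralZl//; last 2 first.
- by apply/measurable_EFinP; exact: measurable_expRM_norm.
- by rewrite lee_fin mulr_ge0 ?expR_ge0.
rewrite [X in (_ <= X%:E)%E](_ : _ = c * expR (c * l1 y) * K); last by ring.
rewrite (EFinM _ K); apply: lee_wpmul2l; first by rewrite lee_fin mulr_ge0 ?expR_ge0.
exact: integral_normal_expR_norm.
Qed.

End Resampling.

Section GaussVec.
Context {R : realType} (n : nat).
Local Notation gam := (@normal_prob R 0 1).
Local Notation X := (n.-tuple R).
Variable mu : probability X R.
Hypothesis gv : gauss_vec mu.

(** Resampling the head of [s] integrates its factor to [m p] and leaves the other factors alone,
    because [s] has no repetition. *)
Lemma integral_prod (f : 'I_n -> R -> R) (m : 'I_n -> R) (s : seq 'I_n) :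
  uniq s -> (forall p, measurable_fun [set: R] (f p)) -> (forall p x, 0 <= f p x) ->
  (forall p, \int[gam]_x (f p x)%:E = (m p)%:E)%E ->
  (\int[mu]_y (\prod_(p <- s) f p (tnth y p))%:E = (\prod_(p <- s) m p)%:E)%E.
Proof.
move=> us mf f0 fm.
have mprod (s' : seq 'I_n) :
    measurable_fun [set: X] (fun y => \prod_(p <- s') f p (tnth y p)).
  apply: measurable_prod => p _; apply: measurableT_comp => //.
  exact: measurable_tnth.
elim: s us => [_|p s IH /= /andP[ps us]].
  rewrite big_nil; under eq_integral do rewrite big_nil.
  by rewrite integral_cst//= probability_setT mule1.
have m0 : 0 <= m p by rewrite -lee_fin -fm integral_ge0// => x _; rewrite lee_fin.
rewrite (gv p); last 2 first.
- exact/measurable_EFinP.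
- by move=> y; rewrite lee_fin prodr_ge0.
transitivity (\int[mu]_y ((m p)%:E * (\prod_(q <- s) f q (tnth y q))%:E))%E.
  apply: eq_integral => y _; rewrite -fm muleC -ge0_integralZl//; last first.
  - by rewrite lee_fin prodr_ge0.
  - by move=> x _; rewrite lee_fin.
  - by apply/measurable_EFinP; exact: mf.
  apply: eq_integral => x _; rewrite -EFinM big_cons tnth_upd_eq mulrC.
  congr ((_ * _)%:E); rewrite big_seq [RHS]big_seq; apply: eq_bigr => q qs.
  by rewrite tnth_upd; case: eqP qs => // ->; rewrite (negbTE ps).
rewrite ge0_integralZl//; last 2 first.
- exact/measurable_EFinP.
- by move=> x _; rewrite lee_fin prodr_ge0.
by rewrite IH// big_cons EFinM.
Qed.

Lemma integral_expR_l1 c :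
  (\int[mu]_y (expR (c * l1 y))%:E =
   (\prod_(p < n) \int[gam]_x (expR (c * `|x|)))%:E)%E.
Proof.
transitivity (\int[mu]_y (\prod_(p < n) expR (c * `|tnth y p|))%:E)%E.
  by apply: eq_integral => y _; rewrite /l1 mulr_sumr expR_sum.
apply: (integral_prod (f := fun _ x => expR (c * `|x|))).
- exact: index_enum_uniq.
- by move=> _; exact: measurable_expRM_norm.
- by move=> _ x; exact: expR_ge0.
- move=> _; rewrite fineK// ge0_fin_numE.
    by rewrite (le_lt_trans (integral_normal_expR_norm _))// ltry.
  by apply: integral_ge0 => x _; rewrite lee_fin expR_ge0.
Qed.

Lemma eg_integrable F : eg F -> mu.-integrable [set: X] (EFin \o F).
Proof.
move=> [mF [c hc]]; have c0 := eg_bound hc; apply/integrableP; split.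
  exact/measurable_EFinP.
have me : measurable_fun [set: X] (fun y => expR (c * l1 y)).
  by apply: measurableT_comp => //; apply: measurable_funM => //; exact: measurable_l1.
apply: (@le_lt_trans _ _ (\int[mu]_y (c%:E * (expR (c * l1 y))%:E)))%E.
  apply: ge0_le_integral => //.
  - by apply/measurable_EFinP; exact: measurableT_comp.
  - by apply: emeasurable_funM => //; exact/measurable_EFinP.
  - by move=> x _; rewrite -EFinM /= lee_fin.
rewrite ge0_integralZl//; last exact/measurable_EFinP.
by rewrite integral_expR_l1 -EFinM ltry.
Qed.

Definition Ex (F : X -> R) : R := \int[mu]_y F y.

Lemma ExE F : eg F -> ((Ex F)%:E = \int[mu]_y (F y)%:E)%E.
Proof. by move=> hF; rewrite fineK//; apply: integrable_fin_num => //; exact: eg_integrable. Qed.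

Lemma eq_Ex F G : F =1 G -> Ex F = Ex G.
Proof. by move=> FG; apply: eq_Rintegral => y _; exact: FG. Qed.

Lemma ExD F G : eg F -> eg G -> Ex (fun y => F y + G y) = Ex F + Ex G.
Proof. by move=> hF hG; apply: RintegralD => //; exact: eg_integrable. Qed.

Lemma ExB F G : eg F -> eg G -> Ex (fun y => F y - G y) = Ex F - Ex G.
Proof. by move=> hF hG; apply: RintegralB => //; exact: eg_integrable. Qed.

Lemma ExZ a F : eg F -> Ex (fun y => a * F y) = a * Ex F.
Proof. by move=> hF; apply: RintegralZl => //; exact: eg_integrable. Qed.

Lemma Ex_cst a : Ex (cst a) = a.
Proof. by rewrite /Ex Rintegral_cst//= probability_setT mulr1. Qed.

Lemma Ex_le F G : eg F -> eg G -> (forall y, F y <= G y) -> Ex F <= Ex G.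
Proof. by move=> hF hG FG; apply: le_Rintegral => //; exact: eg_integrable. Qed.

Lemma Ex_ge0 F : (forall y, 0 <= F y) -> 0 <= Ex F.
Proof. by move=> hF; apply: Rintegral_ge0. Qed.

Lemma Ex_sum (I : Type) (s : seq I) (P : pred I) (F : I -> X -> R) :
  (forall i, P i -> eg (F i)) ->
  Ex (fun y => \sum_(i <- s | P i) F i y) = \sum_(i <- s | P i) Ex (F i).
Proof.
move=> hF; elim: s => [|i s IH].
  rewrite big_nil -[RHS](Ex_cst 0); apply: eq_Ex => y; by rewrite big_nil.
rewrite big_cons; have [Pi|nPi] := boolP (P i); last first.
  by rewrite -IH; apply: eq_Ex => y; rewrite big_cons (negbTE nPi).
rewrite -IH -ExD; [|exact: hF|exact: eg_sum].
by apply: eq_Ex => y; rewrite big_cons Pi.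
Qed.

Lemma Ex_Ep_ge0 p F : eg F -> (forall y, 0 <= F y) -> Ex (Ep p F) = Ex F.
Proof.
move=> hF F0; rewrite /Ex /Rintegral; congr fine.
rewrite (gv p (f := EFin \o F)); last 2 first.
- by apply/measurable_EFinP; exact: hF.1.
- by move=> y; rewrite lee_fin.
by apply: eq_integral => y _; rewrite EpE.
Qed.

(** [gauss_vec] speaks of nonnegative functions only, so the growth bound of [F] is added to make it
    nonnegative and its own expectation is then cancelled. *)
Lemma Ex_Ep p F : eg F -> Ex (Ep p F) = Ex F.
Proof.
move=> hF; have [_ [c hc]] := hF; have c0 := eg_bound hc.
have hB := @eg_expl1 R n c c0.
have B0 y : 0 <= c * expR (c * @l1 R n y) by rewrite mulr_ge0 ?expR_ge0.
have FB0 y : 0 <= F y + c * expR (c * l1 y).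
  by rewrite -lerBlDr sub0r; have := hc y; rewrite ler_norml => /andP[].
have e1 := Ex_Ep_ge0 p hB B0.
have e2 := Ex_Ep_ge0 p (egD hF hB) FB0.
have e3 : Ex (Ep p (fun y => F y + c * expR (c * l1 y))) =
    Ex (Ep p F) + Ex (Ep p (fun y => c * expR (c * l1 y))).
  rewrite -ExD; [|exact: eg_Ep|exact: eg_Ep].
  by apply: eq_Ex => y; rewrite EpD.
by apply: (@addIr _ (Ex (Ep p (fun y => c * expR (c * l1 y))))); rewrite -e3 e2 ExD// e1.
Qed.

Lemma Ex_expR_lin (a : 'I_n -> R) :
  Ex (fun y => expR (\sum_p a p * tnth y p)) = expR (\sum_p a p ^+ 2 / 2).
Proof.
rewrite /Ex /Rintegral expR_sum.
rewrite (eq_integral (fun y => (\prod_p expR (a p * tnth y p))%:E)); last first.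
  by move=> y _; rewrite expR_sum.
rewrite (integral_prod (f := fun p x => expR (a p * x))
  (m := fun p => expR (a p ^+ 2 / 2)) (index_enum_uniq _)); last 3 first.
- by move=> p; exact: measurable_expRM.
- by move=> p x; exact: expR_ge0.
- by move=> p; exact: integral_normal_expR.
by [].
Qed.

Lemma eg_expR_lin (a : 'I_n -> R) : eg (fun y : X => expR (\sum_p a p * tnth y p)).
Proof.
have mF : measurable_fun [set: X] (fun y : X => expR (\sum_p a p * tnth y p)).
  apply: measurableT_comp => //; apply: measurable_sum => p.
  by apply: measurable_funM => //; exact: measurable_tnth.
split=> //; exists (1 + \sum_p `|a p|) => y.
have s0 : 0 <= \sum_p `|a p| by exact: sumr_ge0.
rewrite ger0_norm ?expR_ge0// -[leLHS]mul1r ler_pM ?expR_ge0 ?lerDl//.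
rewrite ler_expR mulrDl mul1r ler_wpDl ?l1_ge0// mulr_suml ler_sum// => p _.
rewrite (le_trans (ler_norm _))// normrM ler_wpM2l//.
by rewrite /l1 (bigD1 p)//= lerDl sumr_ge0.
Qed.

(** Resample coordinate [p] on both sides and apply the one-variable formula with the other
    coordinates frozen. *)
Lemma Ex_ibp p F F' : eg F -> eg F' ->
  (forall y (x : R), is_derive x 1 (fun x => F (upd p x y)) (F' (upd p x y))) ->
  (forall y, continuous (fun x => F' (upd p x y))) ->
  Ex (fun y => tnth y p * F y) = Ex F'.
Proof.
move=> hF hF' dF cF'.
have hpF : eg (fun y => tnth y p * F y) by apply: egM => //; exact: eg_tnth.
rewrite -(Ex_Ep p hpF) -(Ex_Ep p hF'); apply: eq_Ex => y.
rewrite /Ep; under eq_Rintegral do rewrite tnth_upd_eq.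
have [_ [c hc]] := eg_slice p y hF; have [_ [d hd]] := eg_slice p y hF'.
have c0 : 0 <= c by have := hc 0; rewrite normr0 mulr0 expR0 mulr1; exact: le_trans.
have d0 : 0 <= d by have := hd 0; rewrite normr0 mulr0 expR0 mulr1; exact: le_trans.
apply: (@normal_ibp R _ _ (c + d)) => // x.
  by apply: (le_trans (hc x)); apply: expgrow_mono => //; rewrite c0 lerDl.
by apply: (le_trans (hd x)); apply: expgrow_mono => //; rewrite d0 lerDr.
Qed.

End GaussVec.

(** * From independent Gaussian variables to resampling invariance *)

Section GaussVecLaw.
Context {R : realType} (n : nat).
Local Notation gam := (@normal_prob R 0 1).
Local Notation X := (n.-tuple R).

Definition rect (A : 'I_n -> set R) : set X := [set y | forall p, A p (tnth y p)].

Lemma rectE A : rect A = \bigcap_(p in [set: 'I_n]) ((@tnth n R)^~ p @^-1` A p).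
Proof. by apply/seteqP; split=> y /= h p; [move=> _; exact: h|exact: h]. Qed.

Lemma measurable_rect A : (forall p, measurable (A p)) -> measurable (rect A).
Proof.
move=> mA; rewrite rectE; apply: fin_bigcap_measurable => // p _.
by rewrite -[X in measurable X]setTI; exact: measurable_tnth.
Qed.

Definition rects : set (set X) :=
  [set B | exists A, (forall p, measurable (A p)) /\ B = rect A].

Lemma measurable_rects : measurable = <<s rects >>.
Proof.
apply/seteqP; split; last first.
  apply: smallest_sub; first exact: sigma_algebra_measurable.
  by move=> _ [A [mA ->]]; exact: measurable_rect.
apply: smallest_sub; first exact: smallest_sigma_algebra.
rewrite -bigcup_seq; apply: bigcup_sub => p _ _ [B mB <-].
apply: sub_sigma_algebra; exists (fun q => if q == p then B else setT); split.
  by move=> q; case: ifP.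
apply/seteqP; split=> y /=.
  by move=> [_ By] q; case: eqP => // ->.
by move=> /(_ p); rewrite eqxx.
Qed.

Lemma probability_unique_rect (m1 m2 : {measure set X -> \bar R}) :
  m1 setT = 1%E ->
  (forall A, (forall p, measurable (A p)) -> m1 (rect A) = m2 (rect A)) ->
  forall B, measurable B -> m1 B = m2 B.
Proof.
move=> m1T m12; apply: (measure_unique rects (fun _ => setT)).
- exact: measurable_rects.
- move=> _ _ [A [mA ->]] [B [mB ->]]; exists (fun p => A p `&` B p); split.
    by move=> p; exact: measurableI.
  apply/seteqP; split=> y /=; first by move=> [hA hB] p; split.
  by move=> h; split=> p; have [] := h p.
- move=> _; exists (fun=> setT); split=> //.
  by apply/seteqP; split.
- by apply/seteqP; split=> // y _; exists 0%N.
- by move=> _ [A [mA ->]]; exact: m12.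
- by move=> _; rewrite m1T ltry.
Qed.

(** Let [nu] be the law of a vector whose coordinate [p] has been replaced by an independent
    Gaussian. It gives rectangles the same mass as [mu], hence equals [mu], and Fubini-Tonelli turns
    the integral against [nu] into the resampled one. *)
Lemma gauss_vec_rect (mu : probability X R) :
  (forall A, (forall p, measurable (A p)) -> (mu (rect A) = \prod_p gam (A p))%E) ->
  gauss_vec mu.
Proof.
move=> muA p f mf f0.
pose U := fun z : measurableTypeR R * X => upd p z.1 z.2.
have mU : measurable_fun [set: measurableTypeR R * X] U by exact: measurable_upd.
pose Um : {mfun (measurableTypeR R * X)%type >-> X} :=
  HB.pack U (isMeasurableFun.Build _ _ _ _ _ mU).
pose nu := pushforward (gam \x mu)%E Um.
transitivity (\int[nu]_y f y)%E.
  apply: eq_measure_integral => B mB _.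
  apply: (probability_unique_rect (m1 := mu) (m2 := nu)) => //.
    exact: probability_setT.
  move=> A mA; rewrite /= /nu /pushforward /=.
  pose A' q := if q == p then setT else A q.
  have mA' q : measurable (A' q) by rewrite /A'; case: ifP.
  have -> : U @^-1` rect A = A p `*` rect A'.
    apply/seteqP; split=> -[x y] /=.
      move=> h; split; first by have := h p; rewrite tnth_upd_eq.
      by move=> q; have := h q; rewrite /= tnth_upd /A'; case: eqP.
    move=> [Ax h] q; have := h q; rewrite tnth_upd /A'; case: eqP => // -> _.
    exact: Ax.
  rewrite product_measure1E; [|exact: mA|exact: measurable_rect].
  rewrite !muA//.
  have bigD (F : 'I_n -> \bar R) :
      (\prod_q F q = F p * \prod_(q | q != p) F q)%E by exact: (bigD1 p).
  apply: (etrans (bigD _)); congr (_ * _)%E; apply/esym.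
  apply: (etrans (muA _ mA')); apply: (etrans (bigD _)); rewrite {1}/A' eqxx probability_setT mul1e.
  by apply: eq_bigr => q /negbTE qp; rewrite /A' qp.
rewrite ge0_integral_pushforward//.
rewrite fubini_tonelli2//=.
by apply: measurableT_comp.
Qed.

Lemma gauss_vec_of_indep d (T : measurableType d) (P : probability T R)
    (xi : 'I_n -> T -> R) :
  (forall p, measurable_fun [set: T] (xi p)) ->
  (forall A, (forall p, measurable (A p)) ->
    (P (\bigcap_(p in [set: 'I_n]) (xi p @^-1` A p)) = \prod_p gam (A p))%E) ->
  exists mu : probability X R, gauss_vec mu /\
    forall f : X -> \bar R, measurable_fun [set: X] f -> (forall y, 0 <= f y)%E ->
      (\int[mu]_y f y = \int[P]_w f [tuple xi p w | p < n])%E.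
Proof.
move=> mxi ind.
pose G := fun w : T => [tuple xi p w | p < n].
have mG : measurable_fun [set: T] G.
  apply/measurable_fun_tnthP => p; rewrite (_ : _ \o _ = xi p) //.
  by apply/funext => w /=; rewrite tnth_mktuple.
pose Gm : {mfun T >-> X} := HB.pack G (isMeasurableFun.Build _ _ _ _ _ mG).
exists (distribution P Gm); split; last first.
  by move=> f mf f0; rewrite ge0_integral_distribution.
apply: gauss_vec_rect => A mA; rewrite /distribution /pushforward /=.
rewrite -ind//; congr (P _); apply/seteqP; split=> w /= h p.
  by move=> _; have := h p; rewrite tnth_mktuple.
by rewrite tnth_mktuple; exact: h.
Qed.

End GaussVecLaw.

(** * The Efron-Stein inequality and the divergence identity *)

Section EfronStein.
Context {R : realType} (n : nat).
Local Notation X := (n.-tuple R).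
Variable mu : probability X R.
Hypothesis gv : gauss_vec mu.
Local Notation Ex := (Ex mu).
Local Notation indep p B := (forall x (y : X), B (upd p x y) = B y).

Lemma Ex_centered_orth p F B : eg F -> eg B -> indep p B ->
  Ex (fun y => (F y - Ep p F y) * B y) = 0.
Proof.
move=> hF hB iB; have hA : eg (fun y => F y - Ep p F y) by apply: egB => //; exact: eg_Ep.
rewrite -(Ex_Ep gv p); last exact: egM.
rewrite (eq_Ex _ (G := cst 0)) ?Ex_cst// => y.
under [X in Ep p X]eq_fun do rewrite mulrC.
rewrite Ep_mull// EpB//; last exact: eg_Ep.
by rewrite (Ep_indep (F := Ep p F)) ?subrr ?mulr0// => *; exact: Ep_upd.
Qed.

Lemma Ex_sqr_centered p F B : eg F -> eg B -> indep p B ->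
  Ex (fun y => (F y - Ep p F y + B y) ^+ 2) =
  Ex (fun y => (F y - Ep p F y) ^+ 2) + Ex (fun y => B y ^+ 2).
Proof.
move=> hF hB iB; have hA : eg (fun y => F y - Ep p F y) by apply: egB => //; exact: eg_Ep.
have hAB := egM hA hB; have hA2 := egX 2 hA; have hB2 := egX 2 hB.
have -> : Ex (fun y => (F y - Ep p F y + B y) ^+ 2) =
    Ex (fun y => ((F y - Ep p F y) ^+ 2 + B y ^+ 2) + 2 * ((F y - Ep p F y) * B y)).
  by apply: eq_Ex => y; ring.
rewrite !ExD//; [|exact: egD|exact: egZ].
by rewrite ExZ// Ex_centered_orth// mulr0 addr0.
Qed.

Lemma Ex_Ep_sqr_le p F : eg F -> Ex (fun y => Ep p F y ^+ 2) <= Ex (fun y => F y ^+ 2).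
Proof.
move=> hF; have := Ex_sqr_centered hF (eg_Ep p hF) (Ep_upd p F).
under eq_Ex do rewrite subrK.
by move=> ->; rewrite lerDr Ex_ge0// => y; exact: sqr_ge0.
Qed.

Lemma Ex_var_le p F B : eg F -> eg B -> indep p B ->
  Ex (fun y => (F y - Ep p F y) ^+ 2) <= Ex (fun y => (F y - B y) ^+ 2).
Proof.
move=> hF hB iB.
have := @Ex_sqr_centered p F (fun y => Ep p F y - B y) hF (egB (eg_Ep p hF) hB).
under eq_Ex do rewrite addrA subrK.
move=> ->; first by rewrite lerDl Ex_ge0// => y; exact: sqr_ge0.
by move=> x y; rewrite Ep_upd iB.
Qed.

Definition Eps (s : seq 'I_n) (F : X -> R) : X -> R := foldr (fun p G => Ep p G) F s.

Lemma eg_Eps s F : eg F -> eg (Eps s F).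
Proof. by move=> hF; elim: s => //= p s IH; exact: eg_Ep. Qed.

Lemma Ex_Eps s F : eg F -> Ex (Eps s F) = Ex F.
Proof.
move=> hF; elim: s => //= p s IH; rewrite (Ex_Ep gv) ?IH//; exact: eg_Eps.
Qed.

Lemma Eps_upd s F p x y : p \in s -> Eps s F (upd p x y) = Eps s F y.
Proof.
elim: s x y => //= q s IH x y; rewrite inE => /orP[/eqP ->|ps].
  exact: Ep_upd.
by apply: Ep_upd_other => ? ?; exact: IH.
Qed.

Lemma indep_all_cst (G : X -> R) : (forall p, indep p G) -> forall y y', G y = G y'.
Proof.
move=> iG y y'.
pose z s := foldr (fun p z => upd p (tnth y' p) z) y s.
have Gz s : G (z s) = G y by elim: s => //= p s IH; rewrite iG.
have zE s p : p \in s -> tnth (z s) p = tnth y' p.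
  elim: s => //= q s IH; rewrite inE tnth_upd.
  by have [->|pq] := eqVneq p q => //=; exact: IH.
rewrite -(Gz (enum 'I_n)); congr G; apply: eq_from_tnth => p.
by rewrite zE// mem_enum.
Qed.

(** Coordinates are averaged out one at a time. [F - Ep p (Eps s F)] splits into the orthogonal
    pieces [F - Ep p F] and [Ep p (F - Eps s F)]; the second is handled by contraction and
    induction. The first is at most the distance from [F] to any function not depending on
    coordinate [p], since [Ep p F] is the closest one. Choosing [F (upd p 0 y)] avoids an
    independent copy of the vector. *)
Lemma efron_stein F : eg F ->
  Ex (fun y => (F y - Ex F) ^+ 2) <=
  \sum_p Ex (fun y => (F y - F (upd p 0 y)) ^+ 2).
Proof.
move=> hF.
have main s : Ex (fun y => (F y - Eps s F y) ^+ 2) <=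
    \sum_(p <- s) Ex (fun y => (F y - F (upd p 0 y)) ^+ 2).
  elim: s => [|p s IH] /=.
    rewrite big_nil (eq_Ex _ (G := cst 0)) ?Ex_cst// => y.
    by rewrite subrr expr0n.
  have hG := eg_Eps s hF; have hFG := egB hF hG.
  have -> : Ex (fun y => (F y - Ep p (Eps s F) y) ^+ 2) =
      Ex (fun y => (F y - Ep p F y + Ep p (fun y => F y - Eps s F y) y) ^+ 2).
    by apply: eq_Ex => y; rewrite EpB//; congr (_ ^+ 2); ring.
  rewrite Ex_sqr_centered//; [|exact: eg_Ep|exact: Ep_upd].
  rewrite big_cons lerD//.
    apply: Ex_var_le => //; first exact: eg_upd.
    by move=> x y; rewrite upd_upd.
  exact: le_trans (Ex_Ep_sqr_le p hFG) IH.
have cE y : Eps (enum 'I_n) F y = Ex F.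
  rewrite -(Ex_Eps (enum 'I_n) hF) -[LHS](Ex_cst mu).
  apply: eq_Ex => y'; apply: (indep_all_cst (G := Eps (enum 'I_n) F)) => p x z.
  by apply: Eps_upd; rewrite mem_enum.
have := main (enum 'I_n); rewrite big_enum/=.
by under eq_Ex do rewrite cE.
Qed.

End EfronStein.

(** * Second moment of a Gaussian divergence *)

Section Divergence.
Context {R : realType} (n : nat).
Local Notation X := (n.-tuple R).
Variable mu : probability X R.
Hypothesis gv : gauss_vec mu.
Local Notation Ex := (Ex mu).

Definition pder p (F F' : X -> R) : Prop :=
  forall y (x : R), is_derive x 1 (fun x => F (upd p x y)) (F' (upd p x y)).

Definition pcont p (F : X -> R) : Prop :=
  forall y, continuous (fun x : R => F (upd p x y)).

Lemma pder_pcont p F F' : pder p F F' -> pcont p F.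
Proof.
move=> h y x; apply/differentiable_continuous/derivable1_diffP.
by have ? := h y x; exact: ex_derive.
Qed.

Lemma pderM p F F' G G' : pder p F F' -> pder p G G' ->
  pder p (fun y => F y * G y) (fun y => F' y * G y + F y * G' y).
Proof.
move=> hF hG y x; have dM := is_deriveM (hF y x) (hG y x).
have -> : F' (upd p x y) * G (upd p x y) + F (upd p x y) * G' (upd p x y) =
  F (upd p x y) *: G' (upd p x y) + G (upd p x y) *: F' (upd p x y).
  by rewrite /GRing.scale/=; ring.
exact: dM.
Qed.

Lemma pderB p F F' G G' : pder p F F' -> pder p G G' ->
  pder p (fun y => F y - G y) (fun y => F' y - G' y).
Proof. by move=> hF hG y x; exact: (is_deriveB (hF y x) (hG y x)). Qed.

Lemma pder_tnth p q : pder p (fun y => tnth y q) (fun=> (q == p)%:R).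
Proof.
move=> y x; have [->|qp] := eqVneq q p.
  rewrite (_ : (fun _ => _) = id); first exact: is_derive_id.
  by apply/funext => z; rewrite tnth_upd_eq.
rewrite (_ : (fun _ => _) = cst (tnth y q)); first exact: is_derive_cst.
by apply/funext => z; rewrite tnth_upd (negbTE qp).
Qed.

Lemma pcontM p F G : pcont p F -> pcont p G -> pcont p (fun y => F y * G y).
Proof. by move=> hF hG y x; apply: cvgM; [exact: hF|exact: hG]. Qed.

Lemma pcontD p F G : pcont p F -> pcont p G -> pcont p (fun y => F y + G y).
Proof. by move=> hF hG y x; apply: cvgD; [exact: hF|exact: hG]. Qed.

Lemma pcontB p F G : pcont p F -> pcont p G -> pcont p (fun y => F y - G y).
Proof. by move=> hF hG y x; apply: cvgB; [exact: hF|exact: hG]. Qed.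

Lemma pcont_cst p a : pcont p (fun=> a).
Proof. by move=> y x; exact: cvg_cst. Qed.

Lemma Ex_ibp_pder p F F' : eg F -> eg F' -> pder p F F' -> pcont p F' ->
  Ex (fun y => tnth y p * F y) = Ex F'.
Proof. by move=> *; apply: Ex_ibp. Qed.

Section Identity.
Variables (V : 'I_n -> X -> R) (D : 'I_n -> 'I_n -> X -> R)
  (DD : 'I_n -> 'I_n -> 'I_n -> X -> R).
Hypothesis egV : forall p, eg (V p).
Hypothesis egD' : forall p q, eg (D p q).
Hypothesis egDD : forall p q r, eg (DD p q r).
Hypothesis dV : forall p q, pder p (V q) (D p q).
Hypothesis dD : forall p q r, pder p (D q r) (DD p q r).
Hypothesis cDD : forall p q r s, pcont s (DD p q r).
(* Symmetry of the second derivatives of V. *)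
Hypothesis DDC : forall p q r y, DD p q r y = DD q p r y.

(** Here [D p q] is the derivative of [V q] in coordinate [p], and [K] is the factor of index [q].
    Integrating by parts in coordinate [p] cancels [D p p] and moves the derivative onto [K];
    integrating the resulting [tnth y q] term by parts leaves [D q p * D p q] and two terms with
    second derivatives, which cancel by [DDC]. *)
Lemma Ex_skew_mul p q :
  Ex (fun y => (tnth y p * V p y - D p p y) * (tnth y q * V q y - D q q y)) =
  (q == p)%:R * Ex (fun y => V p y * V q y) + Ex (fun y => D q p y * D p q y).
Proof.
pose K y := tnth y q * V q y - D q q y.
pose K' y := (q == p)%:R * V q y + tnth y q * D p q y - DD p q q y.
have cV r s : pcont r (V s) by exact: pder_pcont (dV r s).
have cD r s t : pcont r (D s t) by exact: pder_pcont (dD r s t).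
have ct r s : pcont r (fun y => tnth y s) by exact: pder_pcont (pder_tnth r s).
have egt r : eg (fun y : X => tnth y r) by exact: eg_tnth.
have egK : eg K by apply: egB => //; exact: egM.
have egK' : eg K'.
  by apply: egB => //; apply: egD; [exact: egZ|exact: egM].
have dK : pder p K K'.
  by apply: pderB => //; apply: pderM => //; exact: pder_tnth.
have cK' : pcont p K'.
  apply: pcontB => //; apply: pcontD; apply: pcontM => //; exact: pcont_cst.
have e1 : Ex (fun y => tnth y p * (V p y * K y)) =
    Ex (fun y => D p p y * K y + V p y * K' y).
  apply: Ex_ibp_pder.
  - exact: egM.
  - by apply: egD; exact: egM.
  - exact: pderM.
  - by apply: pcontD; apply: pcontM => //; exact: pder_pcont dK.
have e2 : Ex (fun y => tnth y q * (V p y * D p q y)) =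
    Ex (fun y => D q p y * D p q y + V p y * DD q p q y).
  apply: Ex_ibp_pder.
  - exact: egM.
  - by apply: egD; exact: egM.
  - exact: pderM.
  - by apply: pcontD; apply: pcontM.
transitivity (Ex (fun y => tnth y p * (V p y * K y) - D p p y * K y)).
  by apply: eq_Ex => y; rewrite /K; ring.
have egVK : eg (fun y => V p y * K y) by exact: egM.
have egVK' : eg (fun y => V p y * K' y) by exact: egM.
have egDK : eg (fun y => D p p y * K y) by exact: egM.
have egVV : eg (fun y => V p y * V q y) by exact: egM.
have egVD : eg (fun y => V p y * D p q y) by exact: egM.
have egVDD : eg (fun y => V p y * DD p q q y) by exact: egM.
have egDDs : eg (fun y => D q p y * D p q y) by exact: egM.
rewrite ExB//; last exact: egM.
rewrite e1 ExD// addrC addKr.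
transitivity (Ex (fun y => (q == p)%:R * (V p y * V q y) +
    (tnth y q * (V p y * D p q y) - V p y * DD p q q y))).
  by apply: eq_Ex => y; rewrite /K'; ring.
rewrite ExD//; [|exact: egZ|apply: egB => //; exact: egM].
rewrite ExZ//; congr (_ + _).
rewrite ExB//; last exact: egM.
rewrite e2 ExD//; last by exact: egM.
rewrite (eq_Ex mu (F := fun y => V p y * DD q p q y) (G := fun y => V p y * DD p q q y)).
  by rewrite addrK.
by move=> y; rewrite DDC.
Qed.

Lemma Ex_divergence_sqr :
  Ex (fun y => (\sum_p (tnth y p * V p y - D p p y)) ^+ 2) =
  Ex (fun y => \sum_p V p y ^+ 2) + Ex (fun y => \sum_p \sum_q D q p y * D p q y).
Proof.
have egs p : eg (fun y => tnth y p * V p y - D p p y).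
  by apply: egB => //; apply: egM => //; exact: eg_tnth.
transitivity (Ex (fun y => \sum_p \sum_q
    (tnth y p * V p y - D p p y) * (tnth y q * V q y - D q q y))).
  by apply: eq_Ex => y; rewrite expr2 big_distrlr.
rewrite [LHS](Ex_sum gv); last by move=> p _; apply: eg_sum => q _; exact: egM.
rewrite [X in _ = X + _](Ex_sum gv); last by move=> p _; exact: egX.
rewrite [X in _ = _ + X](Ex_sum gv); last by move=> p _; apply: eg_sum => q _; exact: egM.
rewrite -big_split/=; apply: eq_bigr => p _.
rewrite [LHS](Ex_sum gv); last by move=> q _; exact: egM.
rewrite [X in _ = _ + X](Ex_sum gv); last by move=> q _; exact: egM.
under eq_bigr do rewrite Ex_skew_mul.
rewrite big_split/=; congr (_ + _).
rewrite (bigD1 p)//= eqxx mul1r big1 ?addr0; last first.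
  by move=> q /negbTE ->; rewrite mul0r.
by apply: eq_Ex => y; rewrite expr2.
Qed.

End Identity.
End Divergence.

(** * Gibbs averages and their Stein bound *)

Section Gibbs.
Context {R : realType} (n : nat) (S : finType) (s0 : S).
Local Notation X := (n.-tuple R).
Variables (a : S -> 'I_n -> R) (b kap h0 : R).
Hypothesis a2 : forall s p, a s p ^+ 2 = 1.

(* Abstract Gibbs measure on the configurations S: [a s p] stands for sigma_i sigma_j
   with p = (i, j); in the application kap = 1 / N, b = beta / sqrt N and
   h0 = beta sqrt N / 2. [gav c th] is the quenched average <c th(H)>. *)
Definition Xs (s : S) (y : X) : R := \sum_p a s p * tnth y p.
Definition Ws (s : S) (y : X) : R := expR (b * Xs s y).
Definition Zs (y : X) : R := \sum_s Ws s y.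
Definition gw (s : S) (y : X) : R := Ws s y / Zs y.
Definition Hs (s : S) (y : X) : R := kap * Xs s y - h0.
Definition gav (c : S -> R) (th : R -> R) (y : X) : R :=
  \sum_s c s * th (Hs s y) * gw s y.
Definition mag p : X -> R := gav (fun s => a s p) (fun=> 1).

Lemma Ws_gt0 s y : 0 < Ws s y. Proof. exact: expR_gt0. Qed.

Lemma Zs_gt0 y : 0 < Zs y.
Proof.
rewrite /Zs (bigD1 s0)//= ltr_pwDl ?Ws_gt0// sumr_ge0// => s _.
exact/ltW/Ws_gt0.
Qed.

Lemma gw_ge0 s y : 0 <= gw s y.
Proof. by rewrite divr_ge0// ltW// ?Ws_gt0 ?Zs_gt0. Qed.

Lemma gw_sum y : \sum_s gw s y = 1.
Proof. by rewrite -mulr_suml divff// gt_eqF// Zs_gt0. Qed.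

Lemma a_norm s p : `|a s p| = 1.
Proof.
apply/eqP; rewrite -(@eqrXn2 _ 2)// ?expr1n.
by rewrite real_normK ?num_real// a2.
Qed.

Lemma measurable_Xs s : measurable_fun [set: X] (Xs s).
Proof.
apply: measurable_sum => p; apply: measurable_funM => //.
exact: measurable_tnth.
Qed.

Lemma measurable_Hs s : measurable_fun [set: X] (Hs s).
Proof. by apply: measurable_funB => //; apply: measurable_funM => //; exact: measurable_Xs. Qed.

Lemma measurable_Ws s : measurable_fun [set: X] (Ws s).
Proof. by apply: measurableT_comp => //; apply: measurable_funM => //; exact: measurable_Xs. Qed.

Lemma measurable_Zs : measurable_fun [set: X] Zs.
Proof. by apply: measurable_sum => s; exact: measurable_Ws. Qed.

Lemma measurable_gw s : measurable_fun [set: X] (gw s).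
Proof.
rewrite (_ : gw s = fun y => Ws s y * expR (- ln (Zs y))).
  apply: measurable_funM; first exact: measurable_Ws.
  apply: measurableT_comp => //; apply: measurableT_comp => //.
  by apply: measurableT_comp; [exact: measurable_ln|exact: measurable_Zs].
by apply/funext => y; rewrite expRN lnK// posrE Zs_gt0.
Qed.

Lemma eg_gw s : eg (gw s).
Proof.
apply: (eg_bounded (a := 1)); first exact: measurable_gw.
move=> y; rewrite ger0_norm ?gw_ge0// -(gw_sum y) (bigD1 s)//= lerDl sumr_ge0// => t _.
exact: gw_ge0.
Qed.

Lemma gav_bound c th C K y : (forall s, `|c s| <= C) -> (forall x, `|th x| <= K) ->
  `|gav c th y| <= C * K.
Proof.
move=> hc hK; rewrite (le_trans (ler_norm_sum _ _ _))//.
rewrite -[leRHS]mulr1 -(gw_sum y) mulr_sumr ler_sum// => s _.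
by rewrite normrM (ger0_norm (gw_ge0 s y)) normrM ler_wpM2r ?gw_ge0// ler_pM.
Qed.

Lemma measurable_gav c (th : R -> R) : measurable_fun [set: R] th -> measurable_fun [set: X] (gav c th).
Proof.
move=> mth; apply: measurable_sum => s; apply: measurable_funM; last exact: measurable_gw.
by apply: measurable_funM => //; apply: measurableT_comp => //; exact: measurable_Hs.
Qed.

Lemma eg_gav c (th : R -> R) K : measurable_fun [set: R] th -> (forall x, `|th x| <= K) ->
  eg (gav c th).
Proof.
move=> mth hK; apply: (eg_bounded (a := (\sum_s `|c s|) * K)); first exact: measurable_gav.
move=> y; apply: gav_bound => // s.
by rewrite (bigD1 s)//= lerDl sumr_ge0.
Qed.

Lemma Xs_upd s p x y : Xs s (upd p x y) = a s p * x + (Xs s y - a s p * tnth y p).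
Proof.
rewrite /Xs (bigD1 p)//= tnth_upd_eq; congr (_ + _).
rewrite [X in _ = X - _](bigD1 p)//= addrAC subrr add0r.
by apply: eq_bigr => q /negbTE qp; rewrite tnth_upd qp.
Qed.

Lemma pder_Xs s p : pder p (Xs s) (fun=> a s p).
Proof.
move=> y x; rewrite (_ : (fun _ => _) =
  fun x => a s p * x + (Xs s y - a s p * tnth y p)).
  apply: is_derive_eq; rewrite /GRing.scale/=; ring.
by apply/funext => z; rewrite Xs_upd.
Qed.

Lemma pder_comp p F F' (th th' : R -> R) : pder p F F' ->
  (forall x : R, is_derive x 1 th (th' x)) ->
  pder p (fun y : X => th (F y)) (fun y => th' (F y) * F' y).
Proof.
move=> hF hth y x.
have h := hth (F (upd p x y)); have h2 := hF y x.
exact: (@is_derive1_comp _ th (fun x => F (upd p x y)) x _ _ h h2).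
Qed.

Lemma pder_cst p c : pder p (fun _ : X => c) (fun=> 0 : R).
Proof. by move=> y x; exact: is_derive_cst. Qed.

Lemma eq_pder p (F G F' : X -> R) : pder p F F' -> F' =1 G -> pder p F G.
Proof. by move=> hF FG y x; rewrite -FG; exact: hF. Qed.

Lemma pder_sum (I : Type) (r : seq I) p (F F' : I -> X -> R) :
  (forall i, pder p (F i) (F' i)) ->
  pder p (fun y => \sum_(i <- r) F i y) (fun y => \sum_(i <- r) F' i y).
Proof.
move=> hF; elim: r => [|i r IH].
  move=> y x; rewrite big_nil (_ : (fun _ => _) = cst 0); first exact: is_derive_cst.
  by apply/funext => z; rewrite big_nil.
move=> y x; rewrite big_cons.
have -> : (fun x0 : R => \sum_(i0 <- i :: r) F i0 (upd p x0 y)) =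
    (fun x0 : R => F i (upd p x0 y)) + (fun x0 : R => \sum_(i0 <- r) F i0 (upd p x0 y)).
  by apply/funext => z; rewrite big_cons.
exact: (is_deriveD (hF i y x) (IH y x)).
Qed.

Lemma pder_Hs s p : pder p (Hs s) (fun=> kap * a s p).
Proof.
have h := pderB (pderM (pder_cst p kap) (pder_Xs s p)) (pder_cst p h0).
by apply: (eq_pder h) => y; ring.
Qed.

Lemma pder_Ws s p : pder p (Ws s) (fun y => b * a s p * Ws s y).
Proof.
have h := pder_comp (pderM (pder_cst p b) (pder_Xs s p)) (fun x => is_derive_expR x).
by apply: (eq_pder h) => y; rewrite /Ws; ring.
Qed.

Lemma mag_Ws p y : mag p y = (\sum_s a s p * Ws s y) / Zs y.
Proof. by rewrite /mag /gav mulr_suml; apply: eq_bigr => s _; rewrite /gw; ring. Qed.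

Lemma pder_Zs p : pder p Zs (fun y => b * mag p y * Zs y).
Proof.
have h := pder_sum (index_enum S) (pder_Ws^~ p).
apply: (eq_pder h) => y; rewrite mag_Ws -mulrA divfK ?gt_eqF ?Zs_gt0// mulr_sumr.
by apply: eq_bigr => s _; ring.
Qed.

Lemma pder_gw s p : pder p (gw s) (fun y => b * gw s y * (a s p - mag p y)).
Proof.
have zn y : Zs y != 0 by rewrite gt_eqF// Zs_gt0.
have hV : pder p (fun y => (Zs y)^-1) (fun y => - b * mag p y / Zs y).
  move=> y x; have hz := pder_Zs p y x.
  have h := is_deriveV (f := fun x => Zs (upd p x y)) (zn _) hz.
  have -> : - b * mag p (upd p x y) / Zs (upd p x y) =
      - Zs (upd p x y) ^- 2 *: (b * mag p (upd p x y) * Zs (upd p x y)).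
    by rewrite /GRing.scale/=; field; exact: zn.
  exact: h.
apply: (eq_pder (pderM (pder_Ws s p) hV)) => y.
by rewrite /gw; ring.
Qed.

(** Coordinate [p] acts twice: it moves H at rate [kap * a s p], and it moves the logarithm of the
    Gibbs weight at rate [b * (a s p - mag p y)]. The derivative is thus a connected correlation
    plus a term in [th']. *)
Lemma pder_gav c th th' p : (forall x : R, is_derive x 1 th (th' x)) ->
  pder p (gav c th) (fun y => gav (fun s => c s * a s p) (fun x => kap * th' x + b * th x) y
                              - b * gav c th y * mag p y).
Proof.
move=> hth.
have h := pder_sum (index_enum S) (fun s =>
  pderM (pderM (pder_cst p (c s)) (pder_comp (pder_Hs s p) hth)) (pder_gw s p)).
apply: (eq_pder h) => y /=; rewrite /gav mulr_sumr mulr_suml -sumrB.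
by apply: eq_bigr => s _; ring.
Qed.

Lemma pcont_sum (I : Type) (r : seq I) p (F : I -> X -> R) :
  (forall i, pcont p (F i)) -> pcont p (fun y => \sum_(i <- r) F i y).
Proof.
move=> hF; elim: r => [|i r IH].
  rewrite (_ : (fun _ => _) = fun=> 0); first exact: pcont_cst.
  by apply/funext => z; rewrite big_nil.
rewrite (_ : (fun _ => _) = fun y => F i y + \sum_(i <- r) F i y).
  exact: pcontD.
by apply/funext => z; rewrite big_cons.
Qed.

Lemma pcont_gav c (th : R -> R) p : continuous th -> pcont p (gav c th).
Proof.
move=> cth; apply: pcont_sum => s.
apply: pcontM; last exact: (pder_pcont (pder_gw s p)).
apply: pcontM; first exact: pcont_cst.
move=> y x.
apply: continuous_comp; [exact: (pder_pcont (pder_Hs s p))|exact: cth].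
Qed.

End Gibbs.

(** * The Stein identity under the Gibbs measure and its error terms *)

Section SteinBound.
Context {R : realType} (n : nat) (S : finType) (s0 : S).
Local Notation X := (n.-tuple R).
Variables (a : S -> 'I_n -> R) (b kap h0 : R).
Hypothesis a2 : forall s p, a s p ^+ 2 = 1.
Local Notation gw := (gw a b).
Local Notation Hs := (Hs a kap h0).
Local Notation gav := (gav a b kap h0).
Local Notation mag := (mag a b kap h0).
Local Notation one := (fun _ : S => 1 : R).

Definition Qst (s t : S) : R := \sum_p a s p * a t p.

(* Average over two independent replicas. *)
Definition av2 (f : S -> S -> R) (y : X) : R :=
  \sum_s \sum_t f s t * gw s y * gw t y.

Lemma eg_av2 f : eg (av2 f).
Proof.
apply: eg_sum => s _; apply: eg_sum => t _; apply: egM; last exact: eg_gw.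
by apply: egM; [exact: eg_cst|exact: eg_gw].
Qed.

Lemma av2_le f g y : (forall s t, f s t <= g s t) -> av2 f y <= av2 g y.
Proof.
move=> fg; apply: ler_sum => s _; apply: ler_sum => t _.
by rewrite ler_wpM2r ?gw_ge0// ler_wpM2r ?gw_ge0.
Qed.

Lemma av2_cst c y : av2 (fun _ _ => c) y = c.
Proof.
rewrite /av2 -[RHS]mulr1 -(gw_sum s0 a b y) mulr_sumr; apply: eq_bigr => s _.
by rewrite -mulr_sumr gw_sum// mulr1.
Qed.

Lemma av2D f g y : av2 (fun s t => f s t + g s t) y = av2 f y + av2 g y.
Proof.
rewrite /av2 -big_split/=; apply: eq_bigr => s _; rewrite -big_split/=.
by apply: eq_bigr => t _; ring.
Qed.

Lemma av2Z c f y : av2 (fun s t => c * f s t) y = c * av2 f y.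
Proof.
rewrite /av2 mulr_sumr; apply: eq_bigr => s _; rewrite mulr_sumr.
by apply: eq_bigr => t _; ring.
Qed.

Lemma av2_ge0 f y : (forall s t, 0 <= f s t) -> 0 <= av2 f y.
Proof. by move=> f0; rewrite -(av2_cst 0 y); exact: av2_le. Qed.

Lemma sqr_av2_le f y : av2 f y ^+ 2 <= av2 (fun s t => f s t ^+ 2) y.
Proof.
set m := av2 f y.
have : 0 <= av2 (fun s t => (f s t - m) ^+ 2) y by apply: av2_ge0 => s t; exact: sqr_ge0.
have -> : av2 (fun s t => (f s t - m) ^+ 2) y =
    av2 (fun s t => f s t ^+ 2 + ((- 2 * m) * f s t + m ^+ 2)) y.
  by apply: eq_bigr => s _; apply: eq_bigr => t _; ring.
rewrite av2D av2D av2Z av2_cst -/m; lra.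
Qed.

Lemma norm_av2_le f y : `|av2 f y| <= av2 (fun s t => `|f s t|) y.
Proof.
rewrite ler_norml; apply/andP; split.
  by rewrite -mulN1r -av2Z; apply: av2_le => s t; rewrite mulN1r lerNl -normrN ler_norm.
by apply: av2_le => s t; exact: ler_norm.
Qed.

Lemma gavM (c d : S -> R) (th et : R -> R) y :
  gav c th y * gav d et y = av2 (fun s t => c s * d t * (th (Hs s y) * et (Hs t y))) y.
Proof.
rewrite /gav big_distrlr; apply: eq_bigr => s _; apply: eq_bigr => t _ /=.
by ring.
Qed.

Lemma av2_sum (I : finType) (f : I -> S -> S -> R) y :
  \sum_i av2 (f i) y = av2 (fun s t => \sum_i f i s t) y.
Proof.
rewrite exchange_big; apply: eq_bigr => s _; rewrite exchange_big.
by apply: eq_bigr => t _ /=; rewrite !mulr_suml.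
Qed.

(** Once the product of averages is written over two replicas, the sum over [i] acts on the
    coefficients alone. With single pairs it produces |Q|, with pairs of pairs Q^2, and no
    cancellation in [th] or [et] is needed. *)
Lemma sum_gavM (I : finType) (c : I -> S -> R) (d : I -> S -> R) (th et : R -> R) K L y :
  (forall x, `|th x| <= K) -> (forall x, `|et x| <= L) ->
  `|\sum_i gav (c i) th y * gav (d i) et y| <=
  K * L * av2 (fun s t => `|\sum_i c i s * d i t|) y.
Proof.
move=> hK hL; under eq_bigr do rewrite gavM.
rewrite av2_sum (le_trans (norm_av2_le _ _))// -av2Z; apply: av2_le => s t.
by rewrite -mulr_suml normrM mulrC ler_wpM2r// normrM ler_pM.
Qed.

Section Core.
Variable mu : probability X R.
Hypothesis gv : gauss_vec mu.
Local Notation Ex := (Ex mu).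
Variables (psi psi1 psi2 : R -> R) (K K2 : R).
Hypothesis dpsi : forall x : R, is_derive x 1 psi (psi1 x).
Hypothesis dpsi1 : forall x : R, is_derive x 1 psi1 (psi2 x).
Hypothesis cpsi2 : continuous psi2.
Hypothesis psiK : forall x, `|psi x| <= K.
Hypothesis psi1K : forall x, `|psi1 x| <= K.
Hypothesis psi2K : forall x, `|psi2 x| <= K2.

(** [chi] is the test function that appears when an average of [psi] is differentiated in a
    coordinate, see [pder_gav]; [the2] arises in the same way from [chi]. *)
Let chi x := kap * psi1 x + b * psi x.
Let chi1 x := kap * psi2 x + b * psi1 x.
Let the2 x := kap * chi1 x + b * chi x.

Let dchi (x : R) : is_derive x 1 chi (chi1 x).
Proof.
have hp1 := dpsi1 x; have hp := dpsi x.
by rewrite /chi; apply: is_derive_eq.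
Qed.

Let cont (f f1 : R -> R) : (forall x : R, is_derive x 1 f (f1 x)) -> continuous f.
Proof.
move=> df x; apply/differentiable_continuous/derivable1_diffP.
by have ? := df x; exact: ex_derive.
Qed.

Let cpsi := cont dpsi.
Let cpsi1 := cont dpsi1.
Let cchi := cont dchi.

Let cthe2 : continuous the2.
Proof.
move=> x; apply: cvgD; apply: cvgM; try exact: cvg_cst; last exact: cchi.
apply: cvgD; apply: cvgM; try exact: cvg_cst; [exact: cpsi2|exact: cpsi1].
Qed.

Let K0 : 0 <= K. Proof. exact: le_trans (normr_ge0 _) (psiK 0). Qed.

Let chiK x : `|chi x| <= (`|kap| + `|b|) * K.
Proof.
rewrite mulrDl (le_trans (ler_normD _ _))// !normrM lerD// ler_wpM2l//.
Qed.

Let chi1K x : `|chi1 x| <= `|kap| * K2 + `|b| * K.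
Proof. by rewrite (le_trans (ler_normD _ _))// !normrM lerD// ler_wpM2l. Qed.

Let the2K x : `|the2 x| <= `|kap| * (`|kap| * K2 + `|b| * K) + `|b| * ((`|kap| + `|b|) * K).
Proof. by rewrite (le_trans (ler_normD _ _))// !normrM lerD// ler_wpM2l. Qed.

Let cm (f : R -> R) : continuous f -> measurable_fun [set: R] f.
Proof. by move=> cf; exact: continuous_measurable_fun. Qed.

(** [D q p] is the derivative of [V p] in coordinate [q], [dm p q] that of [mag q] in coordinate
    [p], and [DD p q r] that of [D q r] in coordinate [p]. The factor [kap * 0 + b * 1] is
    [pder_gav] read on the constant function 1. *)
Let V p := gav (a^~ p) psi.
Let D q p y := gav (fun s => a s p * a s q) chi y - b * V p y * mag q y.
Let dm p q y := gav (fun s => a s q * a s p) (fun=> kap * 0 + b * 1) y - b * mag q y * mag p y.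
Let DD p q r y := (gav (fun s => a s r * a s q * a s p) the2 y
    - b * gav (fun s => a s r * a s q) chi y * mag p y)
  - (b * D p r y * mag q y + b * V r y * dm p q y).

Let egV p : eg (V p). Proof. exact: eg_gav (cm cpsi) psiK. Qed.
Let egmag p : eg (mag p).
Proof. by apply: (@eg_gav R n S s0 a b kap h0 _ _ 1) => // x; rewrite normr1. Qed.

Let egbM (F G : X -> R) : eg F -> eg G -> eg (fun y => b * F y * G y).
Proof. by move=> hF hG; apply: egM => //; exact: egZ. Qed.

Let egD' q p : eg (D q p).
Proof. by apply: egB; [exact: eg_gav (cm cchi) chiK|exact: egbM]. Qed.
Let egdm p q : eg (dm p q).
Proof. by apply: egB; [exact: (@eg_gav R n S s0 a b kap h0 _ _ `|kap * 0 + b * 1|)|exact: egbM]. Qed.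
Let egDD p q r : eg (DD p q r).
Proof.
apply: egB; last by apply: egD; exact: egbM.
by apply: egB; [exact: eg_gav (cm cthe2) the2K|apply: egbM => //; exact: eg_gav (cm cchi) chiK].
Qed.

Let dV p q : pder p (V q) (D p q).
Proof. exact: pder_gav. Qed.
Let dmag p q : pder p (mag q) (dm p q).
Proof. by apply: (pder_gav s0 a b kap h0 (fun s => a s q) p) => x; exact: is_derive_cst. Qed.
Let dD p q r : pder p (D q r) (DD p q r).
Proof.
apply: (eq_pder (pderB (pder_gav s0 a b kap h0 (fun s => a s r * a s q) p dchi)
  (pderM (pderM (pder_cst p b) (dV p r)) (dmag p q)))) => y.
by rewrite /DD; congr (_ - _); ring.
Qed.

Let cDD p q r s : pcont s (DD p q r).
Proof.
have cD u v w : pcont u (D v w) by exact: pder_pcont (dD u v w).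
have cV u v : pcont u (V v) by exact: pder_pcont (dV u v).
have cmg u v : pcont u (mag v) by exact: pder_pcont (dmag u v).
have cb F G : pcont s F -> pcont s G -> pcont s (fun y => b * F y * G y).
  by move=> hF hG; apply: pcontM => //; apply: pcontM => //; exact: pcont_cst.
apply: pcontB; apply: pcontB || apply: pcontD.
- exact: pcont_gav.
- by apply: cb => //; exact: pcont_gav.
- exact: cb.
- apply: (cb) => //; apply: pcontB; last exact: cb.
  by apply: pcont_gav => // x; exact: cvg_cst.
Qed.

Let eq_gav (c d : S -> R) th y : c =1 d -> gav c th y = gav d th y.
Proof. by move=> cd; apply: eq_bigr => s _; rewrite cd. Qed.

Let DDC p q r y : DD p q r y = DD q p r y.
Proof.
rewrite /DD /D /dm (eq_gav (d := fun s => a s r * a s p * a s q)); last by move=> s; ring.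
rewrite (eq_gav (c := fun s => a s q * a s p) (d := fun s => a s p * a s q)); last by move=> s; ring.
ring.
Qed.

Let div y := \sum_p (tnth y p * V p y - D p p y).

Let Ex_div_sqr : Ex (fun y => div y ^+ 2) =
  Ex (fun y => \sum_p V p y ^+ 2) + Ex (fun y => \sum_p \sum_q D q p y * D p q y).
Proof. exact: (Ex_divergence_sqr gv egV egD' egDD dV dD cDD DDC). Qed.

Let absQ y := av2 (fun s t => `|Qst s t|) y.
Let sqrQ y := av2 (fun s t => Qst s t ^+ 2) y.

Let absQ_sqr y : absQ y ^+ 2 <= sqrQ y.
Proof.
rewrite (le_trans (sqr_av2_le _ _))//; apply: av2_le => s t.
by rewrite real_normK ?num_real.
Qed.

Let sum_sqr_le (th : R -> R) L y : (forall x, `|th x| <= L) ->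
  \sum_p gav (a^~ p) th y ^+ 2 <= L ^+ 2 * absQ y.
Proof.
move=> hL; rewrite (le_trans (ler_norm _))//.
under eq_bigr do rewrite expr2.
exact: (sum_gavM (fun p s => a s p) (fun p s => a s p) y hL hL).
Qed.

Let sum_sqr2_le (th : R -> R) L y : (forall x, `|th x| <= L) ->
  \sum_p \sum_q gav (fun s => a s p * a s q) th y ^+ 2 <= L ^+ 2 * sqrQ y.
Proof.
move=> hL; rewrite pair_bigA/= (le_trans (ler_norm _))//.
under eq_bigr do rewrite expr2.
apply: (le_trans (sum_gavM (fun pq s => a s pq.1 * a s pq.2)
  (fun pq s => a s pq.1 * a s pq.2) y hL hL)).
rewrite expr2 ler_wpM2l ?mulr_ge0// ?(le_trans _ (hL 0))//; apply: av2_le => s t.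
rewrite -[leRHS]ger0_norm ?sqr_ge0// /Qst expr2 big_distrlr/= pair_bigA/=.
by rewrite (eq_bigr (fun pq => a s pq.1 * a t pq.1 * (a s pq.2 * a t pq.2)))// => pq _; ring.
Qed.

(** [D] is not symmetric, so the product is first bounded by squares. Then [D] splits into a
    correlation of [chi], contributing 2 (|kap| + |b|)^2 <= 4 kap^2 + 4 b^2, and the product
    [b * V p * mag q], contributing 2 b^2. *)
Let sum_D_le y : \sum_p \sum_q D q p y * D p q y <=
  (4 * kap ^+ 2 + 6 * b ^+ 2) * K ^+ 2 * sqrQ y.
Proof.
apply: (@le_trans _ _ (\sum_p \sum_q D q p y ^+ 2)).
  have e : \sum_p \sum_q D q p y ^+ 2 =
      \sum_p \sum_q (D q p y ^+ 2 / 2 + D p q y ^+ 2 / 2).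
    under [RHS]eq_bigr do rewrite big_split/=.
    rewrite big_split/= [X in _ = _ + X]exchange_big -big_split/=.
    by apply: eq_bigr => p _; rewrite -big_split/=; apply: eq_bigr => q _; field.
  rewrite e; apply: ler_sum => p _; apply: ler_sum => q _.
  by have := sqr_ge0 (D q p y - D p q y); nra.
pose A p q := gav (fun s => a s p * a s q) chi y.
apply: (@le_trans _ _ (2 * \sum_p \sum_q A p q ^+ 2 +
    2 * b ^+ 2 * ((\sum_p V p y ^+ 2) * (\sum_q mag q y ^+ 2)))).
  rewrite big_distrlr/= !mulr_sumr -big_split/=; apply: ler_sum => p _.
  rewrite !mulr_sumr -big_split/=; apply: ler_sum => q _.
  rewrite /D -/(A p q); have := sqr_ge0 (A p q + b * V p y * mag q y); nra.
have hA := sum_sqr2_le y chiK; have hV := sum_sqr_le y psiK.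
have hm : \sum_q mag q y ^+ 2 <= 1 ^+ 2 * absQ y.
  by apply: sum_sqr_le => x; rewrite normr1.
have m0 : 0 <= \sum_q mag q y ^+ 2 by apply: sumr_ge0 => q _; exact: sqr_ge0.
have V0 : 0 <= \sum_p V p y ^+ 2 by apply: sumr_ge0 => q _; exact: sqr_ge0.
have hVm : (\sum_p V p y ^+ 2) * (\sum_q mag q y ^+ 2) <= K ^+ 2 * sqrQ y.
  apply: (le_trans (ler_pM V0 m0 hV hm)).
  by rewrite expr1n mul1r -mulrA -expr2 ler_wpM2l ?sqr_ge0.
have hc : ((`|kap| + `|b|) * K) ^+ 2 <= (2 * kap ^+ 2 + 2 * b ^+ 2) * K ^+ 2.
  rewrite exprMn ler_wpM2r ?sqr_ge0//.
  rewrite -(real_normK (num_real kap)) -(real_normK (num_real b)).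
  by have := sqr_ge0 (`|kap| - `|b|); nra.
have sQ : 0 <= sqrQ y by apply: av2_ge0 => s t; exact: sqr_ge0.
have hA' := le_trans hA (ler_wpM2r sQ hc).
have hb := ler_wpM2l (sqr_ge0 b) hVm.
have h1 := ler_wpM2l (ler0n R 2) hA'.
have h2 := ler_wpM2l (ler0n R 2) hb.
rewrite -[X in _ + X]mulrA (le_trans (lerD h1 h2))//.
by rewrite le_eqVlt; apply/orP; left; apply/eqP; ring.
Qed.

(** Multiplied by [kap], the terms [tnth y p * V p] add up to the average of (H + h0) psi(H). Since
    the [a s p] square to 1, the trace of [D] is [n] times the average of [chi] minus an overlap
    term. The two numerical hypotheses match the coefficients of psi' and psi up to the displayed
    remainders. *)
Let div_eq y : n%:R * kap * b = h0 - b / 2 -> 2 * n%:R * kap ^+ 2 = 1 - kap ->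
  gav one (fun x => psi1 x - 2 * x * psi x) y =
  - (2 * kap) * div y + kap * gav one psi1 y + b * gav one psi y +
  2 * b * kap * av2 (fun s t => Qst s t * psi (Hs s y)) y.
Proof.
move=> e1 e2.
have hX : kap * \sum_p tnth y p * V p y =
    gav one (fun x => x * psi x) y + h0 * gav one psi y.
  under eq_bigr do rewrite mulr_sumr.
  rewrite exchange_big/= mulr_sumr [X in _ = _ + X]mulr_sumr -big_split/=.
  apply: eq_bigr => s _.
  rewrite (eq_bigr (fun p => a s p * tnth y p * (psi (Hs s y) * gw s y))); last by move=> p _; ring.
  by rewrite -mulr_suml -/(Xs a s y) {2}/Hs; ring.
have hD : \sum_p D p p y = n%:R * (kap * gav one psi1 y + b * gav one psi y) -
    b * av2 (fun s t => Qst s t * psi (Hs s y)) y.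
  rewrite sumrB; congr (_ - _).
    rewrite (eq_bigr (fun=> kap * gav one psi1 y + b * gav one psi y)).
      by rewrite sumr_const card_ord mulr_natl.
    move=> p _; rewrite /gav 2!mulr_sumr -big_split/=; apply: eq_bigr => s _.
    by rewrite /chi -expr2 a2; ring.
  under eq_bigr do rewrite -mulrA.
  rewrite -mulr_sumr; congr (_ * _).
  under eq_bigr do rewrite gavM.
  rewrite av2_sum; apply: eq_bigr => s _; apply: eq_bigr => t _.
  by congr (_ * _ * _); rewrite -mulr_suml mulr1.
have e : gav one (fun x => psi1 x - 2 * x * psi x) y =
    gav one psi1 y - 2 * gav one (fun x => x * psi x) y.
  by rewrite mulr_sumr -sumrB; apply: eq_bigr => s _; ring.
rewrite e /div sumrB hD.
have -> : gav one (fun x => x * psi x) y =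
  kap * (\sum_p tnth y p * V p y) - h0 * gav one psi y by rewrite hX addrK.
set G1 := gav one psi1 y; set G2 := gav one psi y; set T := \sum_p _.
set Q := av2 _ y.
apply/eqP; rewrite -subr_eq0.
have -> : G1 - 2 * (kap * T - h0 * G2) -
   (- (2 * kap) * (T - (n%:R * (kap * G1 + b * G2) - b * Q)) + kap * G1 + b * G2 + 2 * b * kap * Q) =
  ((1 - kap) - 2 * n%:R * kap ^+ 2) * G1 + 2 * ((h0 - b / 2) - n%:R * kap * b) * G2 by field.
by rewrite e1 e2 !subrr mulr0 !mul0r addr0.
Qed.

Let egdiv : eg div.
Proof.
apply: eg_sum => p _; apply: egB => //; apply: egM => //; exact: eg_tnth.
Qed.

Let egsqrQ : eg sqrQ. Proof. exact: eg_av2. Qed.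

Let Ex_div_le S1 : 0 <= kap -> kap ^+ 2 * Ex sqrQ <= S1 ->
  kap ^+ 2 * Ex (fun y => div y ^+ 2) <=
  K ^+ 2 * (kap * (1 + S1) + (4 * kap ^+ 2 + 6 * b ^+ 2) * S1).
Proof.
move=> kap0 hS.
have hQ : kap ^+ 2 * Ex absQ <= kap * (1 + S1).
  rewrite expr2 -mulrA ler_wpM2l// -(ExZ gv); last exact: eg_av2.
  apply: (@le_trans _ _ (Ex (fun y => 1 + kap ^+ 2 * sqrQ y))).
    apply: (Ex_le gv); first by apply: egZ; exact: eg_av2.
      by apply: egD; [exact: eg_cst|exact: egZ].
    move=> y; rewrite -av2Z -(av2_cst 1 y) -av2Z -av2D; apply: av2_le => s t.
    rewrite -(real_normK (num_real (Qst s t))).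
    (* This is t <= 1 + t^2 for t = kap |Q|, which trades the first moment of the overlap for the
       second. *)
    by have := sqr_ge0 (kap * `|Qst s t| - 2^-1); lra.
  by rewrite (ExD gv) ?(ExZ gv) ?Ex_cst ?lerD2l//; [exact: eg_cst|exact: egZ].
have h1 : Ex (fun y => \sum_p V p y ^+ 2) <= K ^+ 2 * Ex absQ.
  rewrite -(ExZ gv); last exact: eg_av2.
  apply: (Ex_le gv) => [||y]; last exact: sum_sqr_le.
    by apply: eg_sum => p _; exact: egX.
  by apply: egZ; exact: eg_av2.
have h2 : Ex (fun y => \sum_p \sum_q D q p y * D p q y) <=
    (4 * kap ^+ 2 + 6 * b ^+ 2) * K ^+ 2 * Ex sqrQ.
  rewrite -(ExZ gv)//; apply: (Ex_le gv) => [||y]; last exact: sum_D_le.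
    by apply: eg_sum => p _; apply: eg_sum => q _; exact: egM.
  exact: egZ.
rewrite Ex_div_sqr (le_trans (ler_wpM2l (sqr_ge0 _) (lerD h1 h2)))//.
have -> : kap ^+ 2 * (K ^+ 2 * Ex absQ + (4 * kap ^+ 2 + 6 * b ^+ 2) * K ^+ 2 * Ex sqrQ) =
  K ^+ 2 * (kap ^+ 2 * Ex absQ + (4 * kap ^+ 2 + 6 * b ^+ 2) * (kap ^+ 2 * Ex sqrQ)) by ring.
rewrite ler_wpM2l ?sqr_ge0// lerD// ler_wpM2l//.
by apply: addr_ge0; apply: mulr_ge0 => //; exact: sqr_ge0.
Qed.

(** Squaring the four-term identity [div_eq] costs a factor 4, whence 16 = 4 * 2^2 for the
    coefficients 2 kap and 2 b kap. The constant [K2] is absent from the bound, which later permits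
    approximating psi by functions with large second derivatives. *)
Lemma stein_bound S1 : 0 <= kap -> n%:R * kap * b = h0 - b / 2 ->
  2 * n%:R * kap ^+ 2 = 1 - kap ->
  kap ^+ 2 * Ex (av2 (fun s t => Qst s t ^+ 2)) <= S1 ->
  Ex (fun y => gav one (fun x => psi1 x - 2 * x * psi x) y ^+ 2) <=
  K ^+ 2 * (16 * (kap * (1 + S1) + (4 * kap ^+ 2 + 6 * b ^+ 2) * S1) +
    4 * (kap ^+ 2 + b ^+ 2) + 16 * b ^+ 2 * S1).
Proof.
move=> kap0 e1 e2 hS.
have gb (th : R -> R) y : (forall x, `|th x| <= K) -> gav one th y ^+ 2 <= K ^+ 2.
  move=> hth; rewrite -(real_normK (num_real (gav _ _ _))) lerXn2r ?nnegrE//.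
  rewrite -[leRHS]mul1r; apply: gav_bound => // s; by rewrite normr1.
have pw y : gav one (fun x => psi1 x - 2 * x * psi x) y ^+ 2 <=
    (16 * (kap ^+ 2 * div y ^+ 2) + 4 * (kap ^+ 2 + b ^+ 2) * K ^+ 2) +
    16 * b ^+ 2 * K ^+ 2 * (kap ^+ 2 * sqrQ y).
  rewrite (div_eq y e1 e2).
  have h1 := gb _ y psi1K; have h2 := gb _ y psiK.
  set Q := av2 _ y.
  have h3 : Q ^+ 2 <= K ^+ 2 * sqrQ y.
    rewrite (le_trans (sqr_av2_le _ _))// -av2Z; apply: av2_le => s t.
    rewrite exprMn mulrC ler_wpM2r ?sqr_ge0//.
    by rewrite -(real_normK (num_real (psi _))) lerXn2r ?nnegrE.
  have h4 (x1 x2 x3 x4 : R) : (x1 + x2 + x3 + x4) ^+ 2 <=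
      4 * x1 ^+ 2 + 4 * x2 ^+ 2 + 4 * x3 ^+ 2 + 4 * x4 ^+ 2.
    have := sqr_ge0 (x1 - x2); have := sqr_ge0 (x1 - x3); have := sqr_ge0 (x1 - x4).
    have := sqr_ge0 (x2 - x3); have := sqr_ge0 (x2 - x4); have := sqr_ge0 (x3 - x4).
    nra.
  rewrite (le_trans (h4 _ _ _ _))// !exprMn sqrrN !exprMn.
  have k1 := ler_wpM2l (sqr_ge0 kap) h1; have k2 := ler_wpM2l (sqr_ge0 b) h2.
  have k3 := ler_wpM2l (mulr_ge0 (sqr_ge0 b) (sqr_ge0 kap)) h3.
  apply: (le_trans (lerD (lerD (lerD (lexx _) (ler_wpM2l (ler0n R 4) k1))
    (ler_wpM2l (ler0n R 4) k2)) (lexx _))).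
  rewrite -subr_ge0 in k3; have := mulr_ge0 (ler0n R 16) k3.
  by rewrite -[in X in _ -> X]subr_ge0; congr (0 <= _); ring.
have egl : eg (fun y => 16 * (kap ^+ 2 * div y ^+ 2) + 4 * (kap ^+ 2 + b ^+ 2) * K ^+ 2).
  by apply: egD; [apply: egZ; apply: egZ; exact: egX|exact: eg_cst].
have egr : eg (fun y => 16 * b ^+ 2 * K ^+ 2 * (kap ^+ 2 * sqrQ y)) by do 2 apply: egZ.
apply: (@le_trans _ _ (Ex (fun y =>
  (16 * (kap ^+ 2 * div y ^+ 2) + 4 * (kap ^+ 2 + b ^+ 2) * K ^+ 2) +
    16 * b ^+ 2 * K ^+ 2 * (kap ^+ 2 * sqrQ y)))).
  apply: (Ex_le gv) => //; last exact: egD.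
  (* The test function contains x psi(x), for which no bound is assumed, so growth is deduced from
     the pointwise estimate [pw] rather than from [eg_gav]. *)
  apply: eg_le (egD egl egr) _ => [|y]; last first.
    by rewrite ger0_norm ?sqr_ge0// (le_trans (pw y))// ler_norm.
  apply: measurable_funX; apply: (measurable_gav s0).
  apply: measurable_funB; first exact: cm.
  by apply: measurable_funM; [apply: measurable_funM|exact: cm].
rewrite (ExD gv)// (ExD gv); [|by apply: egZ; apply: egZ; exact: egX|exact: eg_cst].
rewrite Ex_cst (ExZ gv _ (egZ _ (egX 2 egdiv))).
rewrite (ExZ gv _ (egX 2 egdiv)).
rewrite (ExZ gv _ (egZ _ egsqrQ)).
rewrite (ExZ gv)//.
have hd := Ex_div_le kap0 hS.
have p0 : 0 <= 16 * b ^+ 2 * K ^+ 2.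
  by apply: mulr_ge0; [apply: mulr_ge0 => //|]; exact: sqr_ge0.
have h3 := ler_wpM2l p0 hS; have h1 := ler_wpM2l (ler0n R 16) hd.
rewrite (le_trans (lerD (lerD h1 (lexx _)) h3))//.
by rewrite le_eqVlt; apply/orP; left; apply/eqP; ring.
Qed.

End Core.
End SteinBound.

(** * Free energy fluctuations and overlap moments *)

Section RealInequalities.
Context {R : realType}.

Lemma is_derive_lipschitz (f f' : R -> R) K :
  (forall x : R, is_derive x 1 f (f' x)) -> (forall x, `|f' x| <= K) ->
  forall x y, `|f x - f y| <= K * `|x - y|.
Proof.
move=> df fK.
have cf : continuous f.
  move=> x; apply/differentiable_continuous/derivable1_diffP.
  by have ? := df x; exact: ex_derive.
have main x y : x < y -> `|f y - f x| <= K * `|y - x|.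
  move=> xy.
  have [c _ ->] := @MVT R f f' x y xy (fun z _ => df z) (continuous_subspaceT cf).
  by rewrite normrM ler_wpM2r.
move=> x y; case: (ltgtP x y) => [xy|yx|->].
- by rewrite distrC [X in _ * X]distrC main.
- exact: main.
- by rewrite !subrr normr0 mulr0.
Qed.

Lemma sqr_le_expR (x : R) : 0 <= x -> x ^+ 2 <= 4 * expR x.
Proof.
move=> x0; have -> : expR x = expR (x / 2) ^+ 2 by rewrite expr2 -expRD; congr expR; field.
have h := expR_ge1Dx (x / 2); have h0 : 0 <= 1 + x / 2 by lra.
have := ler_pM h0 h0 h h; rewrite -!expr2; nra.
Qed.

Lemma ln_sqr_le (x : R) : 1 <= x -> ln x ^+ 2 <= 4 * x.
Proof.
move=> x1; rewrite -{2}(lnK (x := x)) ?posrE; last lra.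
by apply: sqr_le_expR; rewrite ln_ge0.
Qed.

Lemma expR_jensen (I : finType) (g d : I -> R) :
  (forall i, 0 <= g i) -> \sum_i g i = 1 ->
  expR (\sum_i g i * d i) <= \sum_i g i * expR (d i).
Proof.
move=> g0 g1; set m := \sum_i g i * d i.
have -> : expR m = \sum_i g i * (expR m * (1 + (d i - m))).
  rewrite (eq_bigr (fun i => expR m * (1 - m) * g i + expR m * (g i * d i))).
    by rewrite big_split/= -!mulr_sumr g1 -/m; ring.
  by move=> i _; ring.
apply: ler_sum => i _; rewrite ler_wpM2l//.
rewrite (le_trans (ler_wpM2l (expR_ge0 m) (expR_ge1Dx (d i - m))))//.
by rewrite -expRD addrC subrK.
Qed.

(** Pointwise form of the Paley-Zygmund argument. If l <= -1, then exp l <= 1 / 2. Otherwise (l +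
    m)^2 >= (m - 1)^2, and exp l is at most exp (2 l) / (4 c) + c by completing the square. *)
Lemma expR_paley_zygmund (l m c : R) : 0 < c -> 1 < m ->
  expR l <= 2^-1 + (4 * c)^-1 * expR (2 * l) + c * ((l + m) ^+ 2 / (m - 1) ^+ 2).
Proof.
move=> c0 m1.
have e2 : expR (2 * l) = expR l ^+ 2 by rewrite expr2 -expRD; congr expR; ring.
have p1 : 0 <= (4 * c)^-1 * expR (2 * l).
  by rewrite mulr_ge0 ?expR_ge0// invr_ge0 mulr_ge0// ltW.
have p2 : 0 <= c * ((l + m) ^+ 2 / (m - 1) ^+ 2).
  by apply: mulr_ge0; [exact: ltW|apply: divr_ge0; exact: sqr_ge0].
have [l1|l1] := leP l (-1).
  have h1 : expR l <= expR (-1) by rewrite ler_expR.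
  have h2 : expR (-1) <= 2^-1 :> R.
    rewrite expRN lef_pV2 ?posrE ?expR_gt0//.
    have := @expR_ge1Dx R 1; lra.
  by move: (le_trans h1 h2) p1 p2; lra.
have h : 1 <= (l + m) ^+ 2 / (m - 1) ^+ 2.
  rewrite ler_pdivlMr ?mul1r; last by rewrite exprn_gt0// subr_gt0.
  by rewrite lerXn2r ?nnegrE//; lra.
have h3 := ler_wpM2l (ltW c0) h.
have h4 : expR l <= (4 * c)^-1 * expR (2 * l) + c.
  rewrite e2 -subr_ge0.
  have -> : (4 * c)^-1 * expR l ^+ 2 + c - expR l = (4 * c)^-1 * (expR l - 2 * c) ^+ 2.
    by field; rewrite gt_eqF.
  by rewrite mulr_ge0 ?sqr_ge0// invr_ge0 mulr_ge0// ltW.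
lra.
Qed.

End RealInequalities.

Section FreeEnergy.
Context {R : realType} (n : nat) (S : finType) (s0 : S).
Local Notation X := (n.-tuple R).
Variables (a : S -> 'I_n -> R) (b kap h0 : R).
Hypothesis a2 : forall s p, a s p ^+ 2 = 1.
Local Notation Xs := (Xs a).
Local Notation Ws := (Ws a b).
Local Notation Zs := (Zs a b).
Local Notation gw := (gw a b).
Local Notation mag := (mag a b kap h0).
Local Notation Q := (Qst a).
Local Notation av2 := (av2 a b).

Lemma magE p y : mag p y = \sum_s gw s y * a s p.
Proof. by apply: eq_bigr => s _; rewrite mulr1 mulrC. Qed.

Lemma sum_mag_sqr y : \sum_p mag p y ^+ 2 = av2 Q y.
Proof.
under eq_bigr do rewrite expr2 gavM.
by rewrite av2_sum; apply: eq_bigr => s _; apply: eq_bigr => t _; under eq_bigr do rewrite !mulr1.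
Qed.

Lemma eg_mag p : eg (mag p).
Proof. by apply: (@eg_gav R n S s0 a b kap h0 _ _ 1) => // x; rewrite normr1. Qed.

(** Convexity of ln Z in exponentiated form: Z(y') / Z(y) is a Gibbs average at [y] of exponentials,
    to which Jensen's inequality applies. *)
Lemma Zs_convex y y' :
  Zs y * expR (b * \sum_s gw s y * (Xs s y' - Xs s y)) <= Zs y'.
Proof.
have Z0 := Zs_gt0 s0 a b y.
have := expR_jensen (fun s => b * (Xs s y' - Xs s y)) (gw_ge0 s0 a b ^~ y) (gw_sum s0 a b y).
have -> : \sum_i gw i y * (b * (Xs i y' - Xs i y)) =
    b * \sum_s gw s y * (Xs s y' - Xs s y).
  by rewrite mulr_sumr; apply: eq_bigr => s _; ring.
move=> /(ler_wpM2l (ltW Z0)) /le_trans; apply.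
rewrite mulr_sumr le_eqVlt; apply/orP; left; apply/eqP; apply: eq_bigr => s _.
rewrite mulrA [Zs y * _]mulrC divfK ?gt_eqF// /Ws -expRD; congr expR; ring.
Qed.

Definition lnZ y : R := ln (Zs y).

Lemma lnZ_convex y y' : lnZ y + b * \sum_s gw s y * (Xs s y' - Xs s y) <= lnZ y'.
Proof.
have Z0 := Zs_gt0 s0 a b y.
rewrite -[X in _ + X]expRK -lnM ?posrE ?expR_gt0//.
by rewrite ler_ln ?posrE ?mulr_gt0 ?expR_gt0 ?Zs_gt0//; exact: Zs_convex.
Qed.

Lemma lnZ_upd_lb p y x : lnZ y + b * (x - tnth y p) * mag p y <= lnZ (upd p x y).
Proof.
apply: le_trans (lnZ_convex y (upd p x y)); rewrite lerD2l -mulrA magE.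
rewrite le_eqVlt; apply/orP; left; apply/eqP; congr (_ * _).
by rewrite mulr_sumr; apply: eq_bigr => s _; rewrite Xs_upd; ring.
Qed.

(** Along its own coordinate the magnetization has derivative [b * (1 - f z ^+ 2)], of absolute
    value at most [|b|] because the magnetization lies in [-1, 1]. *)
Lemma mag_upd_le p y x : `|mag p y - mag p (upd p x y)| <= `|b| * `|tnth y p - x|.
Proof.
pose f z := mag p (upd p z y).
pose f' z := b - b * f z * f z.
have df (z : R) : is_derive z 1 f (f' z).
  have h := pder_gav s0 a b kap h0 (fun s => a s p) p (fun x : R => is_derive_cst (1 : R) x 1) y z.
  have e : gav a b kap h0 (fun s => a s p * a s p) (fun=> kap * 0 + b * 1) (upd p z y) = b.
    rewrite /gav (eq_bigr (fun s => b * gw s (upd p z y))) -?mulr_sumr ?gw_sum ?mulr1//.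
    by move=> s _; rewrite -expr2 a2; ring.
  by rewrite /f' -{1}e.
have fb z : `|f' z| <= `|b|.
  have hm : `|f z| <= 1.
    have := @gav_bound R n S s0 a b kap h0 (fun s => a s p) (fun=> 1) 1 1 (upd p z y).
    rewrite mulr1; apply=> [s|_]; last by rewrite normr1.
    by rewrite a_norm.
  have -> : f' z = b * (1 - f z ^+ 2) by rewrite /f'; ring.
  rewrite normrM -[leRHS]mulr1 ler_wpM2l//.
  have h2 : f z ^+ 2 <= 1.
    by rewrite -(real_normK (num_real (f z))) expr_le1.
  by rewrite ger0_norm ?subr_ge0//; have := sqr_ge0 (f z); lra.
have := is_derive_lipschitz df fb (tnth y p) x.
by rewrite /f upd_id.
Qed.

(** The tangent lines of the convex function ln Z at both ends enclose the increment between b z m0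
    and b z m, and m differs from m0 by at most |b z|. The magnetization is taken at [upd p 0 y] so
    that it is independent of coordinate [p] and factors out of the expectation. *)
Lemma lnZ_upd_sqr_le p y :
  (lnZ y - lnZ (upd p 0 y)) ^+ 2 <=
  2 * b ^+ 2 * tnth y p ^+ 2 * mag p (upd p 0 y) ^+ 2 + 2 * b ^+ 4 * tnth y p ^+ 4.
Proof.
set m0 := mag p (upd p 0 y); set z := tnth y p.
have h1 := lnZ_upd_lb p y 0.
have h2 := lnZ_upd_lb p (upd p 0 y) z.
rewrite upd_upd upd_id tnth_upd_eq subr0 -/m0 in h2; rewrite -/z sub0r in h1.
have h3 := mag_upd_le p y 0; rewrite -/m0 -/z subr0 in h3.
set m := mag p y in h1 h3.
set d := lnZ y - _.
have dlb : b * z * m0 <= d by rewrite /d; lra.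
have dub : d <= b * z * m by rewrite /d; lra.
have hm : `|b * z * m| <= `|b * z * m0| + (b * z) ^+ 2.
  have -> : b * z * m = b * z * m0 + b * z * (m - m0) by ring.
  rewrite (le_trans (ler_normD _ _))// lerD2l -(real_normK (num_real (b * z))).
  by rewrite expr2 [X in X <= _]normrM ler_wpM2l// normrM.
have hd : `|d| <= `|b * z * m0| + (b * z) ^+ 2.
  rewrite ler_norml; apply/andP; split.
    have := ler_norm (- (b * z * m0)); rewrite normrN.
    by have := sqr_ge0 (b * z); lra.
  by rewrite (le_trans dub)// (le_trans (ler_norm _)).
rewrite -(real_normK (num_real d)).
have h5 : `|d| ^+ 2 <= (`|b * z * m0| + (b * z) ^+ 2) ^+ 2.
  by rewrite lerXn2r ?nnegrE// addr_ge0// sqr_ge0.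
rewrite (le_trans h5)//.
have -> : 2 * b ^+ 2 * z ^+ 2 * m0 ^+ 2 + 2 * b ^+ 4 * z ^+ 4 =
  2 * `|b * z * m0| ^+ 2 + 2 * ((b * z) ^+ 2) ^+ 2.
  by rewrite real_normK ?num_real//; ring.
have := sqr_ge0 (`|b * z * m0| - (b * z) ^+ 2); lra.
Qed.

End FreeEnergy.

Section OverlapBound.
Context {R : realType}.

(** The value of E exp (k g^2 / 2) for a standard Gaussian g and k < 1. *)
Definition exp_cst (k : R) : R := (Num.sqrt (1 - k))^-1.

(* Bounds - E ln (Z / E Z). *)
Definition energy_cst (beta : R) : R :=
  let lam := (1 - beta ^+ 2) / 2 in
  let C2 := exp_cst (beta ^+ 2) in
  let CA := exp_cst (beta ^+ 2 + lam) in
  32 * C2 / lam + 4 * C2 * (4 * (CA + 1) / lam + 5) + 2.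

(** Read off from [overlap_bound]: 6 = 2 * 3 combines the bounds on Y^2 and on F^2 there, [CA]
    bounds the tilted moment, and the innermost sum bounds E L^2. *)
Definition overlap_cst (beta : R) : R :=
  let lam := (1 - beta ^+ 2) / 2 in
  let CA := exp_cst (beta ^+ 2 + lam) in
  let Bm := energy_cst beta in
  2 / lam ^+ 2 * (6 * (lam ^+ 2 / 4 + 4 * CA +
    4 * (4 * ((CA + 2 * Bm) / lam) + 5 + Bm ^+ 2)) + 8) + 2^-1.

Context (n : nat) (S : finType) (s0 : S).
Local Notation X := (n.-tuple R).
Variables (a : S -> 'I_n -> R) (b kap h0 : R).
Hypothesis a2 : forall s p, a s p ^+ 2 = 1.
Variable mu : probability X R.
Hypothesis gv : gauss_vec mu.
Local Notation Ex := (Ex mu).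
Local Notation Xs := (Xs a).
Local Notation Ws := (Ws a b).
Local Notation Zs := (Zs a b).
Local Notation gw := (gw a b).
Local Notation mag := (mag a b kap h0).
Local Notation Q := (Qst a).
Local Notation av2 := (av2 a b).
Local Notation lnZ := (lnZ a b).
Local Notation M := (#|S|%:R : R).

Let M0 : 0 < M. Proof. by rewrite ltr0n; apply/card_gt0P; exists s0. Qed.
Let Z0 y : 0 < Zs y. Proof. exact: Zs_gt0 s0 a b y. Qed.

Let egt p : eg (fun y : X => tnth y p). Proof. exact: eg_tnth. Qed.

Lemma pder_indep p (G : X -> R) : (forall x y, G (upd p x y) = G y) -> pder p G (fun=> 0).
Proof.
move=> h y x; rewrite (_ : (fun _ => _) = cst (G y)); first exact: is_derive_cst.
by apply/funext => z; rewrite h.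
Qed.

Lemma Ex_tnth_sqr_indep p (G : X -> R) : eg G -> (forall x y, G (upd p x y) = G y) ->
  Ex (fun y => tnth y p ^+ 2 * G y) = Ex G.
Proof.
move=> hG iG; have iGd := pder_indep iG.
transitivity (Ex (fun y => tnth y p * (tnth y p * G y))).
  by apply: eq_Ex => y; ring.
rewrite (Ex_ibp_pder gv (F' := fun y => 1 * G y + tnth y p * 0)).
- by apply: eq_Ex => y; ring.
- exact: egM.
- by apply: egD; apply: egM => //; exact: eg_cst.
- by have := pderM (pder_tnth p p) iGd; rewrite eqxx.
- apply: pcontD; apply: pcontM; try exact: pcont_cst.
    exact: pder_pcont iGd.
  exact: pder_pcont (pder_tnth p p).
Qed.

Lemma Ex_tnth_sqr p : Ex (fun y => tnth y p ^+ 2) = 1.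
Proof.
rewrite -[RHS](Ex_cst mu) -[RHS](@Ex_tnth_sqr_indep p)//; last exact: eg_cst.
by apply: eq_Ex => y; rewrite mulr1.
Qed.

Lemma Ex_tnth_4 p : Ex (fun y => tnth y p ^+ 4) = 3.
Proof.
transitivity (Ex (fun y => tnth y p * (tnth y p * (tnth y p * tnth y p)))).
  by apply: eq_Ex => y; ring.
have dt : pder p (fun y : X => tnth y p) (fun=> 1).
  by have := pder_tnth (R := R) p p; rewrite eqxx.
have ct := pder_pcont dt.
have d3 := pderM dt (pderM dt dt).
rewrite (Ex_ibp_pder gv _ _ d3).
- rewrite (eq_Ex mu (G := fun y => 3 * tnth y p ^+ 2)); last by move=> y; ring.
  by rewrite (ExZ gv) ?Ex_tnth_sqr ?mulr1//; exact: egX.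
- by do 2 apply: egM => //.
- by apply: egD; apply: egM; try exact: eg_cst; try exact: egM;
    try (apply: egD; apply: egM => //; exact: eg_cst).
- by apply: pcontD; apply: pcontM; try exact: pcont_cst; try exact: pcontM => //;
    try (apply: pcontD; apply: pcontM => //; exact: pcont_cst).
Qed.

Let WsE s y : Ws s y = expR (\sum_p (b * a s p) * tnth y p).
Proof.
by rewrite /Ws /Xs mulr_sumr; congr expR; apply: eq_bigr => p _; ring.
Qed.

Let egWs s : eg (Ws s).
Proof.
rewrite (_ : Ws s = fun y => expR (\sum_p (b * a s p) * tnth y p)).
  exact: eg_expR_lin.
by apply/funext => y; exact: WsE.
Qed.

Let sum_sqr : \sum_(p < n) b ^+ 2 / 2 = n%:R * (b ^+ 2 / 2).
Proof. by rewrite sumr_const card_ord mulr_natl. Qed.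

Lemma Ex_Zs : Ex Zs = M * expR (n%:R * b ^+ 2 / 2).
Proof.
rewrite (Ex_sum gv)//.
under eq_bigr => s _.
  rewrite (eq_Ex mu (WsE s)) (Ex_expR_lin gv).
  rewrite (eq_bigr (fun=> b ^+ 2 / 2)); last by move=> p _; rewrite exprMn a2 mulr1.
  rewrite sum_sqr mulrA; over.
by rewrite sumr_const [RHS]mulr_natl; congr (_ *+ _); exact: eq_card.
Qed.

(** Multiplying by Z^2 removes the Gibbs normalisation, so the replicas become free sums. Since each
    [a s p] squares to 1, E exp (b X_s + b X_t) equals exp (n b^2 + b^2 Q(s, t)). *)
Lemma Ex_Zs_sqr_av2 f :
  Ex (fun y => Zs y ^+ 2 * av2 f y) =
  expR (n%:R * b ^+ 2) * \sum_s \sum_t f s t * expR (b ^+ 2 * Q s t).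
Proof.
have egW s t : eg (fun y => f s t * (Ws s y * Ws t y)) by apply: egZ; exact: egM.
transitivity (Ex (fun y => \sum_s \sum_t f s t * (Ws s y * Ws t y))).
  apply: eq_Ex => y; rewrite mulr_sumr; apply: eq_bigr => s _.
  rewrite mulr_sumr; apply: eq_bigr => t _; rewrite /gw; field.
  by rewrite gt_eqF.
rewrite (Ex_sum gv); last by move=> s _; apply: eg_sum.
rewrite mulr_sumr; apply: eq_bigr => s _; rewrite (Ex_sum gv)// mulr_sumr.
apply: eq_bigr => t _; rewrite (ExZ gv); last exact: egM.
rewrite mulrCA; congr (_ * _).
rewrite (eq_Ex mu (G := fun y => expR (\sum_p (b * (a s p + a t p)) * tnth y p))); last first.
  move=> y; rewrite !WsE -expRD -big_split/=; congr expR; apply: eq_bigr => p _; ring.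
rewrite (Ex_expR_lin gv) -expRD; congr expR.
rewrite mulr_sumr -[n%:R * _]mulrC.
have -> : b ^+ 2 * n%:R = \sum_(p < n) b ^+ 2 by rewrite sumr_const card_ord mulr_natr.
rewrite -big_split/=; apply: eq_bigr => p _.
have := a2 s p; have := a2 t p; move: (a s p) (a t p) => u v hv hu.
have -> : (b * (u + v)) ^+ 2 / 2 = b ^+ 2 * (u ^+ 2 + v ^+ 2) / 2 + b ^+ 2 * (u * v) by field.
by rewrite hu hv; field.
Qed.

Let egl1 : eg (@l1 R n).
Proof. by apply: eg_sum => p _; exact: eg_norm. Qed.

Lemma eg_lnZ : eg lnZ.
Proof.
have Xl s y : `|b * Xs s y| <= `|b| * l1 y.
  rewrite normrM ler_wpM2l// (le_trans (ler_norm_sum _ _ _))//.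
  by apply: ler_sum => p _; rewrite normrM a_norm// mul1r.
apply: (eg_le (G := fun y => `|ln M| + `|b| * l1 y)).
- apply: measurableT_comp; first exact: measurable_ln.
  exact: measurable_Zs.
- by apply: egD; [exact: eg_cst|exact: egZ].
- move=> y; have l0 := l1_ge0 y.
  rewrite [leRHS]ger0_norm; last by rewrite addr_ge0// mulr_ge0.
  rewrite ler_norml; apply/andP; split.
    apply: (@le_trans _ _ (b * Xs s0 y)).
      have := Xl s0 y; rewrite ler_norml => /andP[h _].
      by rewrite opprD (le_trans _ h)// gerDr oppr_le0.
    rewrite -[leLHS]expRK ler_ln ?posrE ?expR_gt0//.
    by rewrite /Zs (bigD1 s0)//= lerDl sumr_ge0// => s _; exact: expR_ge0.
  apply: (@le_trans _ _ (ln M + `|b| * l1 y)); last by rewrite lerD2r ler_norm.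
  rewrite -[X in _ + X]expRK -lnM ?posrE ?expR_gt0// ler_ln ?posrE ?mulr_gt0 ?expR_gt0//.
  rewrite /Zs mulr_natl -sumr_const; apply: ler_sum => s _.
  by rewrite ler_expR (le_trans (ler_norm _)).
Qed.

Let egmag p : eg (mag p). Proof. exact: eg_mag. Qed.

(** Efron-Stein with [lnZ_upd_sqr_le]. The constants are 4 = 2 * 2 and 10 = 2 * 2 + 2 * 3, where the
    last 3 is the fourth Gaussian moment. *)
Lemma var_lnZ : Ex (fun y => (lnZ y - Ex lnZ) ^+ 2) <=
  4 * b ^+ 2 * Ex (av2 Q) + 10 * n%:R * b ^+ 4.
Proof.
rewrite (le_trans (efron_stein gv eg_lnZ))//.
have -> : Ex (av2 Q) = \sum_p Ex (fun y => mag p y ^+ 2).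
  rewrite -(Ex_sum gv) => [|p _]; last exact: egX.
  by apply: eq_Ex => y; rewrite (sum_mag_sqr a b kap h0).
have -> : 10 * n%:R * b ^+ 4 = \sum_(p < n) (10 * b ^+ 4).
  by rewrite sumr_const card_ord -[RHS]mulr_natl; ring.
rewrite mulr_sumr -big_split/=; apply: ler_sum => p _.
pose m0 y := mag p (upd p 0 y).
have egm0 : eg m0 by exact: eg_upd.
have eg1 : eg (fun y => 2 * b ^+ 2 * (tnth y p ^+ 2 * m0 y ^+ 2)).
  by apply: egZ; apply: egM; exact: egX.
have eg2 : eg (fun y => 2 * b ^+ 4 * tnth y p ^+ 4) by apply: egZ; exact: egX.
apply: (@le_trans _ _ (Ex (fun y =>
    2 * b ^+ 2 * (tnth y p ^+ 2 * m0 y ^+ 2) + 2 * b ^+ 4 * tnth y p ^+ 4))).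
  apply: (Ex_le gv) => [||y].
  - by apply: egX; apply: egB; [exact: eg_lnZ|apply: eg_upd; exact: eg_lnZ].
  - exact: egD.
  - by rewrite (le_trans (lnZ_upd_sqr_le s0 b kap h0 a2 p y))// lerD2r -!mulrA.
rewrite (ExD gv)// (ExZ gv); last by apply: egM; exact: egX.
rewrite (ExZ gv) ?Ex_tnth_4; last exact: egX.
rewrite Ex_tnth_sqr_indep; last 2 first.
- exact: egX.
- by move=> x y; rewrite /m0 upd_upd.
(* Return from [m0] to the magnetization itself, at the price of the Lipschitz error b y_p. *)
have h : Ex (fun y => m0 y ^+ 2) <= 2 * Ex (fun y => mag p y ^+ 2) + 2 * b ^+ 2.
  have -> : 2 * Ex (fun y => mag p y ^+ 2) + 2 * b ^+ 2 =
      Ex (fun y => 2 * mag p y ^+ 2 + 2 * b ^+ 2 * tnth y p ^+ 2).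
    rewrite (ExD gv); [|by apply: egZ; exact: egX|by apply: egZ; exact: egX].
    by rewrite !(ExZ gv) ?Ex_tnth_sqr ?mulr1//; exact: egX.
  apply: (Ex_le gv) => [||y].
  - exact: egX.
  - by apply: egD; apply: egZ; exact: egX.
  - have := mag_upd_le s0 b kap h0 a2 p y 0; rewrite subr0 -normrM -/(m0 y).
    set d := mag p y - m0 y => hd.
    have h2 : d ^+ 2 <= (b * tnth y p) ^+ 2.
      by rewrite -(real_normK (num_real d)) -(real_normK (num_real (b * _))) lerXn2r ?nnegrE.
    have h3 := sqr_ge0 (mag p y + d).
    rewrite exprMn in h2.
    have -> : m0 y = mag p y - d by rewrite /d; ring.
    lra.
have := ler_wpM2l (mulr_ge0 (ler0n R 2) (sqr_ge0 b)) h.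
have : 0 <= b ^+ 4 by rewrite (exprM b 2 2) sqr_ge0.
have -> : b ^+ 4 = b ^+ 2 * b ^+ 2 by ring.
lra.
Qed.

End OverlapBound.

(** * Closing the loop between free energy and overlap *)

Section OverlapMoments.
Context {R : realType} (n : nat) (S : finType) (s0 : S).
Local Notation X := (n.-tuple R).
Variables (a : S -> 'I_n -> R) (b kap beta : R).
Hypothesis a2 : forall s p, a s p ^+ 2 = 1.
Variable mu : probability X R.
Hypothesis gv : gauss_vec mu.
Hypothesis beta01 : 0 < beta < 1.
Hypothesis kap0 : 0 < kap.
Hypothesis b2 : b ^+ 2 = beta ^+ 2 * kap.
Hypothesis nk : 2 * n%:R * kap ^+ 2 = 1 - kap.
Local Notation Ex := (Ex mu).
Local Notation Zs := (Zs a b).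
Local Notation Q := (Qst a).
Local Notation av2 := (av2 a b).
Local Notation lnZ := (lnZ a b).
Local Notation M := (#|S|%:R : R).
Let q s t := kap * Q s t.
(** These two bounds are what the spin structure has to supply beyond [a2] and [nk]; for pairs of
    spins they are [Qst_pspin_ge] and [sum_expR_Qst_le]. *)
Hypothesis q_ge : forall s t, - 2^-1 <= q s t.
Hypothesis q_exp : forall k : R, 0 <= k -> k < 1 ->
  \sum_s \sum_t expR (k * q s t) <= M ^+ 2 * exp_cst k.

(** Half of the room left below 1, so that beta^2 + lam = (1 + beta^2) / 2 is still an admissible
    exponent. *)
Let lam := (1 - beta ^+ 2) / 2.
Let C2 := exp_cst (beta ^+ 2).
Let CA := exp_cst (beta ^+ 2 + lam).
Let Bm := energy_cst beta.

Let M0 : 0 < M. Proof. by rewrite ltr0n; apply/card_gt0P; exists s0. Qed.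
Let Z0 y : 0 < Zs y. Proof. exact: Zs_gt0 s0 a b y. Qed.

Let betasq : 0 < beta ^+ 2 < 1.
Proof. by move: beta01 => /andP[h1 h2]; nra. Qed.

Let lam0 : 0 < lam. Proof. by move: betasq => /andP[h1 h2]; rewrite /lam; lra. Qed.
Let C20 : 0 < C2.
Proof. by move: betasq => /andP[h1 h2]; rewrite invr_gt0 sqrtr_gt0 subr_gt0. Qed.
Let CA0 : 0 < CA.
Proof. by move: betasq => /andP[h1 h2]; rewrite invr_gt0 sqrtr_gt0 /lam; lra. Qed.

Let c0 := ln M + n%:R * b ^+ 2 / 2.
(* L = ln (Z / E Z). *)
Let L y := lnZ y - c0.

Let expL y : expR (L y) = Zs y / (M * expR (n%:R * b ^+ 2 / 2)).
Proof.
have lnZK : expR (lnZ y) = Zs y by rewrite lnK// posrE.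
rewrite /L /c0 opprD addrA !expRD lnZK !expRN lnK ?posrE//.
by rewrite -mulrA -invfM.
Qed.

Let exp2L y : expR (2 * L y) = (M ^+ 2 * expR (n%:R * b ^+ 2))^-1 * Zs y ^+ 2.
Proof.
have -> : 2 * L y = L y + L y by ring.
rewrite expRD expL.
have -> : expR (n%:R * b ^+ 2) = expR (n%:R * b ^+ 2 / 2) ^+ 2.
  by rewrite [RHS]expr2 -expRD; congr expR; field.
by rewrite -expr2 exprMn exprVn exprMn mulrC.
Qed.

Let egL : eg L.
Proof. by apply: egB; [exact: eg_lnZ|exact: eg_cst]. Qed.

Let egZ2 : eg (fun y => Zs y ^+ 2).
Proof.
apply: egX; apply: eg_sum => s _.
rewrite (_ : Ws a b s = fun y => expR (\sum_p (b * a s p) * tnth y p)).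
  exact: eg_expR_lin.
apply/funext => y; rewrite /Ws /Xs mulr_sumr; congr expR.
by apply: eq_bigr => p _; ring.
Qed.

Let egexpL : eg (fun y => expR (L y)).
Proof.
have eg1 : eg (fun y => 1 + (M ^+ 2 * expR (n%:R * b ^+ 2))^-1 * Zs y ^+ 2).
  by apply: egD; [exact: eg_cst|exact: egZ].
apply: eg_le _ eg1 _ => [|y]; first by apply: measurableT_comp => //; exact: egL.1.
rewrite -exp2L ger0_norm ?expR_ge0// ger0_norm ?addr_ge0 ?expR_ge0//.
have -> : expR (2 * L y) = expR (L y) ^+ 2.
  by rewrite [RHS]expr2 -expRD; congr expR; ring.
have := sqr_ge0 (expR (L y) - 1); nra.
Qed.

Let ExpL : Ex (fun y => expR (L y)) = 1.
Proof.
transitivity (Ex (fun y => (M * expR (n%:R * b ^+ 2 / 2))^-1 * Zs y)).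
  by apply: eq_Ex => y; rewrite expL mulrC.
have eZ : eg Zs.
  have eg1 : eg (fun y => 1 + Zs y ^+ 2) by apply: egD => //; exact: eg_cst.
  apply: eg_le _ eg1 _ => [|y]; first exact: measurable_Zs.
  rewrite ger0_norm ?(ltW (Z0 y))// ger0_norm ?addr_ge0 ?sqr_ge0//.
  by have := sqr_ge0 (Zs y - 1); nra.
rewrite (ExZ gv)// (Ex_Zs b a2 gv) mulVf// mulf_neq0 ?gt_eqF ?expR_gt0//.
Qed.

(** exp (2 L) is a multiple of Z^2, so [Ex_Zs_sqr_av2] applies. Its factor exp (b^2 Q) is exp
    (beta^2 q), which shifts the exponent [k] by beta^2. *)
Let Ex_exp_q (k : R) : 0 <= k -> beta ^+ 2 + k < 1 ->
  Ex (fun y => expR (2 * L y) * av2 (fun s t => expR (k * q s t)) y) <=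
  exp_cst (beta ^+ 2 + k).
Proof.
move=> k0 k1; set N2 := (M ^+ 2 * expR (n%:R * b ^+ 2))^-1.
have eA : eg (fun y => Zs y ^+ 2 * av2 (fun s t => expR (k * q s t)) y).
  by apply: egM => //; exact: eg_av2.
rewrite (eq_Ex mu (G := fun y => N2 * (Zs y ^+ 2 * av2 (fun s t => expR (k * q s t)) y))); last first.
  by move=> y; rewrite exp2L -mulrA.
rewrite (ExZ gv)// (Ex_Zs_sqr_av2 s0 b a2 gv).
have e0 := expR_gt0 (n%:R * b ^+ 2).
have -> : \sum_s \sum_t expR (k * q s t) * expR (b ^+ 2 * Q s t) =
    \sum_s \sum_t expR ((beta ^+ 2 + k) * q s t).
  apply: eq_bigr => s _; apply: eq_bigr => t _; rewrite -expRD b2 /q.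
  by congr expR; ring.
have b20 : 0 <= beta ^+ 2 + k by rewrite addr_ge0// sqr_ge0.
rewrite /N2 ler_pdivrMl ?mulr_gt0 ?exprn_gt0//.
rewrite [M ^+ 2 * _]mulrC -mulrA ler_wpM2l ?expR_ge0//.
exact: q_exp.
Qed.

Let Ex_exp2L : Ex (fun y => expR (2 * L y)) <= C2.
Proof.
have := Ex_exp_q (lexx 0); rewrite addr0; move: betasq => /andP[_ h] /(_ h).
rewrite (eq_Ex mu (G := fun y => expR (2 * L y)))// => y.
rewrite (_ : av2 _ y = 1) ?mulr1// -[RHS](av2_cst s0 a b 1 y).
by apply: eq_bigr => s _; apply: eq_bigr => t _; rewrite mul0r expR0.
Qed.

Let egav2 f : eg (av2 f). Proof. exact: eg_av2. Qed.

Let av2_jensen f y : expR (av2 f y) <= av2 (fun s t => expR (f s t)) y.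
Proof.
have h := @expR_jensen R (S * S)%type (fun st => gw a b st.1 y * gw a b st.2 y)
  (fun st => f st.1 st.2) _ _.
have -> : av2 f y = \sum_(st : S * S) gw a b st.1 y * gw a b st.2 y * f st.1 st.2.
  by rewrite /av2 pair_bigA; apply: eq_bigr => st _; ring.
have -> : av2 (fun s t => expR (f s t)) y =
    \sum_(st : S * S) gw a b st.1 y * gw a b st.2 y * expR (f st.1 st.2).
  by rewrite /av2 pair_bigA; apply: eq_bigr => st _; ring.
apply: h => [st|]; first by rewrite mulr_ge0// gw_ge0.
rewrite -(pair_bigA _ (fun s t => gw a b s y * gw a b t y))/=.
rewrite -[RHS](av2_cst s0 a b 1 y); apply: eq_bigr => s _; apply: eq_bigr => t _.
by rewrite mul1r.
Qed.

Let aa := Ex (av2 q).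
Let m := - Ex L.
Let v := Ex (fun y => (L y + m) ^+ 2).

Let aaE : aa = kap * Ex (av2 Q).
Proof. by rewrite -(ExZ gv)//; apply: eq_Ex => y; rewrite /q av2Z. Qed.

Let aa0 : 0 <= aa.
Proof.
rewrite aaE; apply: (mulr_ge0 (ltW kap0)); apply: Ex_ge0 => y; rewrite -(sum_mag_sqr a b 0 0).
by apply: sumr_ge0 => p _; exact: sqr_ge0.
Qed.

(** With b^2 = beta^2 kap the overlap term of [var_lnZ] is 4 beta^2 [aa], and [nk] turns 10 n b^4
    into 5 beta^4 (1 - kap). *)
Let v_le : v <= 4 * aa + 5.
Proof.
have -> : v = Ex (fun y => (lnZ y - Ex lnZ) ^+ 2).
  apply: eq_Ex => y; congr (_ ^+ 2); rewrite /m /L (ExB gv); last 2 first.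
  - exact: eg_lnZ.
  - exact: eg_cst.
  by rewrite (Ex_cst mu c0); ring.
rewrite (le_trans (var_lnZ s0 b 0 0 a2 gv))//.
have -> : 4 * b ^+ 2 * Ex (av2 Q) = 4 * beta ^+ 2 * aa by rewrite aaE b2; ring.
have -> : 10 * n%:R * b ^+ 4 = 5 * (beta ^+ 2) ^+ 2 * (1 - kap).
  by rewrite -nk (exprM b 2 2) b2; ring.
move: betasq => /andP[h1 h2].
have h3 : (beta ^+ 2) ^+ 2 * (1 - kap) <= 1.
  have x2 : (beta ^+ 2) ^+ 2 <= 1 by rewrite expr_le1 ?ltW.
  by have := mulr_ge0 (sqr_ge0 (beta ^+ 2)) (ltW kap0); lra.
have h4 : beta ^+ 2 * aa <= aa by rewrite ler_piMl// ltW.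
lra.
Qed.

(** Integrate 1 + 2 L + lam <q> <= exp (2 L + lam <q>) <= exp (2 L) <exp (lam q)>, where the second
    inequality is Jensen's for the replica average. *)
Let aa_le : lam * aa <= CA - 1 + 2 * m.
Proof.
have h : beta ^+ 2 + lam < 1 by move: betasq => /andP[h1 h2]; rewrite /lam; lra.
have hA := Ex_exp_q (ltW lam0) h.
have eA : eg (fun y => expR (2 * L y) * av2 (fun s t => expR (lam * q s t)) y).
  apply: egM => //; rewrite (_ : (fun _ => _) = fun y => expR (L y) * expR (L y)).
    exact: egM.
  by apply/funext => y; rewrite -expRD; congr expR; ring.
have hp : Ex (fun y => lam * av2 q y + 2 * L y) <=
    Ex (fun y => expR (2 * L y) * av2 (fun s t => expR (lam * q s t)) y - 1).
  apply: (Ex_le gv) => [||y].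
  - by apply: egD; exact: egZ.
  - by apply: egB => //; exact: eg_cst.
  have j := av2_jensen (fun s t => lam * q s t) y; rewrite av2Z in j.
  have := ler_wpM2l (expR_ge0 (2 * L y)) j; rewrite -expRD.
  have := expR_ge1Dx (2 * L y + lam * av2 q y); lra.
have e1 : Ex (fun y => lam * av2 q y + 2 * L y) = lam * aa - 2 * m.
  rewrite (ExD gv) ?(ExZ gv)//; [|exact: egZ|exact: egZ].
  by rewrite -/aa /m mulrN opprK.
have e2 : Ex (fun y => expR (2 * L y) * av2 (fun s t => expR (lam * q s t)) y - 1) =
    Ex (fun y => expR (2 * L y) * av2 (fun s t => expR (lam * q s t)) y) - 1.
  by rewrite (ExB gv)// ?Ex_cst//; exact: eg_cst.
move: hp; rewrite e1 e2; rewrite -/CA in hA; lra.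
Qed.

(** Integrating [expR_paley_zygmund] with c = C2 gives 1 <= 1 / 2 + 1 / 4 + C2 v / (m - 1)^2, since
    E exp L = 1 and E exp (2 L) <= C2. *)
Let m_var : 1 < m -> (m - 1) ^+ 2 <= 4 * C2 * v.
Proof.
move=> m1; have d0 : 0 < (m - 1) ^+ 2 by rewrite exprn_gt0// subr_gt0.
have e2L : eg (fun y => expR (2 * L y)).
  rewrite (_ : (fun _ => _) = fun y => expR (L y) * expR (L y)); first exact: egM.
  by apply/funext => y; rewrite -expRD; congr expR; ring.
have eLm : eg (fun y => (L y + m) ^+ 2) by apply: egX; apply: egD => //; exact: eg_cst.
have e1 : eg (fun y => 2^-1 + (4 * C2)^-1 * expR (2 * L y)).
  by apply: egD; [exact: eg_cst|exact: egZ].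
have e3 : eg (fun y => C2 / (m - 1) ^+ 2 * (L y + m) ^+ 2) by exact: egZ.
have h : Ex (fun y => expR (L y)) <= Ex (fun y => 2^-1 + (4 * C2)^-1 * expR (2 * L y) +
    C2 / (m - 1) ^+ 2 * (L y + m) ^+ 2).
  apply: (Ex_le gv) => //; first exact: egD.
  move=> y; rewrite (le_trans (expR_paley_zygmund (L y) C20 m1))// lerD2l.
  by rewrite [leLHS]mulrA mulrAC.
rewrite ExpL (ExD gv)// (ExD gv) ?(ExZ gv) ?Ex_cst// in h; last exact: egZ; last exact: eg_cst.
have h2 : (4 * C2)^-1 * Ex (fun y => expR (2 * L y)) <= 4^-1.
  rewrite ler_pdivrMl ?mulr_gt0//; have := Ex_exp2L; lra.
rewrite -/v in h.
have h3 : 4^-1 <= C2 / (m - 1) ^+ 2 * v by lra.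
rewrite mulrAC ler_pdivlMr// in h3; lra.
Qed.

(* [m_var], [v_le] and [aa_le] give a quadratic inequality for m - 1 whose right-hand
   side is affine in m. *)
Let m_le : m <= Bm.
Proof.
rewrite /Bm /energy_cst -/lam -/C2 -/CA.
have P0 : 0 <= 4 * C2 * (4 * (CA + 1) / lam + 5).
  apply: mulr_ge0; first by rewrite mulr_ge0// ltW.
  apply: addr_ge0 => //; apply: divr_ge0; last exact: ltW.
  by apply: mulr_ge0 => //; apply: addr_ge0 => //; exact: ltW.
have [m1|m1] := leP m 1.
  have h1 : 0 <= 32 * C2 / lam by apply: divr_ge0; [apply: mulr_ge0 => //|]; exact: ltW.
  have h2 : 0 <= 4 * C2 * (4 * (CA + 1) / lam + 5).
    exact: P0.
  lra.
have h := m_var m1.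
have a1 : aa <= (CA + 1 + 2 * (m - 1)) / lam.
  by rewrite ler_pdivlMr//; have := aa_le; lra.
have h2 : (m - 1) ^+ 2 <= 4 * C2 * (4 * ((CA + 1 + 2 * (m - 1)) / lam) + 5).
  apply: (le_trans h); apply: ler_wpM2l; first by apply: mulr_ge0 => //; exact: ltW.
  by have := v_le; lra.
set D := 32 * C2 / lam; set P := 4 * C2 * _ in P0 *.
have D0 : 0 <= D by apply: divr_ge0; [apply: mulr_ge0 => //|]; exact: ltW.
have h3 : (m - 1) ^+ 2 <= P + D * (m - 1).
  rewrite (le_trans h2)// le_eqVlt; apply/orP; left; apply/eqP.
  by rewrite /P /D; field; rewrite gt_eqF.
(* If m - 1 exceeded D + P + 1, then (m - 1)^2 would exceed D (m - 1) + P. *)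
have [//|h4] := leP m (D + P + 2).
exfalso; nra.
Qed.

Let ExL2 : Ex (fun y => L y ^+ 2) <= 4 * ((CA + 2 * Bm) / lam) + 5 + Bm ^+ 2.
Proof.
have e : v = Ex (fun y => L y ^+ 2) - m ^+ 2.
  rewrite /v (eq_Ex mu (G := fun y => L y ^+ 2 + (2 * m * L y + m ^+ 2))); last by move=> y; ring.
  have eL2 := egX 2 egL; have emL : eg (fun y => 2 * m * L y) by exact: egZ.
  have ec : eg (fun _ : X => m ^+ 2) by exact: eg_cst.
  rewrite (ExD gv)//; last exact: egD.
  rewrite (ExD gv)// (ExZ gv)// (Ex_cst mu (m ^+ 2)).
  by rewrite /m; ring.
(* From 1 + L <= exp L and E exp L = 1, that is, Jensen's inequality for the logarithm. *)
have m0 : 0 <= m.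
  rewrite /m oppr_ge0 -(subrr 1) -{1}ExpL -(Ex_cst mu 1) -(ExB gv)//; last exact: eg_cst.
  apply: (Ex_le gv) => // [|y]; first by apply: egB => //; exact: eg_cst.
  by have := expR_ge1Dx (L y); rewrite /cst; lra.
have a1 : aa <= (CA + 2 * Bm) / lam.
  by rewrite ler_pdivlMr//; have := aa_le; have := m_le; lra.
have m2 : m ^+ 2 <= Bm ^+ 2 by rewrite lerXn2r ?nnegrE//; exact: le_trans m0 m_le.
have := v_le; lra.
Qed.

(** For each disorder, the logarithm F of the replica average of exp Y controls that of Y^2 through
    2 F^2 + 8. Moreover F = lam / 2 - 2 L + ln A, so E F^2 needs only E A and E L^2, and the weight
    exp (2 L) hidden in A disappears. *)
Lemma overlap_bound :
  kap ^+ 2 * Ex (av2 (fun s t => Q s t ^+ 2)) <= overlap_cst beta.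
Proof.
have h : beta ^+ 2 + lam < 1 by move: betasq => /andP[h1 h2]; rewrite /lam; lra.
have hA := Ex_exp_q (ltW lam0) h; rewrite -/CA in hA.
pose A y := expR (2 * L y) * av2 (fun s t => expR (lam * q s t)) y.
have eA : eg A.
  apply: egM => //; rewrite (_ : (fun _ => _) = fun y => expR (L y) * expR (L y)).
    exact: egM.
  by apply/funext => y; rewrite -expRD; congr expR; ring.
have pw y : kap ^+ 2 * av2 (fun s t => Q s t ^+ 2) y <=
    2 / lam ^+ 2 * (6 * (lam ^+ 2 / 4 + 4 * A y + 4 * L y ^+ 2) + 8) + 2^-1.
  (* The shift makes Y nonnegative by [q_ge], hence B >= 1 and F >= 0, and bounds can be squared. *)
  pose Y s t := lam * (q s t + 2^-1).
  have Y0 s t : 0 <= Y s t by apply: (mulr_ge0 (ltW lam0)); have := q_ge s t; lra.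
  pose B := av2 (fun s t => expR (Y s t)) y.
  have B1 : 1 <= B.
    rewrite -(av2_cst s0 a b 1 y); apply: av2_le => s t.
    by rewrite -expR0 ler_expR.
  pose F := ln B.
  have F0 : 0 <= F by exact: ln_ge0.
  have BE : expR F = B by rewrite lnK// posrE; exact: lt_le_trans B1.
  have FE : B = expR (lam / 2 - 2 * L y) * A y.
    rewrite /A mulrA -expRD subrK -av2Z; apply: eq_bigr => s _; apply: eq_bigr => t _.
    by rewrite -expRD /Y; congr (expR _ * _ * _); field.
  have A0 : 0 < A y.
    have : 0 < expR (lam / 2 - 2 * L y) * A y by rewrite -FE; exact: lt_le_trans B1.
    by rewrite pmulr_rgt0 ?expR_gt0.
  have F2 : F = lam / 2 - 2 * L y + ln (A y).
    by rewrite /F FE lnM ?posrE ?expR_gt0// expRK.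
  have Fle : F ^+ 2 <= 3 * (lam ^+ 2 / 4 + 4 * A y + 4 * L y ^+ 2).
    (* When A >= 1, (ln A)^2 <= 4 A. When A < 1, its logarithm may be very negative, but then 0 <= F
       <= lam / 2 - 2 L. *)
    have [A1|A1] := leP 1 (A y).
      have h1 := ln_sqr_le A1; rewrite F2.
      have := sqr_ge0 (lam / 2 + 2 * L y); have := sqr_ge0 (lam / 2 - ln (A y)).
      have := sqr_ge0 (2 * L y + ln (A y)); lra.
    have lA : ln (A y) <= 0 by rewrite ln_le0// ltW.
    have h1 : F ^+ 2 <= (lam / 2 - 2 * L y) ^+ 2.
      by rewrite lerXn2r ?nnegrE//; [move: F0; rewrite F2; lra|rewrite F2; lra].
    have := sqr_ge0 (lam / 2 + 2 * L y); have := sqr_ge0 (L y); have := sqr_ge0 lam; lra.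
  (* F is chosen so that exp (Y - F) has replica average 1. *)
  have YF s t : Y s t ^+ 2 <= 2 * F ^+ 2 + 8 / B * expR (Y s t).
    have [YF|YF] := leP (Y s t) F.
      have h1 : Y s t ^+ 2 <= F ^+ 2 by rewrite lerXn2r ?nnegrE.
      have h2 : 0 <= 8 / B * expR (Y s t).
        by rewrite mulr_ge0 ?expR_ge0// divr_ge0//; exact: le_trans B1.
      by have := sqr_ge0 F; lra.
    have h1 : (Y s t - F) ^+ 2 <= 4 * expR (Y s t - F) by apply: sqr_le_expR; rewrite subr_ge0 ltW.
    have e : 8 / B * expR (Y s t) = 8 * expR (Y s t - F).
      by rewrite expRD expRN BE; ring.
    by rewrite e; have := sqr_ge0 (Y s t - 2 * F); lra.
  have hY : av2 (fun s t => Y s t ^+ 2) y <= 2 * F ^+ 2 + 8.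
    rewrite (le_trans (av2_le a b y YF))// av2D av2_cst// av2Z -/B.
    by rewrite divfK// gt_eqF//; exact: lt_le_trans B1.
  have hq s t : kap ^+ 2 * Q s t ^+ 2 <= 2 / lam ^+ 2 * Y s t ^+ 2 + 2^-1.
    have -> : 2 / lam ^+ 2 * Y s t ^+ 2 = 2 * (q s t + 2^-1) ^+ 2.
      by rewrite /Y; field; rewrite gt_eqF.
    have -> : kap ^+ 2 * Q s t ^+ 2 = q s t ^+ 2 by rewrite /q; ring.
    have := sqr_ge0 (q s t + 1); lra.
  rewrite -av2Z (le_trans (av2_le a b y hq))// av2D av2Z av2_cst// lerD2r.
  rewrite ler_wpM2l ?divr_ge0 ?sqr_ge0//; lra.
rewrite -(ExZ gv)//.
have e1 : eg (fun y => 6 * (lam ^+ 2 / 4 + 4 * A y + 4 * L y ^+ 2) + 8).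
  apply: egD; last exact: eg_cst.
  apply: egZ; apply: egD; last by apply: egZ; exact: egX.
  by apply: egD; [exact: eg_cst|exact: egZ].
have e2 : eg (fun y => 2 / lam ^+ 2 * (6 * (lam ^+ 2 / 4 + 4 * A y + 4 * L y ^+ 2) + 8)).
  exact: egZ.
apply: (le_trans (Ex_le gv _ _ pw)); first exact: egZ.
  by apply: egD => //; exact: eg_cst.
rewrite (ExD gv) ?Ex_cst//; last exact: eg_cst.
rewrite /overlap_cst -/lam -/CA -/Bm lerD2r (ExZ gv)//.
rewrite ler_wpM2l ?divr_ge0 ?sqr_ge0//.
have -> : Ex (fun y => 6 * (lam ^+ 2 / 4 + 4 * A y + 4 * L y ^+ 2) + 8) =
    6 * (lam ^+ 2 / 4 + 4 * Ex A + 4 * Ex (fun y => L y ^+ 2)) + 8.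
  have eA4 : eg (fun y => lam ^+ 2 / 4 + 4 * A y) by apply: egD; [exact: eg_cst|exact: egZ].
  have eL4 : eg (fun y => 4 * L y ^+ 2) by apply: egZ; exact: egX.
  rewrite (ExD gv); [|by apply: egZ; exact: egD|exact: eg_cst].
  rewrite Ex_cst (ExZ gv); last exact: egD.
  rewrite (ExD gv)// (ExD gv); [|exact: eg_cst|exact: egZ].
  by rewrite Ex_cst !(ExZ gv)//; exact: egX.
have := ExL2; rewrite -/A in hA; move: hA; rewrite -/(Ex A); lra.
Qed.

End OverlapMoments.

(** * Pairs of spins *)

Section SpinPairs.
Context {R : realType}.

(** f(x) = exp (- x^2 / 2) (exp x + exp (- x)) equals 2 at 0 and decreases for x > 0: the sign of
    its derivative is that of k, which vanishes at 0 and is itself decreasing. *)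
Lemma expR_cosh_le (c : R) : expR c + expR (- c) <= 2 * expR (c ^+ 2 / 2).
Proof.
wlog c0 : c / 0 <= c.
  move=> h; have [c0|/ltW c0] := leP 0 c; first exact: h.
  by have := h (- c); rewrite opprK sqrrN addrC; apply; rewrite oppr_ge0.
have [->|cn0] := eqVneq c 0; first by rewrite oppr0 expr0n mul0r expR0; lra.
have {cn0}c0 : 0 < c by rewrite lt_def cn0.
pose k (x : R) := expR x - expR (- x) - x * (expR x + expR (- x)).
pose f (x : R) := expR (- (x ^+ 2 / 2)) * (expR x + expR (- x)).
have dk (x : R) : is_derive x 1 k (- (x * (expR x - expR (- x)))).
  by rewrite /k; apply: is_derive_eq; rewrite /GRing.scale/=; ring.
have df (x : R) : is_derive x 1 f (expR (- (x ^+ 2 / 2)) * k x).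
  by rewrite /f; apply: is_derive_eq; rewrite /GRing.scale/= /k; field.
have cont (g g' : R -> R) : (forall x : R, is_derive x 1 g (g' x)) -> continuous g.
  move=> dg x; apply/differentiable_continuous/derivable1_diffP.
  by have ? := dg x; exact: ex_derive.
have k_le (x : R) : 0 < x -> k x <= 0.
  move=> x0; have [z zx] := @MVT R k _ 0 x x0 (fun z _ => dk z)
    (continuous_subspaceT (cont _ _ dk)).
  move: zx; rewrite in_itv/= => /andP[z0 _].
  have -> : k 0 = 0 by rewrite /k oppr0 mul0r subrr subr0.
  rewrite !subr0 => ->; rewrite mulNr oppr_le0 mulr_ge0 ?(ltW x0)// mulr_ge0 ?(ltW z0)//.
  by rewrite subr_ge0 ler_expR; lra.
have [z zc] := @MVT R f _ 0 c c0 (fun z _ => df z)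
    (continuous_subspaceT (cont _ _ df)).
move: zc; rewrite in_itv/= => /andP[z0 _] e.
have f0 : f 0 = 2 by rewrite /f expr0n mul0r oppr0 expR0 mul1r.
have fc : f c <= 2.
  have : f c - f 0 <= 0.
    by rewrite e pmulr_lle0 ?subr0// pmulr_rle0 ?expR_gt0// k_le.
  by rewrite f0; lra.
by move: fc; rewrite /f expRN mulrC ler_pdivrMr ?expR_gt0.
Qed.

Section Pairs.
Variable N : nat.
Local Notation conf := {ffun 'I_N -> bool}.
Local Notation spin := (@spin R N).

Definition pairs : {set 'I_N * 'I_N} :=
  finset (fun p : 'I_N * 'I_N => (p.1 < p.2)%N).

Definition pspin (s : conf) (k : 'I_#|pairs|) : R :=
  spin s (enum_val k).1 * spin s (enum_val k).2.

Definition overlap (s t : conf) : R := \sum_i spin s i * spin t i.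

Lemma spin_sqr (s : conf) i : spin s i ^+ 2 = 1.
Proof. by rewrite /spin; case: (s i); rewrite ?sqrrN expr1n. Qed.

Lemma pspin_sqr s k : pspin s k ^+ 2 = 1.
Proof. by rewrite /pspin exprMn !spin_sqr mulr1. Qed.

Lemma sum_pairs (F : 'I_N * 'I_N -> R) :
  \sum_(k < #|pairs|) F (enum_val k) = \sum_(i < N) \sum_(j < N | (i < j)%N) F (i, j).
Proof.
transitivity (\sum_(p in pairs) F p); first by apply/esym; exact: big_enum_val.
rewrite pair_big_dep/=.
by apply: eq_big => [p|[i j] _//]; rewrite inE.
Qed.

Lemma sqr_sum_pairs (x : 'I_N -> R) :
  (\sum_i x i) ^+ 2 = \sum_i x i ^+ 2 +
    2 * \sum_(k < #|pairs|) x (enum_val k).1 * x (enum_val k).2.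
Proof.
rewrite (sum_pairs (fun p => x p.1 * x p.2))/= expr2 big_distrlr/=.
have -> : \sum_i \sum_j x i * x j =
    \sum_i (x i ^+ 2 + \sum_(j < N | (i < j)%N) x i * x j + \sum_(j < N | (j < i)%N) x i * x j).
  apply: eq_bigr => i _.
  rewrite (bigD1 i)//= expr2 -addrA; congr (_ + _).
  rewrite (bigID (fun j : 'I_N => (i < j)%N))/=; congr (_ + _); apply: eq_bigl => j.
    by rewrite -val_eqE/=; case: ltngtP.
  by rewrite -val_eqE/=; case: ltngtP.
rewrite !big_split/= -addrA; congr (_ + _).
rewrite mulr_natl mulr2n; congr (_ + _).
rewrite (exchange_big_dep xpredT)//=; apply: eq_bigr => i _.
by apply: eq_bigr => j _; rewrite mulrC.
Qed.

(** Expanding the square of the spin overlap, whose N diagonal terms are 1. This gives the lower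
    bound on Q / N and makes Q quadratic in a sum over single sites. *)
Lemma Qst_pspin s t : 2 * Qst pspin s t = overlap s t ^+ 2 - N%:R.
Proof.
rewrite /overlap sqr_sum_pairs.
rewrite (eq_bigr (fun=> 1)); last by move=> i _; rewrite exprMn !spin_sqr mulr1.
rewrite sumr_const card_ord addrAC subrr add0r; congr (_ * _).
by apply: eq_bigr => k _; rewrite /pspin; ring.
Qed.

Lemma card_pairs : 2 * #|pairs|%:R = N%:R ^+ 2 - N%:R :> R.
Proof.
(* For equal configurations Q counts the pairs, and the overlap is N. *)
have := Qst_pspin [ffun=> true] [ffun=> true].
rewrite /Qst (eq_bigr (fun=> 1)); last by move=> k _; rewrite -expr2 pspin_sqr.
rewrite sumr_const card_ord => ->; rewrite /overlap (eq_bigr (fun=> 1)).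
  by rewrite sumr_const card_ord.
by move=> i _; rewrite -expr2 spin_sqr.
Qed.

Hypothesis N0 : (0 < N)%N.
Let NR0 : 0 < N%:R :> R. Proof. by rewrite ltr0n. Qed.

Lemma Qst_pspin_ge s t : - 2^-1 <= N%:R^-1 * Qst pspin s t :> R.
Proof.
rewrite -(ler_pM2l NR0) mulrA divff ?gt_eqF// mul1r.
by have := Qst_pspin s t; have := sqr_ge0 (overlap s t); lra.
Qed.

(** For fixed s the sum over t factorizes over sites, each factor being twice a hyperbolic
    cosine. *)
Lemma sum_expR_overlap_le c :
  \sum_s \sum_t expR (c * overlap s t) <= #|conf|%:R ^+ 2 * expR (N%:R * c ^+ 2 / 2).
Proof.
have cardc : #|conf|%:R = 2 ^+ N :> R by rewrite card_ffun card_bool card_ord natrX.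
apply: (@le_trans _ _ (\sum_(s : conf) 2 ^+ N * expR (N%:R * c ^+ 2 / 2))); last first.
  by rewrite sumr_const -cardc -[leLHS]mulr_natl expr2 mulrA.
apply: ler_sum => s _.
have -> : \sum_t expR (c * overlap s t) =
    \prod_(i < N) \sum_(b : bool) expR (c * (spin s i * (if b then 1 else -1))).
  rewrite bigA_distr_bigA/=; apply: eq_bigr => t _.
  by rewrite /overlap mulr_sumr expR_sum.
have -> : 2 ^+ N * expR (N%:R * c ^+ 2 / 2) = \prod_(i < N) (2 * expR (c ^+ 2 / 2)).
  rewrite prodr_const card_ord exprMn; congr (_ * _).
  by rewrite -expRM_natl; congr expR; ring.
apply: ler_prod => i _; rewrite big_bool/= addr_ge0 ?expR_ge0//=.
have := expR_cosh_le (c * spin s i); rewrite exprMn spin_sqr mulr1.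
by rewrite mulr1 mulrN1 mulrN.
Qed.

(** Hubbard-Stratonovich: k Q / N is at most half the square of [c * overlap s t], with c^2 = k / N,
    and the exponential of this is E exp (c x overlap) for a Gaussian x. The configuration sum at
    fixed x is at most its uniform weight times exp (k x^2 / 2), whose mean is [exp_cst k]. *)
Lemma sum_expR_Qst_le k : 0 <= k -> k < 1 ->
  \sum_s \sum_t expR (k * (N%:R^-1 * Qst pspin s t)) <=
  #|conf|%:R ^+ 2 * exp_cst k.
Proof.
move=> k0 k1.
pose c := Num.sqrt (k / N%:R).
have c2 : c ^+ 2 = k / N%:R by rewrite sqr_sqrtr// divr_ge0// ltW.
have e1 s t : expR (k * (N%:R^-1 * Qst pspin s t)) <= expR ((c * overlap s t) ^+ 2 / 2).
  rewrite ler_expR exprMn c2 -(ler_pM2l NR0).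
  have -> : N%:R * (k * (N%:R^-1 * Qst pspin s t)) = k * Qst pspin s t.
    by field; rewrite gt_eqF.
  have -> : N%:R * (k / N%:R * overlap s t ^+ 2 / 2) = k * (overlap s t ^+ 2 / 2).
    by field; rewrite gt_eqF.
  by rewrite ler_wpM2l//; have := Qst_pspin s t; have := NR0; lra.
apply: (@le_trans _ _ (\sum_s \sum_t expR ((c * overlap s t) ^+ 2 / 2))).
  by apply: ler_sum => s _; apply: ler_sum => t _; exact: e1.
have me (d : R) : measurable_fun [set: measurableTypeR R] (fun x => (expR (d * x))%:E).
  by apply/measurable_EFinP; exact: measurable_expRM.
rewrite -lee_fin EFinM -integral_normal_expR_sqr//.
have -> : (\sum_s \sum_t expR ((c * overlap s t) ^+ 2 / 2))%:E =
    (\int[normal_prob 0 1]_x (\sum_s \sum_t expR (c * x * overlap s t))%:E)%E.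
  rewrite -sumEFin; under [RHS]eq_integral do rewrite -sumEFin.
  rewrite ge0_integral_sum//.
  - apply: eq_bigr => s _; rewrite -sumEFin.
    under [RHS]eq_integral do rewrite -sumEFin.
    rewrite ge0_integral_sum//.
    + apply: eq_bigr => t _; rewrite -integral_normal_expR.
      by apply: eq_integral => x _; congr ((expR _)%:E); ring.
    + move=> t; rewrite (_ : (fun _ => _) = fun x => (expR (c * overlap s t * x))%:E) => //.
      by apply/funext => x; congr ((expR _)%:E); ring.
  - move=> s; apply/measurable_EFinP; apply: measurable_sum => t.
    rewrite (_ : (fun _ => _) = fun x => expR (c * overlap s t * x)).
      exact: measurable_expRM.
    by apply/funext => x; congr expR; ring.
  - by move=> s x _; rewrite lee_fin sumr_ge0// => t _; exact: expR_ge0.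
have me2 : measurable_fun [set: R] (fun x : R => expR (k * x ^+ 2 / 2)).
  apply: measurableT_comp => //.
  by apply: measurable_funM => //; apply: measurable_funM.
rewrite -ge0_integralZl//; last exact/measurable_EFinP.
apply: ge0_le_integral => //.
- by move=> x _; rewrite lee_fin sumr_ge0// => s _; rewrite sumr_ge0// => t _; exact: expR_ge0.
- apply/measurable_EFinP; apply: measurable_sum => s; apply: measurable_sum => t.
  rewrite (_ : (fun _ => _) = fun x => expR (c * overlap s t * x)).
    exact: measurable_expRM.
  by apply/funext => x; congr expR; ring.
- by apply: emeasurable_funM => //; exact/measurable_EFinP.
- move=> x _; rewrite -EFinM lee_fin (le_trans (sum_expR_overlap_le _))//.
  rewrite exprMn c2 le_eqVlt; apply/orP; left; apply/eqP; congr (_ * expR _).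
  by field; rewrite gt_eqF.
Qed.

End Pairs.
End SpinPairs.

(** * Moving averages, Stein's equation and almost everywhere limits *)

Section Averaging.
Context {R : realType}.
Local Notation lam := (@lebesgue_measure R).

Lemma derivable_quotient_cvg (F : R -> R) (x : R) : derivable F x 1 ->
  k.+1%:R * (F (x + k.+1%:R^-1) - F x) @[k --> \oo] --> derive1 F x.
Proof.
move=> dF.
have hk : (fun k : nat => k.+1%:R^-1 : R) @ \oo --> (0 : R)^'.
  move=> A [e /= e0 hA].
  have : \forall k \near \oo, ball (0 : R) e (@harmonic R k).
    by apply: cvg_harmonic; exact: nbhsx_ballx.
  by apply: filterS => k hk; apply: (hA _ hk); rewrite gt_eqF// harmonic_gt0.
rewrite derive1E; have c := cvg_comp _ _ hk dF.
suff -> : (fun k => k.+1%:R * (F (x + k.+1%:R^-1) - F x)) =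
  (fun h => h^-1 *: ((F \o shift x) (h *: 1) - F x)) \o (fun k : nat => k.+1%:R^-1 : R) by exact: c.
by apply/funext => k /=; rewrite invrK /GRing.scale/= mulr1 [x + _]addrC.
Qed.

Lemma bounded_integrable_itv (f : R -> R) M a b : measurable_fun [set: R] f ->
  (forall x, `|f x| <= M) -> lam.-integrable `[a, b] (EFin \o f).
Proof.
move=> mf fM; apply: measurable_bounded_integrable => //.
- by rewrite /= lebesgue_measure_itv/=; case: ifP => _; rewrite ?ltry// -EFinB ltry.
- exact: measurable_funS mf.
- exists M; split; first exact: num_real.
  by move=> y My x _ /=; exact: le_trans (fM x) (ltW My).
Qed.

Lemma bounded_integrable_itvoc (f : R -> R) M a b : measurable_fun [set: R] f ->
  (forall x, `|f x| <= M) -> lam.-integrable `]a, b] (EFin \o f).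
Proof.
move=> mf fM; apply: integrableS (bounded_integrable_itv a b mf fM) => //.
by apply: subset_itvr; rewrite bnd_simp.
Qed.

Lemma Rintegral_itv_le (f : R -> R) M a b : measurable_fun [set: R] f ->
  (forall x, `|f x| <= M) -> a <= b ->
  `|\int[lam]_(t in `]a, b]) f t| <= M * (b - a).
Proof.
move=> mf fM ab.
have fi := bounded_integrable_itvoc a b mf fM.
rewrite (le_trans (le_normr_Rintegral _ fi))//.
have -> : M * (b - a) = \int[lam]_(t in `]a, b]) M.
  rewrite Rintegral_cst//= lebesgue_measure_itv/= lte_fin.
  by case: ltgtP ab => // -> _; rewrite subrr.
apply: le_Rintegral => //.
- apply: (bounded_integrable_itvoc (M := M)); first exact: measurableT_comp.
  by move=> x; rewrite normr_id.
- exact: (bounded_integrable_itvoc (M := `|M|)).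
Qed.

Definition ravg (h : R) (f : R -> R) (x : R) : R :=
  h^-1 * \int[lam]_(t in `]x, x + h]) f t.

Section Bounded.
Variables (f : R -> R) (M : R).
Hypothesis mf : measurable_fun [set: R] f.
Hypothesis fM : forall x, `|f x| <= M.
Let F a x := \int[lam]_(t in `[a, x]) f t.

Lemma ravgE h a x : 0 < h -> a <= x -> ravg h f x = h^-1 * (F a (x + h) - F a x).
Proof.
move=> h0 ax; rewrite /ravg /F Rintegral_itvB//.
- exact: bounded_integrable_itv.
- by rewrite bnd_simp lerDl ltW.
Qed.

Lemma ravg_bound h x : 0 < h -> `|ravg h f x| <= M.
Proof.
move=> h0; rewrite /ravg normrM gtr0_norm ?invr_gt0// ler_pdivrMl//.
rewrite (le_trans (Rintegral_itv_le mf fM _))//; first by rewrite lerDl ltW.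
by rewrite addrAC subrr add0r mulrC.
Qed.

Lemma is_derive_ravg h : 0 < h -> continuous f ->
  forall x : R, is_derive x 1 (ravg h f) (h^-1 * (f (x + h) - f x)).
Proof.
move=> h0 cf x; pose a := x - 1.
have dF (z : R) : a < z -> is_derive z 1 (F a) (f z).
  move=> az; have [dz <-] := @continuous_FTC1_closed R f a z (z + 1)
    (ltr_pwDr ltr01 (lexx z)) (bounded_integrable_itv a (z + 1) mf fM) az (cf z).
  by rewrite derive1E; exact: DeriveDef.
apply: (@near_eq_is_derive _ _ _ (fun z => h^-1 * (F a (z + h) - F a z))).
  near=> z; rewrite -ravgE// ltW//.
  by near: z; apply: lt_nbhsr; rewrite /a ltrBlDr ltrDl.
have ax : a < x by rewrite /a ltrBlDr ltrDl.
have d1 := dF x ax.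
have d2 : is_derive x 1 (fun z => F a (z + h)) (f (x + h)).
  have axh : a < x + h by rewrite (lt_trans ax)// ltrDl.
  have hd := dF _ axh.
  have hs : is_derive x 1 (fun z : R => z + h) (1 : R).
    by apply: is_derive_eq; rewrite addr0.
  rewrite -[f _]mulr1; exact: (@is_derive1_comp _ (F a) (fun z => z + h) x _ _ hd hs).
have d3 := is_deriveZ (h^-1) (is_deriveB d2 d1).
exact: d3.
Unshelve. all: by end_near. Qed.

Lemma continuous_ravg h : 0 < h -> continuous (ravg h f).
Proof.
move=> h0 x; pose a := x - 1.
have M0 : 0 <= M by exact: le_trans (normr_ge0 _) (fM 0).
have FL y z : a <= y -> y <= z -> `|F a z - F a y| <= M * (z - y).
  move=> ay yz; rewrite /F Rintegral_itvB//; first exact: Rintegral_itv_le.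
  exact: bounded_integrable_itv.
have FL2 y z : a <= y -> a <= z -> `|F a z - F a y| <= M * `|z - y|.
  move=> ay az; have [yz|/ltW zy] := leP y z; first by rewrite (ger0_norm (x := z - y)) ?subr_ge0// FL.
  by rewrite distrC [X in _ * X]distrC (ger0_norm (x := y - z)) ?subr_ge0// FL.
apply/cvgrPdist_le => e e0; near=> y.
have ay : a <= y by near: y; by apply: filterS (lt_nbhsr (_ : a < x)) => [z /ltW //|]; rewrite /a ltrBlDr ltrDl.
have ax : a <= x by rewrite /a lerBlDr lerDl.
rewrite !(@ravgE h a)// -mulrBr normrM gtr0_norm ?invr_gt0// ler_pdivrMl//.
have -> : F a (x + h) - F a x - (F a (y + h) - F a y) =
  (F a (x + h) - F a (y + h)) - (F a x - F a y) by ring.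
rewrite (le_trans (ler_normB _ _))//.
have l1 := FL2 y x ay ax.
have l2 : `|F a (x + h) - F a (y + h)| <= M * `|x - y|.
  have -> : x - y = (x + h) - (y + h) by ring.
  by apply: FL2; [rewrite (le_trans ay)// lerDl ltW|rewrite (le_trans ax)// lerDl ltW].
have hd : `|x - y| <= h * e / (2 * M + 1).
  near: y; apply: cvgr_dist_le; first exact: cvg_id.
  by rewrite divr_gt0 ?mulr_gt0// ltr_wpDl// mulr_ge0.
rewrite (le_trans (lerD l2 l1))//.
have hd2 : (2 * M + 1) * `|x - y| <= h * e.
  by rewrite mulrC -ler_pdivlMr// ltr_wpDl// mulr_ge0.
by have := normr_ge0 (x - y); lra.
Unshelve. all: by end_near. Qed.

Lemma ravg_cvg_ae : {ae lam, forall x : R, ravg k.+1%:R^-1 f x @[k --> \oo] --> f x}.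
Proof.
(* Lebesgue differentiation is applied to primitives based at each - j, countably many null sets, so
   that every real x lies to the right of some base point. *)
have h : {ae lam, forall x : R, forall j : nat, - j%:R < x ->
    derivable (F (- j%:R)) x 1 /\ derive1 (F (- j%:R)) x = f x}.
  apply: ae_foralln => j.
  have lf : locally_integrable [set: R] f.
    split=> //; first exact: openT.
    move=> A _ cA; have mA := compact_measurable cA.
    have /integrableP[_] : lam.-integrable A (EFin \o f).
      apply: measurable_bounded_integrable => //.
      - exact: compact_finite_measure.
      - exact: measurable_funS mf.
      - exists M; split; first exact: num_real.
        by move=> y My x _ /=; exact: le_trans (fM x) (ltW My).
    by [].
  have := @FTC1 R f (BLeft (- j%:R))
    (fun y => bounded_integrable_itv _ y mf fM) lf.
  apply: filterS; first exact: (ae_filter_ringOfSetsType lam).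
  by move=> x hx jx; apply: hx.
move: h; apply: filterS; first exact: (ae_filter_ringOfSetsType lam).
move=> x hx.
have [j jx] : exists j : nat, - j%:R < x.
  by exists (Num.truncn `|x|).+1; rewrite ltrNl (le_lt_trans (ler_norm _))// normrN truncnS_gt.
have [d e] := hx j jx.
have c := derivable_quotient_cvg d; rewrite e in c.
suff -> : (fun k : nat => ravg k.+1%:R^-1 f x) =
  (fun k : nat => k.+1%:R * (F (- j%:R) (x + k.+1%:R^-1) - F (- j%:R) x)) by exact: c.
by apply/funext => k; rewrite (@ravgE _ (- j%:R))// ?invrK// ltW.
Qed.

Lemma ravg_cvg x : continuous f -> ravg k.+1%:R^-1 f x @[k --> \oo] --> f x.
Proof.
move=> cf; pose a := x - 1.
have ax : a < x by rewrite /a ltrBlDr ltrDl.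
have [d e] := @continuous_FTC1_closed R f a x (x + 1)
    (ltr_pwDr ltr01 (lexx x)) (bounded_integrable_itv a (x + 1) mf fM) ax (cf x).
have c := derivable_quotient_cvg d; rewrite e in c.
suff -> : (fun k : nat => ravg k.+1%:R^-1 f x) =
  (fun k : nat => k.+1%:R * (F a (x + k.+1%:R^-1) - F a x)) by exact: c.
by apply/funext => k; rewrite (@ravgE _ a)// ?invrK// ltW.
Qed.

End Bounded.
End Averaging.

(** * Solving Stein's equation with bounds *)

Section SteinSolution.
Context {R : realType}.
Local Notation lam := (@lebesgue_measure R).
Local Notation G := (@gauss_fun R).

Definition gauss_tail (x : R) : R := \int[lam]_(t in `[x, +oo[) G t.

Lemma integrable_gauss_itv (i : interval R) : lam.-integrable [set` i] (EFin \o G).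
Proof. by apply: integrableS (@integrableT_gauss R) => //. Qed.

Lemma integrableZ_gauss_itv (c : R) (i : interval R) :
  lam.-integrable [set` i] (fun t => (c * G t)%:E).
Proof. exact: (integrableZl _ c (integrable_gauss_itv i)). Qed.

Lemma gauss_tail_le x : gauss_tail x <= Num.sqrt pi.
Proof.
rewrite -lee_fin /gauss_tail /Rintegral fineK; last first.
  by apply: integrable_fin_num => //; exact: integrable_gauss_itv.
rewrite -(@integralT_gauss R); apply: ge0_subset_integral => //.
- by apply/measurable_EFinP; exact: measurable_gauss_fun.
- by move=> t _; rewrite lee_fin gauss_fun_ge0.
Qed.

(** The Mills ratio bound: on [x, +oo[ the factor 2 x is at most 2 t, and 2 t G(t) is the derivative
    of - G(t). *)
Lemma mulr_gauss_tail_le x : 0 <= x -> 2 * x * gauss_tail x <= G x.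
Proof.
move=> x0.
have dG (t : R) : is_derive t 1 (fun t => - G t) (2 * t * G t).
  rewrite /gauss_fun; apply: is_derive_eq; rewrite /GRing.scale/=; ring.
have mG : measurable_fun [set: R] G by exact: measurable_gauss_fun.
have m2 : measurable_fun [set: R] (fun t => 2 * t * G t).
  by apply: measurable_funM => //; apply: measurable_funM.
rewrite -RintegralZl//; last exact: integrable_gauss_itv.
rewrite -lee_fin fineK; last first.
  by apply: integrable_fin_num => //; exact: integrableZ_gauss_itv.
have e : (\int[lam]_(t in `[x, +oo[) (2 * t * G t)%:E = (0 : R)%:E - (- G x)%:E)%E.
  have cdG : continuous (fun t : R => 2 * t * G t).
    move=> t; apply: cvgM; last exact: continuous_gauss_fun.
    by apply: cvgM; [exact: cvg_cst|exact: cvg_id].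
  have cN : continuous (fun t : R => - G t).
    by move=> t; apply: cvgN; exact: continuous_gauss_fun.
  apply: (@ge0_continuous_FTC2y R (fun t => 2 * t * G t) (fun t => - G t)).
  - by move=> t xt; rewrite mulr_ge0 ?gauss_fun_ge0// mulr_ge0// (le_trans x0).
  - exact: continuous_subspaceT.
  - by rewrite -oppr0; apply: cvgN; exact: cvg_gauss_fun.
  - by move=> t _; have ? := dG t; exact: ex_derive.
  - by apply: cvg_at_right_filter; exact: cN.
  - by move=> t _; rewrite derive1E; have ? := dG t; rewrite derive_val.
rewrite sub0e -EFinN opprK in e; rewrite -e.
apply: ge0_le_integral => //.
- by move=> t /= _; rewrite lee_fin mulr_ge0 ?gauss_fun_ge0// mulr_ge0.
- apply/measurable_funTS; apply/measurable_EFinP; apply: measurable_funM => //.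
- by apply/measurable_funTS/measurable_EFinP.
- move=> t; rewrite /= in_itv/= andbT => xt.
  by rewrite lee_fin ler_wpM2r ?gauss_fun_ge0// ler_wpM2l.
Qed.

Variables (v : R -> R) (V : R).
Hypothesis cv : continuous v.
Hypothesis vV : forall x, `|v x| <= V.
Hypothesis v0 : \int[lam]_t (v t * G t) = 0.

Let h t := v t * G t.
Let F x := \int[lam]_(t in `]-oo, x]) h t.
Let V0 : 0 <= V. Proof. exact: le_trans (normr_ge0 _) (vV 0). Qed.

Let ch : continuous h.
Proof. by move=> t; apply: cvgM; [exact: cv|exact: continuous_gauss_fun]. Qed.

Let mh : measurable_fun [set: R] h. Proof. exact: continuous_measurable_fun. Qed.

Let hG t : `|h t| <= V * G t.
Proof. by rewrite normrM (ger0_norm (gauss_fun_ge0 _)) ler_wpM2r ?gauss_fun_ge0. Qed.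

Let iVG (i : interval R) : lam.-integrable [set` i] (fun t => (V * G t)%:E).
Proof. exact: integrableZ_gauss_itv. Qed.

Let ih (i : interval R) : lam.-integrable [set` i] (EFin \o h).
Proof.
apply: le_integrable (iVG i) => //.
- by apply/measurable_funTS/measurable_EFinP.
- by move=> t _ /=; rewrite lee_fin (le_trans (hG t))// ler_norm.
Qed.

Let Rint_le (i : interval R) :
  `|\int[lam]_(t in [set` i]) h t| <= V * \int[lam]_(t in [set` i]) G t.
Proof.
rewrite (le_trans (le_normr_Rintegral _ (ih i)))// -RintegralZl//; last first.
  exact: integrable_gauss_itv.
have inh : lam.-integrable [set` i] (fun t => (`|h t|)%:E).
  apply: le_integrable (iVG i) => //.
  - by apply/measurable_funTS/measurable_EFinP; exact: measurableT_comp.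
  - by move=> t _ /=; rewrite lee_fin normr_id (le_trans (hG t))// ler_norm.
by apply: le_Rintegral => // t _; exact: hG.
Qed.

(** For x > 0 the centering [v0] rewrites the integral up to x as minus the integral beyond x, so
    the smaller of the two tails can be used on either side. *)
Let F_le x : `|F x| <= V * gauss_tail `|x|.
Proof.
have [x0|x0] := leP x 0.
  rewrite (ler0_norm x0) (le_trans (Rint_le _))// ler_wpM2l//.
  rewrite le_eqVlt; apply/orP; left; apply/eqP; rewrite /gauss_tail /Rintegral; congr fine.
  rewrite -{1}(opprK x) ge0_integration_by_substitutionNy//.
  - by apply: eq_integral => t _; rewrite /= /gauss_fun sqrrN.
  - by apply: continuous_subspaceT; exact: continuous_gauss_fun.
  - by move=> t _; exact: gauss_fun_ge0.
rewrite (gtr0_norm x0).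
have -> : F x = - \int[lam]_(t in `]x, +oo[) h t.
  rewrite -(@Rintegral_itvB _ _ -oo%O +oo%O)//.
  by rewrite set_itvE v0 sub0r opprK.
rewrite normrN (le_trans (Rint_le _))// ler_wpM2l// /gauss_tail.
by rewrite (@Rintegral_itv_obnd_cbnd _ x +oo%O)//; exact: integrable_gauss_itv.
Qed.

Definition stein_sol (x : R) : R := expR (x ^+ 2) * F x.

Lemma is_derive_stein_sol (x : R) :
  is_derive x 1 stein_sol (2 * x * stein_sol x + v x).
Proof.
have [dF eF] := @continuous_FTC1 R h -oo%O x (x + 1) (ltr_pwDr ltr01 (lexx x))
  (ih _) (ltNyr _) (@ch x).
have hF : is_derive x 1 F (h x) by rewrite -eF derive1E; exact: DeriveDef.
have hE : is_derive x 1 (fun x : R => expR (x ^+ 2)) (2 * x * expR (x ^+ 2)).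
  by apply: is_derive_eq; rewrite /GRing.scale/=; ring.
have hM := is_deriveM hE hF.
have -> : 2 * x * stein_sol x + v x =
    expR (x ^+ 2) *: h x + F x *: (2 * x * expR (x ^+ 2)).
  rewrite /GRing.scale/= /stein_sol /h /gauss_fun expRN; field.
  by rewrite gt_eqF// expR_gt0.
exact: hM.
Qed.

Lemma mulr_stein_sol_le x : `|2 * x * stein_sol x| <= V.
Proof.
rewrite /stein_sol !normrM (ger0_norm (expR_ge0 _)) (ger0_norm (ler0n R 2)).
have h1 := mulr_gauss_tail_le (normr_ge0 x); have h2 := F_le x.
have E0 := expR_gt0 (x ^+ 2).
have h3 := ler_wpM2l (mulr_ge0 (ler0n R 2) (normr_ge0 x)) h2.
have h4 := ler_wpM2l V0 h1.
have EG : expR (x ^+ 2) * G `|x| = 1.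
  by rewrite /gauss_fun real_normK ?num_real// expRN divff// gt_eqF.
have -> : 2 * `|x| * (expR (x ^+ 2) * `|F x|) = expR (x ^+ 2) * (2 * `|x| * `|F x|) by ring.
have -> : V = expR (x ^+ 2) * (V * G `|x|) by rewrite mulrCA EG mulr1.
rewrite (ler_wpM2l (ltW E0))// (le_trans h3)// (le_trans _ h4)// le_eqVlt; apply/orP; left; apply/eqP; ring.
Qed.

(** On [-1, 1] the factor exp (x^2) is at most e and the Gaussian tail at most sqrt pi. Outside,
    |psi| <= |2 x psi| <= V. *)
Lemma stein_sol_le x : `|stein_sol x| <= (expR 1 * Num.sqrt pi + 1) * V.
Proof.
have S0 : 0 <= Num.sqrt (pi : R) by exact: sqrtr_ge0.
have p0 : 0 <= expR 1 * Num.sqrt pi * V by rewrite !mulr_ge0 ?expR_ge0.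
have [x1|x1] := leP `|x| 1.
  rewrite /stein_sol normrM (ger0_norm (expR_ge0 _)) mulrDl mul1r.
  apply: (@le_trans _ _ (expR 1 * Num.sqrt pi * V)); last by rewrite lerDl.
  rewrite -mulrA ler_pM ?expR_ge0//.
    by rewrite ler_expR -(real_normK (num_real x)) expr_le1.
  by rewrite (le_trans (F_le x))// mulrC ler_wpM2r// gauss_tail_le.
have hx := mulr_stein_sol_le x; rewrite (normrM (2 * x)) (normrM 2) (ger0_norm (ler0n R 2)) in hx.
have x0 : 0 <= `|x| - 1 by rewrite subr_ge0 ltW.
have px := mulr_ge0 x0 (normr_ge0 (stein_sol x)).
have q0 := normr_ge0 (stein_sol x); rewrite mulrDl mul1r; lra.
Qed.

End SteinSolution.

(** Fatou's lemma, after replacing [f] by the lower limit of the sequence, which agrees with it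
    almost everywhere. *)
Lemma ge0_integral_ae_cvg_le d (T : measurableType d) (R : realType)
    (mu : {measure set T -> \bar R}) (f_ : nat -> T -> \bar R) (f : T -> \bar R) B :
  (forall k, measurable_fun [set: T] (f_ k)) -> measurable_fun [set: T] f ->
  (forall k x, 0 <= f_ k x)%E -> (forall x, 0 <= f x)%E ->
  {ae mu, forall x, f_ k x @[k --> \oo] --> f x} ->
  (forall k, \int[mu]_x f_ k x <= B)%E -> (\int[mu]_x f x <= B)%E.
Proof.
move=> mf_ mf f_0 f0 cvf fB.
rewrite (ge0_ae_eq_integral (g := fun x => limn_einf (f_ ^~ x)))//.
- apply: (le_trans (fatou mu measurableT mf_ (fun k x _ => f_0 k x))).
  rewrite limn_einf_lim; apply: lime_le; first exact: is_cvg_einfs.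
  apply: nearW => k; apply: le_trans (fB k).
  by apply: ereal_inf_lbound; exists k => //=.
- apply: (emeasurable_fun_cvg (fun k x => einfs (f_ ^~ x) k)).
    by move=> k; exact: measurable_fun_einfs.
  by move=> x _; rewrite limn_einf_lim; exact: is_cvg_einfs.
- move=> x _; rewrite limn_einf_lim; apply: lime_ge; first exact: is_cvg_einfs.
  by apply: nearW => k; apply: le_ereal_inf_tmp => _ [j _ <-].
- move: cvf; apply: filterS => x cx _ /=; rewrite is_cvg_limn_einfE; last by apply/cvg_ex; eexists; exact: cx.
  by apply/esym/cvg_lim.
Qed.

(** * Absolute continuity of H and passage to the limit *)

Section NullSets.
Context {R : realType}.
Local Notation lam := (@lebesgue_measure R).
Local Notation gam := (@normal_prob R 0 1).

(** |al| times the Lebesgue measure of the preimage agrees with Lebesgue measure on half-open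
    intervals, hence everywhere. A negative slope changes which endpoint is included, but not the
    length. *)
Lemma lebesgue_measure_affine_preimage0 (al c : R) (A : set R) :
  al != 0 -> measurable A -> lam A = 0%E -> lam ((fun x => al * x + c) @^-1` A) = 0%E.
Proof.
move=> al0 mA A0.
pose f := fun x : measurableTypeR R => (al * x + c : measurableTypeR R).
have mf : measurable_fun [set: measurableTypeR R] f.
  have : measurable_fun [set: R] (fun x : R => al * x + c).
    by apply: measurable_funD => //; apply: measurable_funM.
  by [].
pose pm : {measure set (measurableTypeR R) -> \bar R} :=
  measure_function_pushforward__canonical__measure_function_Measure lam mf.
pose nu := mscale (NngNum (normr_ge0 al)) pm.
have nuE (B : set (measurableTypeR R)) : nu B = (`|al|%:E * lam (f @^-1` B))%E by [].
have hitv (a b : R) : lam `]a, b]%classic = nu `]a, b]%classic.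
  rewrite nuE; case: (ltgtP al 0) al0 => // [al0|al0] _.
    have -> : f @^-1` `]a, b]%classic = `[(b - c) / al, (a - c) / al[%classic.
      apply/seteqP; split=> x; rewrite /= !in_itv/= /f => /andP[h1 h2]; apply/andP; split.
      - by rewrite ler_ndivrMr// mulrC; lra.
      - by rewrite ltr_ndivlMr// mulrC; lra.
      - by move: h2; rewrite ltr_ndivlMr// mulrC; lra.
      - by move: h1; rewrite ler_ndivrMr// mulrC; lra.
    rewrite !lebesgue_measure_itv/= !lte_fin ltr_ndivrMr// divfK ?lt_eqF// ltrD2r.
    rewrite ltr0_norm//; case: ifP => _; last by rewrite mule0.
    by rewrite -!EFinB -EFinM; congr EFin; field; rewrite lt_eqF.
  have -> : f @^-1` `]a, b]%classic = `](a - c) / al, (b - c) / al]%classic.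
    apply/seteqP; split=> x; rewrite /= !in_itv/= /f => /andP[h1 h2]; apply/andP; split.
    - by rewrite ltr_pdivrMr// mulrC; lra.
    - by rewrite ler_pdivlMr// mulrC; lra.
    - by move: h1; rewrite ltr_pdivrMr// mulrC; lra.
    - by move: h2; rewrite ler_pdivlMr// mulrC; lra.
  rewrite !lebesgue_measure_itv/= !lte_fin ltr_pdivrMr// divfK ?gt_eqF// ltrD2r.
  rewrite gtr0_norm//; case: ifP => _; last by rewrite mule0.
  by rewrite -!EFinB -EFinM; congr EFin; field; rewrite gt_eqF.
have : lam A = nu A.
  by apply: (lebesgue_measure_unique (mu := nu)) => // _ [[u v] _ <-]; exact: hitv.
rewrite A0 nuE => /esym {}A0.
move/eqP: A0; rewrite mule_eq0 => /orP[|/eqP //].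
by rewrite eqe normr_eq0 (negbTE al0).
Qed.

Lemma normal_prob_affine_preimage0 (al c : R) (A : set R) :
  al != 0 -> measurable A -> lam A = 0%E -> gam ((fun x => al * x + c) @^-1` A) = 0%E.
Proof.
move=> al0 mA A0.
have /null_content_dominatesP := @normal_prob_dominates R 0 1; apply.
  rewrite -[X in measurable X]setTI.
  have : measurable_fun [set: R] (fun x : R => al * x + c).
    by apply: measurable_funD => //; apply: measurable_funM.
  by apply.
exact: lebesgue_measure_affine_preimage0.
Qed.

Context (n : nat) (S : finType) (s0 : S) (p : 'I_n).
Local Notation X := (n.-tuple R).
Variables (a : S -> 'I_n -> R) (b kap h0 : R).
Hypothesis a2 : forall s p, a s p ^+ 2 = 1.
Hypothesis kap0 : kap != 0.
Variable mu : probability X R.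
Hypothesis gv : gauss_vec mu.
Local Notation Hs := (Hs a kap h0).
Local Notation gav := (gav a b kap h0).

(** Resampling the single coordinate [p] suffices: H is affine in it with slope [kap * a s p], which
    is nonzero, so the conditional probability already vanishes. *)
Lemma Hs_preimage0 s (A : set R) : measurable A -> lam A = 0%E ->
  mu (Hs s @^-1` A) = 0%E.
Proof.
move=> mA A0.
have mHA : measurable (Hs s @^-1` A).
  by rewrite -[X in measurable X]setTI; exact: (@measurable_Hs R n S a kap h0 s).
have -> : mu (Hs s @^-1` A) = (\int[mu]_y (\1_(Hs s @^-1` A) y)%:E)%E.
  by rewrite integral_indic// setIT.
rewrite (gv p (f := fun y => (\1_(Hs s @^-1` A) y)%:E)); last 2 first.
- exact/measurable_EFinP.
- by move=> y; rewrite lee_fin.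
apply: integral0_eq => y _.
pose c := kap * (Xs a s y - a s p * tnth y p) - h0.
have al0 : kap * a s p != 0.
  by rewrite mulf_neq0// -sqrf_eq0 a2 oner_neq0.
pose B := (fun x : R => kap * a s p * x + c) @^-1` A.
have mB : measurable B.
  have : measurable_fun [set: R] (fun x : R => kap * a s p * x + c).
    by apply: measurable_funD => //; apply: measurable_funM.
  by move=> h; rewrite -[X in measurable X]setTI; exact: h.
transitivity (\int[gam]_x (\1_B x)%:E)%E.
  apply: eq_integral => x _; rewrite !indicE; congr ((nat_of_bool _)%:R%:E).
  have e : Hs s (upd p x y) = kap * a s p * x + c by rewrite /Hs Xs_upd /c; ring.
  by apply/idP/idP => /set_mem h; apply/mem_set; move: h; rewrite /B /= e.
rewrite integral_indic// setIT; exact: normal_prob_affine_preimage0.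
Qed.

Lemma gav_sqr_cvg_le (v_ : nat -> R -> R) (v : R -> R) B :
  (forall k, measurable_fun [set: R] (v_ k)) -> measurable_fun [set: R] v ->
  {ae lam, forall x : R, v_ k x @[k --> \oo] --> v x} ->
  (forall k, \int[mu]_y (gav (fun=> 1) (v_ k) y ^+ 2)%:E <= B)%E ->
  (\int[mu]_y (gav (fun=> 1) v y ^+ 2)%:E <= B)%E.
Proof.
move=> mv_ mv [N [mN N0 subN]] hB.
have mg (w : R -> R) : measurable_fun [set: R] w ->
    measurable_fun [set: X] (fun y => (gav (fun=> 1) w y ^+ 2)%:E).
  by move=> mw; apply/measurable_EFinP; apply: measurable_funX; exact: (measurable_gav s0).
apply: (ge0_integral_ae_cvg_le (f_ := fun k y => (gav (fun=> 1) (v_ k) y ^+ 2)%:E)) => //.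
- by move=> k; exact: mg.
- exact: mg.
- by move=> k y; rewrite lee_fin sqr_ge0.
- by move=> y; rewrite lee_fin sqr_ge0.
have hN : {ae mu, forall y, forall s, ~ N (Hs s y)}.
  apply: filter_forall => s; exists (Hs s @^-1` N); split => //.
  - by rewrite -[X in measurable X]setTI; exact: (@measurable_Hs R n S a kap h0 s).
  - exact: Hs_preimage0.
  - by move=> y /= /contrapT.
move: hN; apply: filterS => y hy; apply: cvg_EFin; first exact: nearW.
have cs s : v_ k (Hs s y) @[k --> \oo] --> v (Hs s y).
  by apply: contrapT => nc; apply: (hy s); exact: subN.
have cg : gav (fun=> 1) (v_ k) y @[k --> \oo] --> gav (fun=> 1) v y.
  rewrite /gav; elim: (index_enum S) => [|s r IH].
    by rewrite big_nil; under eq_fun do rewrite big_nil; exact: cvg_cst.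
  rewrite big_cons; under eq_fun do rewrite big_cons.
  apply: cvgD => //; apply: cvgM; last exact: cvg_cst.
  by apply: cvgM; [exact: cvg_cst|exact: cs].
by rewrite expr2; under eq_fun do rewrite expr2; exact: cvgM.
Qed.

End NullSets.

(** * The bound for the Sherrington-Kirkpatrick model *)

Section Assembly.
Context {R : realType}.
Local Notation lam := (@lebesgue_measure R).

(** [stein_bound] with kap^2 <= kap and b^2 <= kap: 24 = 16 + 8 and 192 = 16 * (1 + 10) + 16. *)
Definition core_cst (beta : R) : R :=
  24 + 192 * overlap_cst beta.

(** Large enough for psi, with constant e sqrt pi + 1, and for psi' = 2 x psi + v, with constant
    2. *)
Definition stein_cst : R := expR 1 * Num.sqrt pi + 3.

Variables (N : nat) (beta : R).
Hypothesis N0 : (0 < N)%N.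
Hypothesis beta01 : 0 < beta < 1.
Local Notation n := #|pairs N|.
Local Notation X := (n.-tuple R).
Variable mu : probability X R.
Hypothesis gv : gauss_vec mu.

Let kap : R := N%:R^-1.
Let b : R := beta / Num.sqrt N%:R.
Let h0 : R := Num.sqrt N%:R * beta / 2.
Let s0 : {ffun 'I_N -> bool} := [ffun=> true].
Local Notation a := (@pspin R N).
Local Notation gav := (gav a b kap h0).
Local Notation Hs := (Hs a kap h0).
Local Notation one := (fun _ : {ffun 'I_N -> bool} => 1 : R).
Local Notation S1 := (overlap_cst beta).

Let NR0 : 0 < N%:R :> R. Proof. by rewrite ltr0n. Qed.
Let sN0 : 0 < Num.sqrt (N%:R : R). Proof. by rewrite sqrtr_gt0. Qed.
Let sN2 : Num.sqrt (N%:R : R) ^+ 2 = N%:R. Proof. by rewrite sqr_sqrtr// ltW. Qed.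
Let kap0 : 0 < kap. Proof. by rewrite invr_gt0. Qed.
Let kap1 : kap <= 1. Proof. by rewrite invf_le1// ler1n. Qed.

Let b2 : b ^+ 2 = beta ^+ 2 * kap.
Proof. by rewrite /b exprMn exprVn sN2. Qed.

Let nk : 2 * n%:R * kap ^+ 2 = 1 - kap.
Proof. by rewrite card_pairs /kap; field; rewrite gt_eqF. Qed.

Let nkb : n%:R * kap * b = h0 - b / 2.
Proof.
apply: (@mulfI _ (2 * Num.sqrt N%:R)); first by rewrite mulf_neq0// gt_eqF.
have -> : 2 * Num.sqrt N%:R * (n%:R * kap * b) = (2 * n%:R) * kap * beta.
  by rewrite /b; field; rewrite gt_eqF.
have -> : 2 * Num.sqrt N%:R * (h0 - b / 2) = Num.sqrt N%:R ^+ 2 * beta - beta.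
  by rewrite /b /h0; field; rewrite gt_eqF.
by rewrite card_pairs sN2 /kap; field; rewrite gt_eqF.
Qed.

Let overlap_le : kap ^+ 2 * Ex mu (av2 a b (fun s t => Qst a s t ^+ 2)) <= S1.
Proof.
apply: (overlap_bound s0 (@pspin_sqr R N) gv beta01 kap0 b2 nk).
  exact: Qst_pspin_ge.
exact: sum_expR_Qst_le.
Qed.

Let S10 : 0 <= S1.
Proof.
apply: le_trans overlap_le; rewrite mulr_ge0 ?sqr_ge0// Ex_ge0// => y.
by apply: (av2_ge0 s0) => s t; exact: sqr_ge0.
Qed.

Lemma core_cst_ge0 : 0 <= core_cst beta.
Proof. by rewrite /core_cst addr_ge0// mulr_ge0. Qed.

Lemma gav_stein_C2 (psi psi1 psi2 : R -> R) K K2 :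
  (forall x : R, is_derive x 1 psi (psi1 x)) ->
  (forall x : R, is_derive x 1 psi1 (psi2 x)) -> continuous psi2 ->
  (forall x, `|psi x| <= K) -> (forall x, `|psi1 x| <= K) ->
  (forall x, `|psi2 x| <= K2) ->
  (\int[mu]_y (gav one (fun x => psi1 x - 2 * x * psi x)%R y ^+ 2)%:E <=
   (core_cst beta * K ^+ 2 / N%:R)%:E)%E.
Proof.
move=> d1 d2 c2 k1 k2 k3.
have cont (f f1 : R -> R) : (forall x : R, is_derive x 1 f (f1 x)) ->
    measurable_fun [set: R] f.
  move=> df; apply: continuous_measurable_fun => x.
  apply/differentiable_continuous/derivable1_diffP.
  by have ? := df x; exact: ex_derive.
have m1 := cont _ _ d1; have m2 := cont _ _ d2.
have egHs s : eg (Hs s).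
  apply: egB; last exact: eg_cst.
  apply: egZ; apply: eg_sum => p _; apply: egZ; exact: eg_tnth.
have egth (th : R -> R) s : measurable_fun [set: R] th -> (forall x, `|th x| <= K) ->
    eg (fun y => th (Hs s y)).
  move=> mth hth; apply: (eg_bounded (a := K)) => //.
  by apply: measurableT_comp => //; exact: measurable_Hs.
have egg : eg (gav one (fun x => psi1 x - 2 * x * psi x)).
  apply: eg_sum => s _; apply: egM; last exact: (eg_gw s0).
  apply: egZ; apply: egB; first exact: egth.
  by apply: egM; [exact: egZ|exact: egth].
rewrite -(ExE gv (egX 2 egg)) lee_fin.
apply: (le_trans (stein_bound s0 (@pspin_sqr R N) gv d1 d2 c2 k1 k2 k3
  (ltW kap0) nkb nk overlap_le)).
have -> : core_cst beta * K ^+ 2 / N%:R = K ^+ 2 * (kap * core_cst beta).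
  by rewrite /kap; ring.
apply: ler_wpM2l; first exact: sqr_ge0.
have hk : kap ^+ 2 <= kap by rewrite expr2 ler_piMr// ltW.
have hb : b ^+ 2 <= kap.
  move: beta01 => /andP[h1 h2]; rewrite b2 ler_piMl ?(ltW kap0)// expr_le1 ?ltW//.
have h3 := ler_wpM2r S10 hk; have h4 := ler_wpM2r S10 hb.
rewrite /core_cst; lra.
Qed.

(* For N = 1 there are no pairs and H is deterministic, hence [0 < n]. *)
Lemma gav_stein_C1 (psi psi1 : R -> R) K : (0 < n)%N ->
  (forall x : R, is_derive x 1 psi (psi1 x)) -> continuous psi1 ->
  (forall x, `|psi x| <= K) -> (forall x, `|psi1 x| <= K) ->
  (\int[mu]_y (gav one (fun x => psi1 x - 2 * x * psi x)%R y ^+ 2)%:E <=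
   (core_cst beta * K ^+ 2 / N%:R)%:E)%E.
Proof.
move=> n0 d1 c1 k1 k2.
have cpsi : continuous psi.
  move=> x; apply/differentiable_continuous/derivable1_diffP.
  by have ? := d1 x; exact: ex_derive.
have mpsi : measurable_fun [set: R] psi by exact: continuous_measurable_fun.
have mpsi1 : measurable_fun [set: R] psi1 by exact: continuous_measurable_fun.
(* Averaging psi over a window of length h makes it C^2 and preserves the bounds [K] on it and its
   derivative. The second derivative is only bounded by 2 K / h, which is harmless in
   [gav_stein_C2]. *)
pose h k : R := k.+1%:R^-1.
have hp k : 0 < h k by rewrite invr_gt0.
have dshift (f f1 : R -> R) c : (forall x : R, is_derive x 1 f (f1 x)) ->
    forall x : R, is_derive x 1 (fun x => f (x + c)) (f1 (x + c)).
  move=> df x; have hd := df (x + c).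
  have hs : is_derive x 1 (fun z : R => z + c) (1 : R).
    by apply: is_derive_eq; rewrite addr0.
  by rewrite -[f1 _]mulr1; exact: (@is_derive1_comp _ f (fun z => z + c) x _ _ hd hs).
have cravg k : continuous (ravg (h k) psi) by exact: continuous_ravg mpsi k1 _ (hp k).
have cq (f : R -> R) k : continuous f -> continuous (fun x => (h k)^-1 * (f (x + h k) - f x)).
  move=> cf x; apply: cvgM; first exact: cvg_cst.
  apply: cvgB; last exact: cf.
  apply: (@continuous_comp _ _ _ (fun x => x + h k) f); last exact: cf.
  by apply: cvgD; [exact: cvg_id|exact: cvg_cst].
apply: (gav_sqr_cvg_le (v_ := fun k x =>
  (h k)^-1 * (psi (x + h k) - psi x) - 2 * x * ravg (h k) psi x) s0 (Ordinal n0)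
  (@pspin_sqr R N) (lt0r_neq0 kap0) gv).
- move=> k; apply: measurable_funB.
    by apply: continuous_measurable_fun; exact: cq.
  apply: measurable_funM; first by apply: measurable_funM.
  exact: continuous_measurable_fun.
- by apply: measurable_funB => //; apply: measurable_funM => //; apply: measurable_funM.
- apply: aeW => x.
  apply: cvgB.
    have [dx ex] : derivable psi x 1 /\ derive1 psi x = psi1 x.
      by have ? := d1 x; split; [exact: ex_derive|rewrite derive1E derive_val].
    have hE k : (h k)^-1 * (psi (x + h k) - psi x) =
        k.+1%:R * (psi (x + k.+1%:R^-1) - psi x) by rewrite /h invrK.
    under eq_fun do rewrite hE.
    by have := derivable_quotient_cvg dx; rewrite ex.
  by apply: cvgM; [exact: cvg_cst|exact: ravg_cvg mpsi k1 _ cpsi].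
- move=> k.
  have d1k := is_derive_ravg mpsi k1 (hp k) cpsi.
  have d2k (x : R) : is_derive x 1 (fun x => (h k)^-1 * (psi (x + h k) - psi x))
      ((h k)^-1 * (psi1 (x + h k) - psi1 x)).
    exact: (is_deriveZ ((h k)^-1) (is_deriveB (dshift _ _ (h k) d1 x) (d1 x))).
  apply: (gav_stein_C2 (K2 := (h k)^-1 * (K + K)) d1k d2k).
  + exact: cq.
  + by move=> x; exact: ravg_bound mpsi k1 _ _ (hp k).
  + move=> x; rewrite normrM gtr0_norm ?invr_gt0// ler_pdivrMl// mulrC.
    have := is_derive_lipschitz d1 k2 (x + h k) x.
    by rewrite [x + _ - x]addrAC subrr add0r (gtr0_norm (hp k)).
  + move=> x; rewrite normrM gtr0_norm ?invr_gt0// ler_wpM2l ?invr_ge0 ?(ltW (hp k))//.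
    by rewrite (le_trans (ler_normB _ _))// lerD.
Qed.

Definition gauss_mean (u : R -> R) : R := \int[lam]_t (u t * phi_half t).

Let spi : 0 < Num.sqrt (pi : R). Proof. by rewrite sqrtr_gt0 pi_gt0. Qed.

Let phiE t : phi_half t = (Num.sqrt pi)^-1 * gauss_fun t :> R.
Proof. by []. Qed.

Section Mean.
Variables (u : R -> R) (M : R).
Hypothesis mu_ : measurable_fun [set: R] u.
Hypothesis uM : forall t, `|u t| <= M.

Lemma integrable_mul_phi :
  lam.-integrable [set: R] (fun t => (u t * phi_half t)%:E).
Proof.
have mphi : measurable_fun [set: R] (@phi_half R).
  by apply: measurable_funM => //; exact: measurable_gauss_fun.
have iM : lam.-integrable [set: R] (fun t => (M * (Num.sqrt pi)^-1 * gauss_fun t)%:E).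
  exact: (integrableZl measurableT (M * (Num.sqrt pi)^-1) (@integrableT_gauss R)).
apply: le_integrable iM => //.
- by apply/measurable_EFinP; exact: measurable_funM.
- move=> t _ /=; rewrite lee_fin phiE normrM -mulrA [leRHS]normrM.
  by rewrite ler_wpM2r// (le_trans (uM t))// ler_norm.
Qed.

Lemma integral_gauss1 : \int[lam]_t gauss_fun t = Num.sqrt pi :> R.
Proof. by rewrite /Rintegral integralT_gauss. Qed.

Lemma gauss_mean_le : `|gauss_mean u| <= M.
Proof.
rewrite /gauss_mean (le_trans (le_normr_Rintegral _ integrable_mul_phi))//.
have iM : lam.-integrable [set: R] (fun t => (M * (Num.sqrt pi)^-1 * gauss_fun t)%:E).
  exact: (integrableZl measurableT (M * (Num.sqrt pi)^-1) (@integrableT_gauss R)).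
have -> : M = \int[lam]_t (M * (Num.sqrt pi)^-1 * gauss_fun t).
  rewrite RintegralZl//; last exact: integrableT_gauss.
  by rewrite integral_gauss1 divfK// gt_eqF.
have iabs : lam.-integrable [set: R] (fun t => (`|u t * phi_half t|)%:E).
  exact: integrable_abse integrable_mul_phi.
apply: le_Rintegral => // t _.
rewrite phiE normrM -mulrA ler_pM//.
by rewrite ger0_norm// mulr_ge0 ?gauss_fun_ge0// invr_ge0 ltW.
Qed.

Lemma centered_gauss_mean : \int[lam]_t ((u t - gauss_mean u) * gauss_fun t) = 0.
Proof.
have e t : (u t - gauss_mean u) * gauss_fun t =
    Num.sqrt pi * (u t * phi_half t) - gauss_mean u * gauss_fun t.
  by rewrite phiE; field; rewrite gt_eqF.
under eq_Rintegral do rewrite e.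
rewrite RintegralB//; last 2 first.
- exact: (integrableZl measurableT (Num.sqrt pi) integrable_mul_phi).
- exact: (integrableZl measurableT (gauss_mean u) (@integrableT_gauss R)).
rewrite (RintegralZl _ measurableT integrable_mul_phi) (RintegralZl _ measurableT (@integrableT_gauss R)).
by rewrite integral_gauss1 mulrC subrr.
Qed.

End Mean.

Lemma gav_bound_continuous (u : R -> R) M : (0 < n)%N -> continuous u ->
  (forall t, `|u t| <= M) ->
  (\int[mu]_y (gav one (fun x => u x - gauss_mean u)%R y ^+ 2)%:E <=
   (core_cst beta * (stein_cst * (2 * M)) ^+ 2 / N%:R)%:E)%E.
Proof.
move=> n0 cu uM; have mu_ : measurable_fun [set: R] u by exact: continuous_measurable_fun.
pose v x := u x - gauss_mean u.
have cv : continuous v by move=> x; apply: cvgB; [exact: cu|exact: cvg_cst].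
have vV x : `|v x| <= 2 * M.
  rewrite (le_trans (ler_normB _ _))// mulr_natl mulr2n lerD//.
  exact: gauss_mean_le.
have v0 := centered_gauss_mean mu_ uM.
pose psi := stein_sol v.
have M0 : 0 <= 2 * M by exact: le_trans (normr_ge0 _) (vV 0).
have e : (fun x => u x - gauss_mean u) =
    fun x => (2 * x * psi x + v x) - 2 * x * psi x.
  by apply/funext => x; rewrite /v; ring.
have dpsi := is_derive_stein_sol cv vV.
have cpsi : continuous psi.
  move=> x; apply/differentiable_continuous/derivable1_diffP.
  by have ? := dpsi x; exact: ex_derive.
rewrite e; apply: (@gav_stein_C1 psi (fun x => 2 * x * psi x + v x)) => //.
- move=> x; apply: cvgD; last exact: cv.
  by apply: cvgM; [apply: cvgM; [exact: cvg_cst|exact: cvg_id]|exact: cpsi].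
- move=> x; apply: le_trans (stein_sol_le cv vV v0 x) _.
  by apply: ler_wpM2r => //; rewrite /stein_cst; lra.
- move=> x; rewrite (le_trans (ler_normD _ _))//.
  apply: le_trans (lerD (mulr_stein_sol_le cv vV v0 x) (vV x)) _.
  have -> : 2 * M + 2 * M = 2 * (2 * M) by ring.
  apply: ler_wpM2r => //; rewrite /stein_cst.
  have : 0 <= expR 1 * Num.sqrt pi :> R by rewrite mulr_ge0 ?expR_ge0.
  lra.
Qed.

Lemma gav_bound_measurable (u : R -> R) M : (0 < n)%N -> measurable_fun [set: R] u ->
  (forall t, `|u t| <= M) ->
  (\int[mu]_y (gav one (fun x => u x - gauss_mean u)%R y ^+ 2)%:E <=
   (core_cst beta * (stein_cst * (2 * M)) ^+ 2 / N%:R)%:E)%E.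
Proof.
move=> n0 mu_ uM.
pose uk k := ravg (k.+1%:R^-1) u.
have hp k : (0 : R) < k.+1%:R^-1 by rewrite invr_gt0.
have cuk k : continuous (uk k) by exact: continuous_ravg mu_ uM _ (hp k).
have muk k : measurable_fun [set: R] (uk k) by exact: continuous_measurable_fun.
have ukM k t : `|uk k t| <= M by exact: ravg_bound mu_ uM _ _ (hp k).
have cvae := ravg_cvg_ae mu_ uM.
have mphi : measurable_fun [set: R] (@phi_half R).
  by apply: measurable_funM => //; exact: measurable_gauss_fun.
have phi0 t : 0 <= phi_half t :> R.
  by rewrite phiE mulr_ge0 ?gauss_fun_ge0// invr_ge0 ltW.
have cmean : gauss_mean (uk k) @[k --> \oo] --> gauss_mean u.
  have iM := @integrable_mul_phi (cst M) `|M| (measurable_cst M) (fun _ => lexx _).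
  have dae : {ae lam, forall x : R, [set: R] x ->
      (uk k x * phi_half x)%:E @[k --> \oo] --> (u x * phi_half x)%:E}.
    move: cvae; apply: filterS; first exact: (ae_filter_ringOfSetsType lam).
    move=> x cx _; apply: cvg_EFin; first exact: nearW.
    by apply: cvgM => //; exact: cvg_cst.
  have dom : {ae lam, forall x : R, forall k, [set: R] x ->
      (`|(uk k x * phi_half x)%:E| <= (M * phi_half x)%:E)%E}.
    apply: aeW => x k _ /=; rewrite lee_fin normrM (ger0_norm (phi0 x)).
    by rewrite ler_wpM2r.
  have [_ _ c] := @dominated_convergence _ (measurableTypeR R) R lam setT measurableT
    (fun k t => (uk k t * phi_half t)%:E) (fun t => (u t * phi_half t)%:E)
    (fun t => (M * phi_half t)%:E)
    (fun k => iffRL (measurable_EFinP _ _) (measurable_funM (muk k) mphi))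
    (iffRL (measurable_EFinP _ _) (measurable_funM mu_ mphi)) dae iM dom.
  have fu : (\int[lam]_t (u t * phi_half t)%:E)%E \is a fin_num.
    exact: integrable_fin_num (integrable_mul_phi mu_ uM).
  by apply: fine_cvg; rewrite fineK.
apply: (gav_sqr_cvg_le (v_ := fun k x => uk k x - gauss_mean (uk k)) s0 (Ordinal n0)
  (@pspin_sqr R N) (lt0r_neq0 kap0) gv).
- by move=> k; exact: measurable_funB.
- exact: measurable_funB.
- move: cvae; apply: filterS; first exact: (ae_filter_ringOfSetsType lam).
  by move=> x cx; apply: cvgB.
- by move=> k; apply: gav_bound_continuous.
Qed.

End Assembly.

(** * Translation of the disorder into a Gaussian vector *)

Section Disorder.
Context {R : realType} (d : measure_display) (T : measurableType d).
Variables (P : probability T R) (N : nat) (g : 'I_N -> 'I_N -> T -> R).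
Hypothesis g_gauss : disorder_std_gaussian P g.
Hypothesis g_indep : disorder_independent P g.
Local Notation n := #|pairs N|.

Definition pair_disorder (k : 'I_n) : T -> R := g (enum_val k).1 (enum_val k).2.

Lemma enum_val_pairs (k : 'I_n) : ((enum_val k).1 < (enum_val k).2)%N.
Proof. by have := enum_valP k; rewrite inE. Qed.

Lemma gauss_vec_of_disorder :
  exists mu : probability (n.-tuple R) R, gauss_vec mu /\
    forall f : n.-tuple R -> \bar R,
      measurable_fun [set: n.-tuple R] f -> (forall y, 0 <= f y)%E ->
      (\int[mu]_y f y = \int[P]_w f [tuple pair_disorder k w | k < n])%E.
Proof.
apply: gauss_vec_of_indep => [k|A mA].
  by have [] := g_gauss (enum_val_pairs k).
(* Moves the sets from coordinates to pairs: the intersection has one term at a pair i < j and is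
   empty, hence the full line, elsewhere. *)
pose A' (p : 'I_N * 'I_N) : set R := \bigcap_(k in [set k | enum_val k = p]) A k.
have A'E k : A' (enum_val k) = A k.
  apply/seteqP; split=> x; first by apply.
  by move=> Ax j /= /enum_val_inj ->.
have mA' p : measurable (A' p).
  by apply: fin_bigcap_measurable => // k _; exact: mA.
have := @g_indep (pairs N) A' _ mA'.
have -> : \bigcap_(p in [set q | q \in pairs N]) (g p.1 p.2 @^-1` A' p) =
    \bigcap_(k in [set: 'I_n]) (pair_disorder k @^-1` A k).
  apply/seteqP; split=> w h.
    by move=> k _ /=; rewrite -A'E; apply: h; exact: enum_valP.
  move=> p pJ /=; rewrite -(enum_rankK_in pJ pJ) A'E; exact: h.
move=> ->; last by move=> p; rewrite inE.
etransitivity; first exact: big_enum_val.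
apply: eq_bigr => k _ /=; rewrite A'E.
by have [_ ->] := g_gauss (enum_val_pairs k).
Qed.

Lemma pair_energy_disorder (s : {ffun 'I_N -> bool}) w :
  pair_energy (fun i j => g i j w) s =
  Xs (@pspin R N) s [tuple pair_disorder k w | k < n].
Proof.
rewrite /pair_energy /Xs.
rewrite -(sum_pairs (fun p => g p.1 p.2 w * spin s p.1 * spin s p.2)).
by apply: eq_bigr => k _; rewrite tnth_mktuple /pspin /pair_disorder; ring.
Qed.

Lemma centered_gibbs_avg (beta : R) (u : R -> R) c w :
  gibbs_avg beta 0 (fun i j => g i j w)
    (fun s => u (Hstat beta (fun i j => g i j w) s)) - c =
  gav (@pspin R N) (beta / Num.sqrt N%:R) N%:R^-1 (Num.sqrt N%:R * beta / 2)
    (fun=> 1) (fun x => u x - c) [tuple pair_disorder k w | k < n].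
Proof.
set y := [tuple _ | _ < _].
have gwE (s : {ffun 'I_N -> bool}) :
    gibbs_weight beta 0 (fun i j => g i j w) s =
    Ws (@pspin R N) (beta / Num.sqrt N%:R) s y.
  by rewrite /gibbs_weight mul0r addr0 pair_energy_disorder.
have ZE : partition_fun beta 0 (fun i j => g i j w) =
    Zs (@pspin R N) (beta / Num.sqrt N%:R) y by apply: eq_bigr => s _; exact: gwE.
have cE : c = \sum_s c * gw (@pspin R N) (beta / Num.sqrt N%:R) s y.
  by rewrite -mulr_sumr (gw_sum [ffun=> true]) mulr1.
rewrite [X in _ - X]cE /gibbs_avg -sumrB; apply: eq_bigr => s _.
by rewrite gwE ZE /Hstat pair_energy_disorder mul1r mulrBl.
Qed.

End Disorder.

Lemma le_sup_norm (R : realType) (u : R -> R) t :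
  (exists M, forall t, `|u t| <= M) -> `|u t| <= sup_norm u.
Proof.
move=> [M uM]; apply: sup_upper_bound; last by exists t.
by split; [exists `|u 0|, 0|exists M => _ [x _ <-]].
Qed.

Theorem theorem1p6 (R : realType) (beta : R) :
  0 < beta < 1 ->
  exists C : R,
    forall (N : nat) (d : measure_display) (T : measurableType d)
           (P : probability T R) (g : 'I_N -> 'I_N -> T -> R),
      (0 < N)%N ->
      disorder_std_gaussian P g ->
      disorder_independent P g ->
      forall u : R -> R,
        measurable_fun [set: R] u ->
        (exists M : R, forall t, `|u t| <= M) ->
        ('E_P[fun w =>
            ((gibbs_avg beta 0 (fun i j => g i j w) (fun s => u (Hstat beta (fun i j => g i j w) s))
             - \int[lebesgue_measure]_t (u t * phi_half t)) ^+ 2)%R]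
         <= (C * sup_norm u ^+ 2 / N%:R)%:E)%E.
Proof.
(* The factor 4 [stein_cst]^2 comes from |u - int u phi| <= 2 ||u||; the final 4 covers the case
   without pairs. *)
move=> beta01; exists (core_cst beta * (4 * stein_cst ^+ 2) + 4).
move=> N d T P g N0 gauss indep u mu_ ub.
have uM t : `|u t| <= sup_norm u by exact: le_sup_norm.
have [mu [gv muE]] := gauss_vec_of_disorder gauss indep.
have core0 := core_cst_ge0 N0 beta01 gv.
pose v x := u x - gauss_mean u.
have mv : measurable_fun [set: R] v by exact: measurable_funB.
pose s0 : {ffun 'I_N -> bool} := [ffun=> true].
pose F (y : #|pairs N|.-tuple R) := gav (@pspin R N) (beta / Num.sqrt N%:R) N%:R^-1
  (Num.sqrt N%:R * beta / 2) (fun=> 1) v y ^+ 2.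
have mF : measurable_fun [set: #|pairs N|.-tuple R] (fun y => (F y)%:E).
  by apply/measurable_EFinP; apply: measurable_funX; exact: (measurable_gav s0).
rewrite unlock.
under eq_integral do rewrite centered_gibbs_avg.
rewrite -(muE (fun y => (F y)%:E) mF) => [|y]; last by rewrite lee_fin sqr_ge0.
have M2 : 0 <= sup_norm u ^+ 2 by exact: sqr_ge0.
(* Without pairs N is 1, and the trivial bound (2 ||u||)^2 already has the required form. *)
have [n0|n0] := posnP #|pairs N|; last first.
  apply: (le_trans (gav_bound_measurable N0 beta01 gv n0 mu_ uM)).
  rewrite lee_fin ler_wpM2r ?invr_ge0//.
  have -> : core_cst beta * (stein_cst * (2 * sup_norm u)) ^+ 2 =
    core_cst beta * (4 * stein_cst ^+ 2) * sup_norm u ^+ 2 by ring.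
  by rewrite [leRHS]mulrDl lerDl mulr_ge0.
have N1 : N%:R = 1 :> R.
  have := card_pairs (R := R) N; rewrite n0 mulr0 => /esym/eqP.
  by rewrite expr2 -[X in _ - X]mul1r -mulrBl mulf_eq0 subr_eq0 pnatr_eq0 (gtn_eqF N0) orbF => /eqP.
have vM x : `|v x| <= 2 * sup_norm u.
  rewrite (le_trans (ler_normB _ _))// mulr_natl mulr2n lerD//.
  exact: gauss_mean_le.
have FM y : F y <= 4 * sup_norm u ^+ 2.
  rewrite /F -real_normK ?num_real//.
  have -> : 4 * sup_norm u ^+ 2 = (1 * (2 * sup_norm u)) ^+ 2 by ring.
  rewrite lerXn2r ?nnegrE//; first by rewrite mul1r (le_trans (normr_ge0 _) (vM 0)).
  by apply: (gav_bound s0) => // s; rewrite normr1.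
apply: (@le_trans _ _ (\int[mu]_y (4 * sup_norm u ^+ 2)%:E)%E).
  by apply: ge0_le_integral => // y _; rewrite lee_fin ?sqr_ge0// mulr_ge0.
rewrite integral_cst// [X in (_ * X)%E]probability_setT mule1 lee_fin N1 divr1.
by rewrite [leRHS]mulrDl lerDr mulr_ge0// mulr_ge0// mulr_ge0// sqr_ge0.
Qed.
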